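(* Let $\Omega\subseteq\mathbb{R}^n$ be a bounded $C^2$ domain with boundary $\partial\Omega$, and let $p:\Omega\to(1,\infty)$, $p\in C(\Omega)$, satisfy $p_-=\inf_{x\in\Omega}p(x)>n$ (the possibility $p_+=\sup_{x\in\Omega}p(x)=\infty$ is allowed). Then for any $\varphi\in W^{1,p}(\Omega)$ such that $\int_\Omega\frac{|\nabla\varphi|^{p}}{p}dx<\infty$, there exists a unique weak solution $u\in W^{1,p}(\Omega)$ of the Dirichlet problem $$\begin{cases}\Delta_pu=\operatorname{div}(|\nabla u|^{p(x)-2}\nabla u)=0 & \text{in }\Omega,\\ u|_{\partial\Omega}=\varphi\end{cases}$$ that satisfies $\int_\Omega (p(x))^{-1}|\nabla u(x)|^{p(x)}dx<\infty$ and such that the inequality $$\int_\Omega|\nabla u(x)|^{p(x)-2}\,\nabla u(x)\cdot\nabla(u+v-\varphi)(x)\,dx\le0$$ holds for every $v\in U^{1,p}_0(\Omega)$ such that $\int_\Omega(p(x))^{-1}|\nabla(v-\varphi)(x)|^{p(x)}dx<\infty$. Here ''weak solution'' means that $$\int_\Omega|\nabla u|^{p-2}\nabla u\cdot\nabla\phi\,dx=0\quad\text{for all }\phi\in W^{1,p}_{comp}(\Omega),$$ and the boundary condition $u|_{\partial\Omega}=\varphi$ means $u-\varphi\in U^{1,p}_0(\Omega)$.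
   Context: For a Borel measurable $p:\Omega\to[1,\infty)$ (possibly $\sup_\Omega p=\infty$), $L^p(\Omega)$ is the set of measurable $f$ with $\int_\Omega|\lambda f(x)|^{p(x)}dx<\infty$ for some $\lambda>0$; $W^{1,p}(\Omega)$ is the set of $f\in L^p(\Omega)$ whose first-order weak derivatives also lie in $L^p(\Omega)$. Put $\rho_p(f)=\int_\Omega \frac{|f(x)|^{p(x)}}{p(x)}dx$ and $\rho_{1,p}(f)=\rho_p(f)+\rho_p(|\nabla f|)$. Modular topology: a set $A\subseteq W^{1,p}(\Omega)$ is $\rho_{1,p}$-closed iff whenever $(f_k)\subseteq A$, $f\in W^{1,p}(\Omega)$ and $\rho_{1,p}(f_k-f)\to0$, then $f\in A$. These are the closed sets of a topology; $\rho_{1,p}$-closures are taken in it. $W^{1,p}_{comp}(\Omega)$ is the set of $v\in W^{1,p}(\Omega)$ with compact support in $\Omega$, and $U^{1,p}_0(\Omega)$ is the $\rho_{1,p}$-closure of $W^{1,p}_{comp}(\Omega)$ in $W^{1,p}(\Omega)$. *)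

(* Defs.v *)
From HB Require Import structures.
From mathcomp Require Import all_boot all_order all_algebra.
From mathcomp Require Import all_classical all_reals all_analysis.

Set Implicit Arguments.
Unset Strict Implicit.
Unset Printing Implicit Defensive.

Import Order.TTheory GRing.Theory Num.Theory.
Import numFieldNormedType.Exports.

Local Open Scope classical_set_scope.
Local Open Scope ring_scope.

Definition rV_display : measure_display.
Proof. exact: default_measure_display. Qed.

(** The Borel sigma-algebra of R^n, generated by the coordinate functions. *)
Section measurable_rV.
Context {R : realType} (n : nat).

Definition rV_coord (i : 'I_n) (x : 'rV[R]_n) : R := x ord0 i.

Let rV_set0 : g_sigma_preimage rV_coord set0.
Proof. exact: sigma_algebra0. Qed.

Let rV_setC A : g_sigma_preimage rV_coord A -> g_sigma_preimage rV_coord (~` A).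
Proof. exact: sigma_algebraC. Qed.

Let rV_bigcup (F : (set 'rV[R]_n)^nat) :
  (forall i, g_sigma_preimage rV_coord (F i)) ->
  g_sigma_preimage rV_coord (\bigcup_i (F i)).
Proof. exact: sigma_algebra_bigcup. Qed.

HB.instance Definition _ := @isMeasurable.Build rV_display
  'rV[R]_n (g_sigma_preimage rV_coord) rV_set0 rV_setC rV_bigcup.

End measurable_rV.

Section rV_cons.
Context {R : realType}.

Lemma measurable_rV_coord n (i : 'I_n) :
  measurable_fun setT (@rV_coord R n i).
Proof.
move=> _ Y mY; rewrite setTI; apply: sub_sigma_algebra => /=.
rewrite -bigcup_seq/=; exists i => /=; first by rewrite mem_index_enum.
by exists Y => //; rewrite setTI.
Qed.

Lemma measurable_fun_rV d (T : measurableType d) n (f : T -> 'rV[R]_n) :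
  (forall i, measurable_fun setT (fun x => f x ord0 i)) ->
  measurable_fun setT f.
Proof.
move=> mf _ Y; apply: (@smallest_sub _ (sigma_algebra setT) _
  [set Y | measurable (setT `&` f @^-1` Y)]); last first.
  rewrite -bigcup_seq => B [i _ [A mA <-]].
  by have := mf i measurableT A mA; rewrite /= !setTI.
split => /=.
- by rewrite preimage_set0 setI0.
- move=> A /=; rewrite !setTI setTD preimage_setC; exact: measurableC.
- move=> F mF; rewrite setTI preimage_bigcup; apply: bigcup_measurable => k _.
  by have := mF k; rewrite setTI.
Qed.

Definition rV_cons n (z : R * 'rV[R]_n) : 'rV[R]_n.+1 :=
  \row_i oapp (z.2 ord0) z.1 (unlift ord0 i).

Definition rV_uncons n (x : 'rV[R]_n.+1) : R * 'rV[R]_n :=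
  (x ord0 ord0, col' ord0 x).

Lemma rV_cons0 n (z : R * 'rV[R]_n) : rV_cons z ord0 ord0 = z.1.
Proof.
by rewrite mxE unlift_none.
Qed.

Lemma rV_consS n (z : R * 'rV[R]_n) (j : 'I_n) :
  rV_cons z ord0 (lift ord0 j) = z.2 ord0 j.
Proof.
by rewrite mxE liftK.
Qed.

Lemma rV_consK n : cancel (@rV_cons n) (@rV_uncons n).
Proof.
case=> a v; rewrite /rV_uncons rV_cons0; congr pair.
by apply/rowP => j; rewrite mxE rV_consS.
Qed.

Lemma measurable_rV_cons n :
  measurable_fun setT (@rV_cons n : measurableTypeR R * 'rV[R]_n -> 'rV[R]_n.+1).
Proof.
apply: measurable_fun_rV => i; case: (unliftP ord0 i) => [j|] ->.
  under eq_fun do rewrite rV_consS.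
  exact: (measurableT_comp (measurable_rV_coord j)).
by under eq_fun do rewrite rV_cons0; exact: measurable_fst.
Qed.

Lemma measurable_rV_uncons n :
  measurable_fun setT (@rV_uncons n : 'rV[R]_n.+1 -> measurableTypeR R * 'rV[R]_n).
Proof.
apply/measurable_fun_pairP; split; first exact: measurable_rV_coord.
apply: measurable_fun_rV => j.
under eq_fun do rewrite /= mxE.
exact: measurable_rV_coord.
Qed.

End rV_cons.

Section lebesgue_rV_step.
Local Open Scope ereal_scope.
Context {R : realType} (n : nat).
Variable m : {sigma_finite_measure set 'rV[R]_n -> \bar R}.

Definition lebesgue_rV_succ : set 'rV[R]_n.+1 -> \bar R :=
  pushforward (@lebesgue_measure R \x m) (@rV_cons R n).

Let succ0 : lebesgue_rV_succ set0 = 0.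
Proof. by rewrite /lebesgue_rV_succ /pushforward preimage_set0 measure0. Qed.

Let succ_ge0 A : 0 <= lebesgue_rV_succ A.
Proof. by rewrite /lebesgue_rV_succ /pushforward; exact: measure_ge0. Qed.

Let succ_sigma_additive : semi_sigma_additive lebesgue_rV_succ.
Proof.
move=> F mF tF mUF; rewrite /lebesgue_rV_succ /pushforward preimage_bigcup.
apply: measure_semi_sigma_additive.
- by move=> k; rewrite -[X in measurable X]setTI; exact: measurable_rV_cons.
- apply/trivIsetP => /= i j _ _ ij; rewrite -preimage_setI.
  by move/trivIsetP : tF => /(_ _ _ _ _ ij) ->//; rewrite preimage_set0.
- by rewrite -preimage_bigcup -[X in measurable X]setTI; exact: measurable_rV_cons.
Qed.

HB.instance Definition _ := isMeasure.Build _ _ _ lebesgue_rV_succ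
  succ0 succ_ge0 succ_sigma_additive.

Let sigma_finite_succ : sigma_finite setT lebesgue_rV_succ.
Proof.
have /sigma_finiteP[F [FT ndF Foo]] := sigma_finiteT (@lebesgue_measure R).
have /sigma_finiteP[G [GT ndG Goo]] := sigma_finiteT m.
have FGT : \bigcup_k (F k `*` G k) = setT.
  rewrite -setXTT FT GT predeqE => -[x y]; split.
    by move=> [k _ []/= ? ?]; split; exists k.
  move=> [/= [k _ Fkx] [l _ Gly]]; exists (maxn k l) => //; split.
  - by move: x Fkx; exact/subsetPset/ndF/leq_maxl.
  - by move: y Gly; exact/subsetPset/ndG/leq_maxr.
exists (fun k => @rV_uncons R n @^-1` (F k `*` G k)).
  by rewrite -preimage_bigcup FGT preimage_setT.
move=> k; have [mF Fk] := Foo k; have [mG Gk] := Goo k; split.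
  rewrite -[X in measurable X]setTI.
  by apply: measurable_rV_uncons => //; exact: measurableX.
rewrite /lebesgue_rV_succ /pushforward -comp_preimage.
rewrite (_ : _ \o _ = id); last by apply/funext => z; exact: rV_consK.
by rewrite preimage_id product_measure1E// lte_mul_pinfty// ge0_fin_numE.
Qed.

HB.instance Definition _ := Measure_isSigmaFinite.Build _ _ _
  lebesgue_rV_succ sigma_finite_succ.

End lebesgue_rV_step.

Section lebesgue_rV.
Local Open Scope ereal_scope.
Context {R : realType}.

Fixpoint lebesgue_rV (n : nat) : {sigma_finite_measure set 'rV[R]_n -> \bar R} :=
  match n with
  | 0%N => \d_(0%R : 'rV[R]_0)
  | k.+1 => lebesgue_rV_succ (lebesgue_rV k)
  end.

Lemma measurable_rV_box n (a b : 'rV[R]_n) :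
  measurable [set x : 'rV[R]_n | forall i, x ord0 i \in `[a ord0 i, b ord0 i]].
Proof.
rewrite (_ : mkset _ =
    \bigcap_(i in [set: 'I_n]) (@rV_coord R n i @^-1` `[a ord0 i, b ord0 i])).
  apply: fin_bigcap_measurable => // i _.
  by rewrite -[X in measurable X]setTI; exact: measurable_rV_coord.
by apply/seteqP; split => x /= xab i; [move=> _; exact: xab|exact: xab].
Qed.

Lemma lebesgue_rV_box n (a b : 'rV[R]_n) :
  (forall i, (a ord0 i <= b ord0 i)%R) ->
  lebesgue_rV n [set x : 'rV[R]_n | forall i, x ord0 i \in `[a ord0 i, b ord0 i]] =
  (\prod_(i < n) (b ord0 i - a ord0 i))%:E.
Proof.
elim: n a b => [|n IHn] a b ab.
  by rewrite big_ord0 /= diracE mem_set// => -[].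
have -> : lebesgue_rV n.+1
    [set x : 'rV[R]_n.+1 | forall i, x ord0 i \in `[a ord0 i, b ord0 i]] =
  (@lebesgue_measure R \x lebesgue_rV n) (`[a ord0 ord0, b ord0 ord0] `*`
    [set x : 'rV[R]_n |
       forall i, x ord0 i \in `[(col' ord0 a : 'rV_n) ord0 i, (col' ord0 b : 'rV_n) ord0 i]]).
  rewrite /= /lebesgue_rV_succ /pushforward; congr (_ _).
  apply/seteqP; split => [[x v]/= xv|[x v]/= [x0 vi] i].
    split; first by have := xv ord0; rewrite rV_cons0.
    by move=> i; have := xv (lift ord0 i); rewrite rV_consS !mxE.
  case: (unliftP ord0 i) => [j|] ->; last by rewrite rV_cons0.
  by rewrite rV_consS; have := vi j; rewrite !mxE.
rewrite big_ord_recl EFinM product_measure1E//=; last exact: measurable_rV_box.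
rewrite lebesgue_measure_itv/= IHn; last by move=> i; rewrite !mxE.
congr (_ * _).
  rewrite lte_fin; case: ltP => // ba.
  have /eqP -> : a ord0 ord0 == b ord0 ord0 by rewrite eq_le ab ba.
  by rewrite subrr.
by congr EFin; apply: eq_bigr => i _; rewrite !mxE.
Qed.

End lebesgue_rV.

Section calculus.
Context {R : realType}.

Definition dotv n (a b : 'rV[R]_n) : R := \sum_i a ord0 i * b ord0 i.

(** The library norm on ['rV_n] is the sup norm, hence a separate definition
    of the Euclidean norm. *)
Definition enorm n (a : 'rV[R]_n) : R := Num.sqrt (dotv a a).

Definition partial n (i : 'I_n) (f : 'rV[R]_n -> R) : 'rV[R]_n -> R :=
  fun x => 'D_(delta_mx ord0 i) f x.

Fixpoint Ck (k n : nat) (f : 'rV[R]_n -> R) : Prop :=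
  continuous f /\
  match k with
  | 0%N => True
  | k'.+1 => forall i : 'I_n,
      (forall x, derivable f x (delta_mx ord0 i)) /\ Ck k' (partial i f)
  end.

Definition Coo n (f : 'rV[R]_n -> R) : Prop := forall k, Ck k f.

Definition boundary (T : topologicalType) (A : set T) : set T :=
  closure A `&` closure (~` A).

(** Near each boundary point, and up to relabelling and reorienting the
    coordinate axes, [Om] is the region above the graph of a C^2 function of
    the remaining n - 1 coordinates [col' i y]. *)
Definition C2_boundary n (Om : set 'rV[R]_n) : Prop :=
  forall x, boundary Om x ->
  exists (i : 'I_n) (s : bool) (g : 'rV[R]_n.-1 -> R),
    Ck 2 g /\
    \forall y \near x, Om y <-> g (col' i y) < (-1) ^+ s * y ord0 i.

Definition bounded_C2_domain n (Om : set 'rV[R]_n) : Prop :=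
  [/\ Om !=set0, open Om, connected Om, bounded_set Om & C2_boundary Om].

End calculus.

(** Elements of the function spaces below are represented by functions on R^n
    of which only the values on [Om] matter; equality in the spaces is equality
    almost everywhere on [Om]. *)

Section sobolev.
Local Open Scope ereal_scope.
Context {R : realType} (n : nat).
Variables (Om : set 'rV[R]_n) (p : 'rV[R]_n -> R).
Local Notation mu := (lebesgue_rV n).
Local Notation fn := ('rV[R]_n -> R).

Definition test_function (psi : fn) : Prop :=
  Coo psi /\
  exists K : set 'rV[R]_n,
    [/\ compact K, K `<=` Om & forall x, ~ K x -> psi x = 0%R].

Definition L1loc (f : fn) : Prop :=
  measurable_fun Om f /\
  forall K, compact K -> K `<=` Om -> \int[mu]_(x in K) `|f x|%:E < +oo.

Definition is_wpartial (i : 'I_n) (f g : fn) : Prop :=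
  [/\ L1loc f, L1loc g &
    forall psi, test_function psi ->
      \int[mu]_(x in Om) (f x * partial i psi x)%:E =
      - \int[mu]_(x in Om) (g x * psi x)%:E].

(** A chosen representative of the i-th weak derivative: it is determined
    almost everywhere on [Om] when it exists, and arbitrary otherwise. *)
Definition wpartial (i : 'I_n) (f : fn) : fn := get (is_wpartial i f).

Definition wgrad (f : fn) (x : 'rV[R]_n) : 'rV[R]_n := \row_i wpartial i f x.

Definition Lp : set fn := [set f |
  measurable_fun Om f /\
  exists2 lam : R, (0 < lam)%R &
    \int[mu]_(x in Om) (`|lam * f x| `^ p x)%:E < +oo].

Definition W1p : set fn := [set f |
  Lp f /\ forall i, exists2 g, is_wpartial i f g & Lp g].

Definition rho (f : fn) : \bar R :=
  \int[mu]_(x in Om) (`|f x| `^ p x / p x)%:E.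

Definition rho1 (f : fn) : \bar R := rho f + rho (fun x => enorm (wgrad f x)).

Definition rho1_closed (A : set fn) : Prop :=
  A `<=` W1p /\
  forall (f_ : nat -> fn) (f : fn),
    (forall k, A (f_ k)) -> W1p f ->
    rho1 (f_ k \- f)%R @[k --> \oo] --> 0 -> A f.

Definition W1p_comp : set fn := [set v |
  W1p v /\
  exists K : set 'rV[R]_n,
    [/\ compact K, K `<=` Om &
        {ae mu, forall x, Om x -> ~ K x -> v x = 0%R}]].

(** Closure in the modular topology, whose closed sets are the sets satisfying
    [rho1_closed]; such sets are stable under equality a.e. on [Om]. *)
Definition U1p_0 : set fn := smallest rho1_closed W1p_comp.

(** |grad u|^(p-2) grad u . grad w; the factor [dotv] makes it vanish where
    grad u does, also if p(x) < 2. *)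
Definition plap_form (u w : fn) (x : 'rV[R]_n) : R :=
  (enorm (wgrad u x) `^ (p x - 2) * dotv (wgrad u x) (wgrad w x))%R.

Definition weak_solution (u : fn) : Prop :=
  forall phi, W1p_comp phi -> \int[mu]_(x in Om) (plap_form u phi x)%:E = 0.

End sobolev.

(* Main.v *)
Require Import Defs.
From mathcomp Require Import all_boot all_order all_algebra.
From mathcomp Require Import all_classical all_reals all_analysis.
From mathcomp Require Import measurable_realfun ring lra.

Set Implicit Arguments.
Unset Strict Implicit.
Unset Printing Implicit Defensive.

Import Order.TTheory GRing.Theory Num.Theory.
Import numFieldNormedType.Exports.

Local Open Scope classical_set_scope.
Local Open Scope ring_scope.

(** Solutions are the minimizers of the energy [int |grad u|^p / p] over the
    [u] with [u - phi] in [U1p_0] and finite energy.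

    Functions in [U1p_0] can be tested against smooth functions that do not
    vanish near the boundary, since this property passes to modular limits; so
    they extend by [0] to R^n, whatever the regularity of the boundary.  As
    [inf p > n], Morrey's estimate bounds them uniformly by the L^q norms of
    their derivatives, [n < q <= inf p], and these norms are small when the
    energy is small.

    By Clarkson's inequality ([p >= 2] unless [n = 1], where a scalar estimate
    is used), if two competitors are close to the infimum then the energy of
    half their difference is small.  Hence minimizing sequences converge, by
    Fatou's lemma their limits are minimizers, and minimizers are unique.  The
    variational inequality is Fatou's lemma applied to the difference quotients
    of the energy along segments between competitors; conversely it implies
    minimality because [|b|^p/p >= |a|^p/p + |a|^(p-2) a.(b-a)].  Perturbations
    with compact support have finite energy in both directions, since [p] is
    bounded on compact sets, hence the weak equation. *)

(** * Boxes in R^n *)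

Section boxes.
Context {R : realType} (n : nat).
Implicit Types (a b x : 'rV[R]_n).

(** Two obstacles shape the details. Hence modulars and membership in [U1p_0] are only transported
    under scaling by factors of absolute value at most 1, which explains the many halves, and bounds
    of the form [e + C * modular] replace norm inequalities. For the same reason smallness of [v] in
    a fixed L^q says nothing about its modular, whereas uniform smallness controls |v|^p for all
    exponents at once; this is what the uniform estimate is for. Secondly, [U1p_0] is a smallest
    closed set, whose elements are not known to be limits of sequences of compactly supported
    functions; each of its properties is proved by exhibiting a closed set that contains [W1p_comp].
    Test functions are explicit products of one-variable profiles made of exp and ln; together with
    integrals over lower orthants they take the place of mollifiers. *)

Definition obox a b : set 'rV[R]_n :=
  [set x | forall i, a ord0 i < x ord0 i < b ord0 i].

Definition cbox a b : set 'rV[R]_n :=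
  [set x | forall i, x ord0 i \in `[a ord0 i, b ord0 i]].

Lemma obox_cbox a b : obox a b `<=` cbox a b.
Proof. by move=> x xab i; rewrite in_itv/=; have /andP[/ltW -> /ltW ->] := xab i. Qed.

Lemma measurable_obox a b : measurable (obox a b).
Proof.
rewrite (_ : obox a b =
    \bigcap_(i in [set: 'I_n]) (@rV_coord R n i @^-1` `]a ord0 i, b ord0 i[)).
  apply: fin_bigcap_measurable => // i _.
  by rewrite -[X in measurable X]setTI; exact: measurable_rV_coord.
apply/seteqP; split => x /= xab i; first by move=> _; rewrite /= in_itv/=; exact: xab.
by have := xab i Logic.I; rewrite /= in_itv/=.
Qed.

Lemma nbhs_rV_ball x (U : set 'rV[R]_n) : nbhs x U <->
  exists2 e : R, 0 < e & forall y : 'rV[R]_n, (forall i, `|x ord0 i - y ord0 i| < e) -> U y.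
Proof.
split=> [/nbhs_ballP[e e0 eU]|[e e0 eU]].
  exists e => // y xy; apply: eU; split => // i j.
  by rewrite (ord1 i); exact: xy.
apply/nbhs_ballP; exists e => // y [_ xy]; apply: eU => i; exact: xy.
Qed.

(** The sigma-algebra is generated by the coordinates, so it is the countability of the rational
    boxes that makes open sets measurable. The closed boxes stay inside [U] in order to serve as
    compact sets in [L1loc] and [test_function]. *)
Lemma open_obox_cover (U : set 'rV[R]_n) : open U ->
  exists (D : set nat) (a b : nat -> 'rV[R]_n),
    U = \bigcup_(k in D) obox (a k) (b k) /\
    forall k, D k -> cbox (a k) (b k) `<=` U.
Proof.
move=> oU.
(* Codes of pairs of a rational centre and an index [m], for the half-side 1/(m+1). Numbers that
   decode to nothing get a default pair, which is harmless: only boxes whose closure lies in [U] are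
   kept. *)
pose dec (k : nat) : 'rV[rat]_n * nat := odflt (0, 0%N) (unpickle k).
pose a k : 'rV[R]_n := \row_i (ratr ((dec k).1 ord0 i) - (dec k).2.+1%:R^-1).
pose b k : 'rV[R]_n := \row_i (ratr ((dec k).1 ord0 i) + (dec k).2.+1%:R^-1).
exists [set k | cbox (a k) (b k) `<=` U], a, b; split => //.
apply/seteqP; split => [x Ux|x [k /= kU /obox_cbox]]; last exact: kU.
have /nbhs_rV_ball[e e0 eU] : nbhs x U by apply: open_nbhs_nbhs.
(* Half of [e], because the centre is within 1/(m+1) of [x] and the box reaches as far again. *)
have [m me] : exists m : nat, m.+1%:R^-1 < e / 2.
  have e20 : 0 < e / 2 by rewrite divr_gt0.
  have [m _ hm] := near_infty_natSinv_lt (PosNum e20).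
  by exists m; exact: (hm m (leqnn m)).
have [q hq] : exists q : 'rV[rat]_n, forall i,
    ratr (q ord0 i) \in `]x ord0 i - m.+1%:R^-1, x ord0 i + m.+1%:R^-1[.
  have H i : {q : rat | ratr q \in `]x ord0 i - m.+1%:R^-1, x ord0 i + m.+1%:R^-1[}.
    apply: cid; have : x ord0 i - m.+1%:R^-1 < x ord0 i + m.+1%:R^-1.
      by rewrite ltrD2l gtrN// invr_gt0.
    by move/rat_in_itvoo => [r hr]; exists r.
  exists (\row_i (projT1 (H i))) => i; rewrite mxE; exact: (projT2 (H i)).
exists (pickle (q, m)); rewrite /= /a /b /dec pickleK/=.
  move=> y yq; apply: eU => i.
  have := yq i; have := hq i; rewrite !mxE !in_itv/= ltr_norml.
  move: me; set r := m.+1%:R^-1 => me.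
  by move=> /andP[? ?] /andP[? ?]; apply/andP; split; lra.
move=> i; have := hq i; rewrite !mxE !in_itv/=; set r := m.+1%:R^-1.
by move=> /andP[? ?]; apply/andP; split; lra.
Qed.

Lemma open_measurable_rV (U : set 'rV[R]_n) : open U -> measurable U.
Proof.
move=> /open_obox_cover[D [a [b [-> _]]]].
by apply: bigcup_measurable => k _; exact: measurable_obox.
Qed.

Lemma closed_measurable_rV (U : set 'rV[R]_n) : closed U -> measurable U.
Proof. by rewrite -openC => /open_measurable_rV/measurableC; rewrite setCK. Qed.

Lemma continuous_measurable_rV (U : set 'rV[R]_n) (f : 'rV[R]_n -> R) :
  open U -> {within U, continuous f} -> measurable_fun U f.
Proof.
move=> oU cf; apply: (measurability _ (RGenOpens.measurableE R)).
move=> _ [_ [u [v ->] <-]].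
apply: open_measurable_rV.
rewrite openE => x [Ux fx].
have := cf; rewrite continuous_open_subspace// => /(_ x).
rewrite inE => /(_ Ux) /(_ `]u, v[%classic) H.
rewrite /interior; apply: filterI; first exact: open_nbhs_nbhs.
by apply: H; apply: open_nbhs_nbhs; split => //; exact: itv_open.
Qed.

Lemma closed_cbox a b : closed (cbox a b).
Proof.
rewrite -openC openE => x /= /existsNP[i]; rewrite in_itv/= => /negP.
rewrite negb_and -!ltNge => /orP[xa|xb].
- apply/nbhs_rV_ball; exists (a ord0 i - x ord0 i); first by rewrite subr_gt0.
  move=> y /(_ i); rewrite ltr_norml => /andP[h1 h2] /(_ i).
  by rewrite in_itv/= => /andP[]; lra.
- apply/nbhs_rV_ball; exists (x ord0 i - b ord0 i); first by rewrite subr_gt0.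
  move=> y /(_ i); rewrite ltr_norml => /andP[h1 h2] /(_ i).
  by rewrite in_itv/= => /andP[]; lra.
Qed.

Lemma norm_coord_le x i : `|x ord0 i| <= `|x|.
Proof.
by have := @mx_normrE R 1 n x; rewrite /Num.norm/= => ->;
  exact: (le_bigmax_cond _ (j := (ord0, i)) (fun ij : 'I_1 * 'I_n => `|x ij.1 ij.2|)).
Qed.

Lemma norm_rV_le x (M : R) : 0 <= M -> (forall i, `|x ord0 i| <= M) -> `|x| <= M.
Proof.
move=> M0 H; have := @mx_normrE R 1 n x; rewrite /Num.norm/= => ->.
by apply/bigmax_leP; split => // -[i j] _ /=; rewrite (ord1 i); exact: H.
Qed.

Lemma compact_cbox a b : compact (cbox a b).
Proof.
apply: bounded_closed_compact; last exact: closed_cbox.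
exists (`|a| + `|b|); split; first by rewrite num_real.
move=> M hM x xab /=; apply: norm_rV_le.
  by apply/ltW; rewrite (le_lt_trans _ hM)// addr_ge0.
move=> i; have := xab i; rewrite in_itv/= => /andP[h1 h2].
have := norm_coord_le a i; have := norm_coord_le b i.
rewrite !ler_norml => /andP[? ?] /andP[? ?].
by have := ltW hM => ?; apply/andP; split; lra.
Qed.

Lemma measurable_cbox a b : measurable (cbox a b).
Proof. exact: measurable_rV_box. Qed.

Lemma compact_measurable_rV (K : set 'rV[R]_n) : compact K -> measurable K.
Proof.
by move=> /(compact_closed (@norm_hausdorff _ _)); exact: closed_measurable_rV.
Qed.

Lemma bounded_cbox (A : set 'rV[R]_n) : bounded_set A ->
  exists2 M : R, 0 < M & A `<=` cbox (\row__ - M) (\row__ M).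
Proof.
move=> [N [_ hN]]; exists (`|N| + 1); first by rewrite ltr_wpDl.
move=> x Ax i; have /(_ _ x Ax)/= := hN (`|N| + 1).
rewrite in_itv/= !mxE -ler_norml => H; apply: (le_trans (norm_coord_le x i)).
by apply: H; rewrite (le_lt_trans (ler_norm _))// ltrDl.
Qed.

Lemma lebesgue_cbox_fin a b : (lebesgue_rV n (cbox a b) < +oo)%E.
Proof.
have [h|/existsNP[i /negP]] := pselect (forall i, a ord0 i <= b ord0 i).
  by rewrite lebesgue_rV_box// ltry.
rewrite -ltNge => ba; rewrite (_ : cbox a b = set0) ?measure0//.
rewrite -subset0 => x /(_ i); rewrite in_itv/= => /andP[h1 h2].
by have := le_lt_trans (le_trans h1 h2) ba; rewrite ltxx.
Qed.

Lemma bounded_lebesgue_fin (A : set 'rV[R]_n) : measurable A -> bounded_set A ->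
  (lebesgue_rV n A < +oo)%E.
Proof.
move=> mA /bounded_cbox[M _ AM]; apply: le_lt_trans (lebesgue_cbox_fin (\row__ - M) (\row__ M)).
by apply: le_measure; rewrite ?inE//; exact: measurable_cbox.
Qed.

(** Closed lower orthants form a pi-system that generates the sigma-algebra, so the integrals of a
    function over them determine it almost everywhere. *)
Definition lowset b : set 'rV[R]_n := [set x | forall i, x ord0 i <= b ord0 i].

Lemma measurable_lowset b : measurable (lowset b).
Proof.
rewrite (_ : lowset b =
    \bigcap_(i in [set: 'I_n]) (@rV_coord R n i @^-1` `]-oo, b ord0 i])).
  apply: fin_bigcap_measurable => // i _.
  by rewrite -[X in measurable X]setTI; exact: measurable_rV_coord.
apply/seteqP; split => x /= xab i; first by move=> _; rewrite /= in_itv/=; exact: xab.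
by have := xab i Logic.I; rewrite /= in_itv/=.
Qed.

Lemma setI_closed_lowset : setI_closed (range lowset).
Proof.
move=> _ _ [a _ <-] [b _ <-].
exists (\row_i Num.min (a ord0 i) (b ord0 i)) => //.
apply/seteqP; split => [x xab|x [xa xb] i]; last by rewrite mxE le_min xa xb.
by split => i; have := xab i; rewrite mxE le_min => /andP[].
Qed.

Lemma measurable_rV_lowsetE : @measurable _ 'rV[R]_n = <<s range lowset>>.
Proof.
apply/seteqP; split; last first.
  apply: smallest_sub; first exact: sigma_algebra_measurable.
  by move=> _ [b _ <-]; exact: measurable_lowset.
apply: smallest_sub; first exact: smallest_sigma_algebra.
rewrite -bigcup_seq => _ [i _ [B mB <-]].
have mc : measurable_fun setT
    (@rV_coord R n i : g_sigma_algebraType (range lowset) -> measurableTypeR R).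
  apply: (measurability _ (RGenOInfty.measurableE R)).
  move=> _ [_ [c ->] <-]; rewrite setTI.
  (* The half-space where coordinate [i] exceeds [c] is the complement of a union of orthants,
     bounded by [c] in direction [i] and by [k] in the other ones. *)
  rewrite (_ : _ @^-1` _ = ~` (\bigcup_k
    lowset (\row_j if j == i then c else k%:R))).
    apply: measurableC; apply: bigcup_measurable => k _.
    by apply: sub_sigma_algebra; eexists.
  apply/seteqP; split => x /=.
    rewrite in_itv/= andbT => cx [k _ /(_ i)]; rewrite mxE eqxx.
    by move=> /(lt_le_trans cx); rewrite ltxx.
  move=> xc; rewrite in_itv/= andbT ltNge; apply/negP => cx; apply: xc.
  exists (Num.truncn `|x|).+1 => // j; rewrite mxE; case: eqVneq => [->//|_].
  rewrite (le_trans (ler_norm _))// (le_trans (norm_coord_le x j))//.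
  by apply/ltW/truncnS_gt.
exact: mc.
Qed.

Local Notation mu := (lebesgue_rV n).

(** By Dynkin's theorem the signed measure with density [f] vanishes on all measurable sets as soon
    as it does on a generating pi-system. *)
Lemma integral_lowset_ae0 (D : set 'rV[R]_n) (f : 'rV[R]_n -> R) :
  measurable D -> mu.-integrable D (EFin \o f) ->
  (forall b, \int[mu]_(x in D `&` lowset b) (f x)%:E = 0)%E ->
  {ae mu, forall x, D x -> f x = 0}.
Proof.
move=> mD intf f0.
have intS E : measurable E -> mu.-integrable (D `&` E) (EFin \o f).
  by move=> mE; apply: integrableS intf => //; exact: measurableI.
suff H E : measurable E -> (\int[mu]_(x in D `&` E) (f x)%:E = 0)%E.
  suff : ae_eq mu D (EFin \o f) (cst 0%E).
    by apply: filterS => x /= h Dx; have := h Dx => -[].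
  apply: integral_ae_eq => //.
  by move=> E ED mE; rewrite integral0 -(setIidr ED); exact: H.
(* Stability under complements needs the integral over all of [D]; it is the limit of the integrals
   over growing orthants. *)
have DT : (\int[mu]_(x in D) (f x)%:E = 0)%E.
  have T : \bigcup_k (D `&` lowset (const_mx k%:R)) = D.
      rewrite -setI_bigcupr; apply/setIidPl => x _.
      exists (Num.truncn `|x|).+1 => // j; rewrite mxE.
      rewrite (le_trans (ler_norm _))// (le_trans (norm_coord_le x j))//.
      by apply/ltW/truncnS_gt.
    pose F k := f \_ (D `&` lowset (const_mx k%:R)).
    have [] := @dominated_convergence _ _ _ mu D mD (fun k => EFin \o F k)
      (EFin \o f) (EFin \o (fun x => `|f x|)).
    + move=> k; apply/measurable_EFinP; apply/measurable_restrict => //.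
        by apply: measurableI => //; exact: measurable_lowset.
      apply: measurable_funS (mD) _ _ => //.
      by apply/measurable_EFinP; exact: measurable_int intf.
    + exact: measurable_int intf.
    + apply/aeW => x Dx; apply: cvg_near_cst.
      exists (Num.truncn `|x|).+1 => // k /= hk.
      rewrite /F /= patchE mem_set//; split => // j; rewrite mxE.
      rewrite (le_trans (ler_norm _))// (le_trans (norm_coord_le x j))//.
      by rewrite (le_trans (ltW (truncnS_gt _)))// ler_nat.
    + exact: integrable_norm.
    + apply/aeW => x k Dx /=; rewrite lee_fin /F patchE.
      by case: ifP; rewrite ?normr0.
    + move=> _ _; move=> cv.
      rewrite -(cvg_lim _ cv)//; apply/cvg_lim => //.
      apply: cvg_near_cst; apply: nearW => k /=.
      rewrite -[RHS](f0 (const_mx k%:R)) [RHS]integral_mkcond [LHS]integral_mkcond.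
      apply: eq_integral => x _; rewrite /F !patchE.
      by rewrite in_setI; case: (x \in D); case: (x \in lowset _).
move=> mE; apply: (@dynkin_induction _ 'rV[R]_n (range lowset)
  (fun E => \int[mu]_(x in D `&` E) (f x)%:E = 0)%E).
- exact: measurable_rV_lowsetE.
- exact: setI_closed_lowset.
- by rewrite setIT.
- by move=> _ [b _ <-].
- move=> S mS S0.
  have : (\int[mu]_(x in D) (f x)%:E = 0)%E by [].
  rewrite -[in X in X -> _](setUIDK D S) integral_setU//.
  + by rewrite S0 add0e setDE.
  + exact: measurableI.
  + exact: measurableD.
  + by rewrite setUIDK; exact: measurable_int intf.
  + by apply/disj_set2P; rewrite setDE setIACA setICr setI0.
- move=> F mF tF F0; rewrite setI_bigcupr integral_bigcup//.
  + by rewrite eseries0.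
  + by apply: trivIset_setIl.
  + by move=> k; apply: measurableI.
  + by rewrite -setI_bigcupr; apply: intS; exact: bigcup_measurable.
- by rewrite -measurable_rV_lowsetE.
Qed.
End boxes.

(** * Smooth functions *)

Section directional.
Context {R : realType} {V : normedModType R}.
Implicit Types (f : V -> R) (x v : V).

(** [Ck] only speaks of directional derivatives. Restriction to a line makes the one-variable chain
    rule applicable without differentiability of [f] in the full sense. *)
Lemma is_derive_line f x v (l : R) :
  is_derive x v f l <-> is_derive (0 : R) (1 : R) (fun h : R => f (h *: v + x)) l.
Proof.
have E : 'D_v f x = 'D_1 (fun h : R => f (h *: v + x)) 0.
  rewrite /derive; set g1 := fun h => h^-1 *: _; set g2 := fun h => h^-1 *: _.
  suff -> : g1 = g2 by [].
  by apply/funext => h; rewrite /g1 /g2 /= addr0 scale0r add0r [_%:A]mulr1.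
have [dl dr] := derivable1P f x v.
split=> -[d1 d2]; apply: DeriveDef.
- exact: dl.
- by rewrite -E.
- exact: dr.
- by rewrite E.
Qed.

Lemma is_derive_comp_real (h : R -> R) f x v (df dh : R) :
  is_derive (f x) 1 h dh -> is_derive x v f df ->
  is_derive x v (fun y => h (f y)) (dh * df).
Proof.
move=> hd /is_derive_line fd; apply/is_derive_line.
apply: (@is_derive1_comp _ h (fun t : R => f (t *: v + x))) => //.
by rewrite scale0r add0r.
Qed.

Lemma is_derive_invariant f x v : (forall h : R, f (h *: v + x) = f x) ->
  is_derive x v f 0.
Proof.
move=> H; apply/is_derive_line.
by rewrite (_ : (fun _ => _) = cst (f x)); [exact: is_derive_cst|exact/funext].
Qed.

Lemma is_deriveM_real f g x v (df dg : R) :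
  is_derive x v f df -> is_derive x v g dg ->
  is_derive x v (fun y => f y * g y) (df * g x + f x * dg).
Proof.
move=> fd gd; have H := is_deriveM fd gd.
by apply: is_derive_eq; rewrite addrC; congr (_ + _); rewrite mulrC.
Qed.

End directional.

(** * Calculus of the classes [Ck] *)

Section Ck_theory.
Context {R : realType} {n : nat}.
Implicit Types f g : 'rV[R]_n -> R.
Local Notation e i := (delta_mx ord0 i : 'rV[R]_n).

(** Takes an explicit candidate for each partial derivative, so that smoothness proofs compute with
    formulas instead of the derivation operator. *)
Lemma CkS k f : continuous f ->
  (forall i, exists2 g, forall x, is_derive x (e i) f (g x) & Ck k g) ->
  Ck k.+1 f.
Proof.
move=> cf H; split => // i; have [g fg cg] := H i.
have -> : partial i f = g by apply/funext => x; rewrite /partial; have [_ ->] := fg x.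
by split => // x; have [] := fg x.
Qed.

Lemma Ck_derive k f i x : Ck k.+1 f -> is_derive x (e i) f (partial i f x).
Proof. by move=> [_ /(_ i)[+ _]] => /(_ x) /derivableP. Qed.

Lemma Ck_partial k f i : Ck k.+1 f -> Ck k (partial i f).
Proof. by case=> _ /(_ i)[]. Qed.

Lemma CkW k f : Ck k.+1 f -> Ck k f.
Proof.
elim: k f => [|k IH] f cf; first by split => //; have [] := cf.
apply: CkS; first by have [] := cf.
move=> i; exists (partial i f); first by move=> x; exact: Ck_derive cf.
by apply: IH; exact: Ck_partial cf.
Qed.

Lemma Ck_cst k (c : R) : Ck k (fun _ : 'rV[R]_n => c).
Proof.
elim: k c => [|k IH] c; first by split => //; exact: cst_continuous.
apply: CkS; first exact: cst_continuous.
by move=> i; exists (fun=> 0); [move=> x; exact: is_derive_cst|exact: IH].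
Qed.

Lemma CkD k f g : Ck k f -> Ck k g -> Ck k (fun x => f x + g x).
Proof.
elim: k f g => [|k IH] f g cf cg.
  by split => // x; apply: continuousD; [case: cf => + _; exact|case: cg => + _; exact].
apply: CkS.
  by move=> x; apply: continuousD; [case: cf => + _; exact|case: cg => + _; exact].
move=> i; exists (fun x => partial i f x + partial i g x).
  by move=> x; apply: is_deriveD; [exact: Ck_derive cf|exact: Ck_derive cg].
by apply: IH; [exact: Ck_partial cf|exact: Ck_partial cg].
Qed.

Lemma CkM k f g : Ck k f -> Ck k g -> Ck k (fun x => f x * g x).
Proof.
elim: k f g => [|k IH] f g cf cg.
  by split => // x; apply: continuousM; [case: cf => + _; exact|case: cg => + _; exact].
apply: CkS.
  by move=> x; apply: continuousM; [case: cf => + _; exact|case: cg => + _; exact].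
move=> i; exists (fun x => partial i f x * g x + f x * partial i g x).
  by move=> x; apply: is_deriveM_real; [exact: Ck_derive cf|exact: Ck_derive cg].
by apply: CkD; apply: IH; [exact: Ck_partial cf|exact: CkW|exact: CkW|exact: Ck_partial cg].
Qed.

(** Smoothness of the outer function enters only through [h' \o f]. For the concrete functions
    below, [h'] is a polynomial in functions of the same family, so this hypothesis comes from the
    induction on [k]. *)
Lemma Ck_comp k f (h h' : R -> R) :
  (forall x, is_derive (f x) 1 h (h' (f x))) ->
  Ck k.+1 f -> Ck k (h' \o f) -> Ck k.+1 (h \o f).
Proof.
move=> hd cf ch; apply: CkS.
  move=> x; apply: continuous_comp; first by case: cf => + _; exact.
  by apply/differentiable_continuous/derivable1_diffP; have [] := hd x.
move=> i; exists (fun x => h' (f x) * partial i f x).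
  by move=> x; apply: is_derive_comp_real => //; exact: Ck_derive cf.
by apply: CkM => //; exact: Ck_partial cf.
Qed.

Lemma Ck_coord k (j : 'I_n) : Ck k (fun x : 'rV[R]_n => x ord0 j).
Proof.
case: k => [|k]; first by split => //; exact: coord_continuous.
apply: CkS; first exact: coord_continuous.
move=> i; exists (fun=> (j == i)%:R); last exact: Ck_cst.
move=> x; apply/is_derive_line.
have -> : (fun h : R => (h *: e i + x) ord0 j) =
    (fun h : R => h * (j == i)%:R) \+ cst (x ord0 j).
  by apply/funext => h; rewrite !mxE eqxx.
rewrite -[X in is_derive _ _ _ X]addr0; apply: is_deriveD.
have := is_deriveM_real (is_derive_id (0 : R) 1)
  (is_derive_cst ((j == i)%:R : R) (0 : R) 1).
by rewrite mul1r mulr0 addr0.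
Qed.

Lemma CkV k f : (forall x, f x != 0) -> Ck k f -> Ck k (fun x => (f x)^-1).
Proof.
move=> f0; have d x : is_derive (f x) 1 (fun y => y^-1) (- ((f x)^-1 * (f x)^-1)).
  apply: is_derive_eq (is_deriveV (f0 x) (is_derive_id _ _)) _.
  by rewrite expr2 invfM [_ *: _]mulr1.
elim: k => [|k IH] cf.
  split => // x; apply: (@continuous_comp _ _ _ f (fun y => y^-1)).
    by case: cf => + _; exact.
  exact: inv_continuous.
apply: (@Ck_comp k f (fun y => y^-1) (fun y => - (y^-1 * y^-1)) d cf).
have h := IH (CkW cf); have := CkM (Ck_cst k (-1)) (CkM h h).
by congr Ck; apply/funext => x /=; rewrite mulN1r.
Qed.

Lemma Ck_sum k (I : Type) (s : seq I) (P : pred I) (F : I -> 'rV[R]_n -> R) :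
  (forall i, Ck k (F i)) -> Ck k (fun x => \sum_(i <- s | P i) F i x).
Proof.
move=> H; elim: s => [|i s IH].
  by under eq_fun do rewrite big_nil; exact: Ck_cst.
under eq_fun do rewrite big_cons.
by case: (P i) => //; exact: CkD.
Qed.

Lemma Ck_prod k (I : Type) (s : seq I) (P : pred I) (F : I -> 'rV[R]_n -> R) :
  (forall i, Ck k (F i)) -> Ck k (fun x => \prod_(i <- s | P i) F i x).
Proof.
move=> H; elim: s => [|i s IH].
  by under eq_fun do rewrite big_nil; exact: Ck_cst.
under eq_fun do rewrite big_cons.
by case: (P i) => //; exact: CkM.
Qed.

End Ck_theory.

(** * Flat functions, the logistic function and its primitive *)

Section flat_exponential.
Context {R : realType}.
Implicit Types x y : R.

(** The classical function exp(-1/x), extended by 0, times powers of 1/x. The index [m] makes the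
    family stable under differentiation, so that smoothness follows by induction. *)
Definition flat (m : nat) (x : R) : R :=
  if 0 < x then x^-1 ^+ m * expR (- x^-1) else 0.

Lemma flat_le0 m x : x <= 0 -> flat m x = 0.
Proof. by rewrite /flat ltNge => ->. Qed.

Lemma flat_ge0 m x : 0 <= flat m x.
Proof.
rewrite /flat; case: ifP => // x0.
by rewrite mulr_ge0 ?expR_ge0// exprn_ge0// invr_ge0 ltW.
Qed.

Lemma flat_gt0 x : (0 < flat 0 x) = (0 < x).
Proof.
by rewrite /flat; case: ifP => _; rewrite ?ltxx// expr0 mul1r expR_gt0.
Qed.

Lemma flat_le1 x : flat 0 x <= 1.
Proof.
rewrite /flat; case: ifPn => // x0; rewrite expr0 mul1r expR_le1.
by rewrite oppr_le0 invr_ge0 ltW.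
Qed.

(** With y = 1/x, the term of degree m+1 in the exponential series gives y^m exp(-y) <= (m+1)!/y.
    This linear bound yields the continuity of every [flat m] at 0. *)
Lemma flat_le m x : flat m x <= (m.+1)`!%:R * `|x|.
Proof.
rewrite /flat; case: ifP => x0; last by rewrite mulr_ge0.
rewrite gtr0_norm// expRN ler_pdivrMr ?expR_gt0//.
have y0 : 0 < x^-1 by rewrite invr_gt0.
have := expR_ge1Dxn m (ltW y0); set E := expR _ => hE.
have fn : 0 < (m.+1)`!%:R :> R by rewrite ltr0n fact_gt0.
have : x^-1 ^+ m.+1 / m.+1`!%:R <= E by apply: le_trans hE; rewrite lerDr.
rewrite ler_pdivrMr// => h.
have -> : x^-1 ^+ m = x^-1 ^+ m.+1 * x by rewrite exprSr -mulrA mulVf ?mulr1// gt_eqF.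
by rewrite mulrAC [_ * E]mulrC ler_pM2r.
Qed.

Lemma is_derive_flat m x :
  is_derive x 1 (flat m) (flat m.+2 x - m%:R * flat m.+1 x).
Proof.
have [x0|x0|->] := ltgtP x 0.
- rewrite !flat_le0 ?(ltW x0)// mulr0 subr0.
  apply: (near_eq_is_derive _ (is_derive_cst (0 : R) x (1 : R))).
  near=> z; rewrite flat_le0//; near: z.
  by apply: filterS (lt_nbhsl x0) => z /ltW.
- apply: (@near_eq_is_derive R R R (fun x => x^-1 ^+ m * expR (- x^-1))).
    near=> z; rewrite /flat ifT//; near: z; exact: lt_nbhsr.
  have xn0 : x != 0 by rewrite gt_eqF.
  have dV := is_deriveV xn0 (is_derive_id x (1 : R)).
  have := is_deriveX m dV; rewrite exprfctE => d1.
  have dN := is_deriveN dV.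
  have d2 : is_derive x (1 : R) (fun x => expR (- x^-1)) _ :=
    @is_derive_comp_real R R expR (fun x => - x^-1) x 1 _ _ (is_derive_expR _) dN.
  apply: (is_derive_eq (is_deriveM_real d1 d2)).
  rewrite /flat x0 /GRing.scale/= !exprS expr0 !invfM.
  rewrite !divr1 !mulr1; set E := expR _; set y := x^-1.
  by case: m {d1} => [|m]; rewrite /= ?exprS ?expr0; ring.
- rewrite !flat_le0// mulr0 subr0; apply/is_derive1_caratheodory.
  (* The difference quotient at 0 is again a member of the family, and [flat_le] gives its
     continuity there. *)
  exists (flat m.+1); split; last by rewrite flat_le0.
    move=> z; rewrite (@flat_le0 m 0)// !subr0 /flat; case: ifP => z0; last by rewrite mul0r.
    by rewrite exprSr mulrAC -(mulrA _ z^-1) mulVf ?mulr1// gt_eqF.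
  apply/cvgrPdist_le => /= e e0; rewrite (@flat_le0 m.+1 0)//.
  have F0 : 0 < m.+2`!%:R :> R by rewrite ltr0n fact_gt0.
  have d0 : 0 < e / m.+2`!%:R by rewrite divr_gt0.
  near=> z; rewrite sub0r normrN ger0_norm ?flat_ge0// (le_trans (flat_le _ _))//.
  rewrite mulrC -ler_pdivlMr//; near: z.
Unshelve. all: by end_near. Qed.

Lemma Ck_flat n k m (f : 'rV[R]_n -> R) : Ck k f -> Ck k (fun x : 'rV[R]_n => flat m (f x)).
Proof.
elim: k m => [|k IH] m cf.
  split => // x; apply: (@continuous_comp _ _ _ f (flat m)).
    by case: cf => + _; exact.
  by apply/differentiable_continuous/derivable1_diffP; have [] := is_derive_flat m (f x).
apply: (@Ck_comp _ _ k f (flat m) (fun y => flat m.+2 y - m%:R * flat m.+1 y)).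
- by move=> x; exact: is_derive_flat.
- by [].
- have cf' := CkW cf.
  have := CkD (IH m.+2 cf') (CkM (Ck_cst k (- m%:R)) (IH m.+1 cf')).
  by congr Ck; apply/funext => x /=; rewrite mulNr.
Qed.

(** Rescaled, the logistic function approximates the indicator of a half-line and its primitive
    [softplus] the positive part; the second differentiates exactly to the first, and the derivative
    of the first is a polynomial in it. *)
Definition sigmoid x := (1 + expR (- x))^-1.

Definition softplus x := ln (1 + expR x).

Lemma is_derive_sigmoid x : is_derive x 1 sigmoid (sigmoid x - sigmoid x * sigmoid x).
Proof.
have n0 : 1 + expR (- x) != 0 by rewrite gt_eqF// ltr_wpDr// expR_ge0.
have d1 : is_derive x (1 : R) (fun x => expR (- x)) _ :=
  @is_derive_comp_real R R expR (fun x => - x) x 1 _ _ (is_derive_expR _)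
   (is_deriveN (is_derive_id x (1 : R))).
have H : is_derive x (1 : R) sigmoid _ :=
  @is_deriveV R (fun x => 1 + expR (- x)) _ _ _ n0 (is_deriveD (is_derive_cst (1 : R) x 1) d1).
apply: (is_derive_eq H); rewrite /sigmoid /GRing.scale/= add0r.
set E := expR _ in n0 *; field; exact: n0.
Qed.

Lemma is_derive_softplus x : is_derive x 1 softplus (sigmoid x).
Proof.
have d1 := is_deriveD (is_derive_cst (1 : R) x 1) (is_derive_expR x).
have p0 : 0 < 1 + expR x by rewrite ltr_wpDr// expR_ge0.
have H : is_derive x (1 : R) softplus _ :=
  @is_derive_comp_real R R (@ln R) _ x 1 _ _ (is_derive1_ln p0) d1.
apply: (is_derive_eq H); rewrite add0r /sigmoid expRN.
have E0 : 0 < expR x := expR_gt0 x.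
by field; rewrite !gt_eqF// addrC.
Qed.

Lemma Ck_sigmoid n k (f : 'rV[R]_n -> R) : Ck k f -> Ck k (fun x : 'rV[R]_n => sigmoid (f x)).
Proof.
elim: k => [|k IH] cf.
  split => // x; apply: (@continuous_comp _ _ _ f sigmoid).
    by case: cf => + _; exact.
  by apply/differentiable_continuous/derivable1_diffP; have [] := is_derive_sigmoid (f x).
apply: (@Ck_comp _ _ k f sigmoid (fun y => sigmoid y - sigmoid y * sigmoid y)).
- by move=> x; exact: is_derive_sigmoid.
- by [].
- have h := IH (CkW cf).
  have := CkD h (CkM (Ck_cst k (- 1)) (CkM h h)).
  by congr Ck; apply/funext => x /=; rewrite mulN1r.
Qed.

Lemma Ck_softplus n k (f : 'rV[R]_n -> R) : Ck k f -> Ck k (fun x : 'rV[R]_n => softplus (f x)).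
Proof.
case: k => [|k] cf.
  split => // x; apply: (@continuous_comp _ _ _ f softplus).
    by case: cf => + _; exact.
  by apply/differentiable_continuous/derivable1_diffP; have [] := is_derive_softplus (f x).
apply: (@Ck_comp _ _ k f softplus sigmoid) => //.
- by move=> x; exact: is_derive_softplus.
- by apply: Ck_sigmoid; exact: CkW.
Qed.

End flat_exponential.

(** * Limits of smooth step functions *)

Section step_limits.
Context {R : realType}.
Implicit Types (s t y : R) (u : nat -> R).

Lemma cvg_rate u l (C : R) :
  (\forall k \near \oo, `|u k - l| <= C / k.+1%:R) -> u k @[k --> \oo] --> l.
Proof.
move=> H; apply/cvgrPdist_le => e e0.
have h : (fun k => `|C| * k.+1%:R^-1) @ \oo --> `|C| * (0 : R).
  by apply: cvgMr; exact: cvg_harmonic.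
rewrite mulr0 in h; have /cvgrPdist_le/(_ e e0) h' := h.
near=> k; rewrite distrC.
have : `|0 - `|C| * k.+1%:R^-1| <= e by near: k; exact: h'.
rewrite sub0r normrN normrM normr_id ger0_norm ?invr_ge0//; apply: le_trans.
have : `|u k - l| <= C / k.+1%:R by near: k.
move/le_trans; apply; rewrite ler_wpM2r ?invr_ge0//; exact: ler_norm.
Unshelve. all: by end_near. Qed.

Lemma sigmoid_ge0 y : 0 <= sigmoid y.
Proof. by rewrite invr_ge0 addr_ge0// expR_ge0. Qed.

Lemma sigmoidN y : sigmoid (- y) = 1 - sigmoid y.
Proof.
rewrite /sigmoid opprK expRN; have E0 : 0 < expR y := expR_gt0 y.
by field; rewrite !gt_eqF// addrC ltr_wpDr// ltW.
Qed.

Lemma sigmoid_le1 y : sigmoid y <= 1.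
Proof. by have := sigmoid_ge0 (- y); rewrite sigmoidN subr_ge0. Qed.

Lemma sigmoid_neg y : 0 < y -> sigmoid (- y) <= y^-1.
Proof.
move=> y0; rewrite /sigmoid opprK lef_pV2 ?posrE ?addr_gt0 ?expR_gt0//.
by rewrite ler_wpDl// (le_trans _ (expR_ge1Dx y))// lerDr.
Qed.

Lemma sigmoid_pos y : 0 < y -> 1 - y^-1 <= sigmoid y.
Proof. by move=> /sigmoid_neg; rewrite sigmoidN; lra. Qed.

(** The shift by [k.+1] is dominated by the quadratic slope when [s] is not 0, but forces the limit
    1 at [s = 0]: the limit is the indicator of the closed half-line at every point. *)
Lemma cvg_sigmoid_ge s :
  sigmoid (k.+1%:R ^+ 2 * s + k.+1%:R) @[k --> \oo] --> ((0 <= s)%R%:R : R).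
Proof.
apply: (@cvg_rate _ _ 1); case: (lerP 0 s) => s0.
  apply: nearW => k; set K : R := k.+1%:R.
  have K0 : 0 < K by rewrite ltr0n.
  have y0 : K <= K ^+ 2 * s + K by rewrite lerDr mulr_ge0// exprn_ge0// ltW.
  have yp := lt_le_trans K0 y0.
  rewrite distrC ger0_norm ?subr_ge0 ?sigmoid_le1// mul1r.
  have := sigmoid_pos yp; rewrite lerBlDl -lerBlDr => /le_trans; apply.
  by rewrite lef_pV2.
near=> k.
(* Beyond this index the argument of [sigmoid] is at most [- k.+1%:R]. *)
have : 2 / - s <= k%:R by near: k; exact: nbhs_infty_ger.
move=> /le_trans -/(_ k.+1%:R); rewrite ler_nat leqnSn => /(_ isT).
set K : R := k.+1%:R; have K0 : 0 < K by rewrite ltr0n.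
rewrite ler_pdivrMr ?oppr_gt0// => h.
have y0 : K <= - (K ^+ 2 * s + K) by nra.
rewrite subr0 ger0_norm ?sigmoid_ge0// mul1r -[X in sigmoid X]opprK.
rewrite (le_trans (sigmoid_neg (lt_le_trans K0 y0)))// lef_pV2// posrE//.
exact: lt_le_trans y0.
Unshelve. all: by end_near. Qed.

Lemma cvg_sigmoid_gt s :
  sigmoid (k.+1%:R ^+ 2 * s - k.+1%:R) @[k --> \oo] --> ((0 < s)%R%:R : R).
Proof.
have -> : (0 < s)%R%:R = 1 - (0 <= - s)%R%:R :> R.
  by rewrite oppr_ge0; case: ltP; rewrite ?subr0 ?subrr.
under eq_fun do rewrite -[X in sigmoid X]opprK opprB addrC -mulrN sigmoidN.
by apply: cvgB; [exact: cvg_cst|exact: cvg_sigmoid_ge].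
Qed.

Lemma cvg_flat t : flat 0 (k.+1%:R * t) @[k --> \oo] --> ((0 < t)%R%:R : R).
Proof.
case: (ltrP 0 t) => t0; last first.
  apply: cvg_near_cst; apply: nearW => k; rewrite flat_le0//.
  by rewrite mulr_ge0_le0.
apply: (@cvg_rate _ _ (t^-1)); apply: nearW => k.
rewrite distrC ger0_norm ?subr_ge0 ?flat_le1//.
rewrite /flat mulr_gt0// expr0 mul1r lerBlDl -lerBlDr invfM mulrC.
exact: expR_ge1Dx.
Qed.

Lemma softplus_bound y : Num.max 0 y <= softplus y <= Num.max 0 y + 1.
Proof.
have p0 : 0 < 1 + expR y by rewrite ltr_wpDr// expR_ge0.
rewrite -[X in X <= _]expRK -[X in _ && (_ <= X)]expRK /softplus !ler_ln ?posrE ?expR_gt0//.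
have e2 : 2 <= expR 1 :> R by rewrite (le_trans _ (expR_ge1Dx 1)).
rewrite expRD; case: (lerP 0 y) => y0; apply/andP; split.
- by rewrite lerDr.
- have : 1 <= expR y by rewrite -expR0 ler_expR.
  by have := expR_gt0 y; nra.
- by rewrite expR0 lerDl expR_ge0.
- have : expR y <= 1 by rewrite expR_le1 ltW.
  by rewrite expR0 mul1r; lra.
Qed.

Lemma maxr_lip s t : `|Num.max 0 s - Num.max 0 t| <= `|s - t|.
Proof.
by rewrite ler_norml; case: (ler0P (s - t)); case: (lerP 0 s); case: (lerP 0 t) => *;
  apply/andP; split; lra.
Qed.

(** [softplus] is within 1 of the positive part and the shift moves the argument by at most [k.+1];
    after division by the square both errors vanish. *)
Lemma cvg_softplus (e : R) t : `|e| <= 1 ->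
  softplus (k.+1%:R ^+ 2 * t + e * k.+1%:R) / k.+1%:R ^+ 2 @[k --> \oo] -->
  Num.max 0 t.
Proof.
move=> e1; apply: (@cvg_rate _ _ 2); apply: nearW => k; set K : R := k.+1%:R.
have K1 : 1 <= K by rewrite ler1n.
have K0 : 0 < K by rewrite ltr0n.
have KK : 0 < K ^+ 2 by rewrite exprn_gt0.
have -> : Num.max 0 t = Num.max 0 (K ^+ 2 * t) / K ^+ 2.
  by rewrite -{2}(mulr0 (K ^+ 2)) -maxr_pMr ?ltW// mulrAC mulfV ?mul1r// gt_eqF.
rewrite -mulrBl normrM [`|_^-1|]gtr0_norm ?invr_gt0// ler_pdivrMr//.
have -> : 2 / K * K ^+ 2 = K + K by rewrite expr2 mulrA divfK ?gt_eqF//; ring.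
have := softplus_bound (K ^+ 2 * t + e * K).
have := maxr_lip (K ^+ 2 * t + e * K) (K ^+ 2 * t).
have : `|K ^+ 2 * t + e * K - K ^+ 2 * t| <= K.
  by rewrite addrAC subrr add0r normrM (gtr0_norm K0) ler_piMl// ltW.
move=> h1 /le_trans/(_ h1); rewrite !ler_norml => /andP[? ?] /andP[? ?].
by apply/andP; split; lra.
Qed.

End step_limits.

Section dct.
Context d {T : measurableType d} {R : realType} (mu : {measure set T -> \bar R}).

Lemma dominated_cvg_real (D : set T) (f_ : nat -> T -> R) (f g : T -> R) :
  measurable D -> (forall k, measurable_fun D (f_ k)) ->
  (forall x, D x -> f_ k x @[k --> \oo] --> f x) ->
  mu.-integrable D (EFin \o g) ->
  (forall k x, D x -> `|f_ k x| <= g x) ->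
  mu.-integrable D (EFin \o f) /\
  (\int[mu]_(x in D) (f_ k x)%:E)%E @[k --> \oo] --> (\int[mu]_(x in D) (f x)%:E)%E.
Proof.
move=> mD mf ff ig fg.
have cv x : D x -> (EFin \o f_^~ x) k @[k --> \oo] --> (f x)%:E.
  by move=> Dx; apply: cvg_EFin; [exact: nearW|exact: ff].
have [] := @dominated_convergence _ _ _ mu D mD (fun k => EFin \o f_ k)
    (EFin \o f) (EFin \o g) => //.
- by move=> k; exact/measurable_EFinP.
- by apply: (emeasurable_fun_cvg (fun k => EFin \o f_ k)) => // k; exact/measurable_EFinP.
- exact/aeW.
- by apply/aeW => x k Dx /=; rewrite lee_fin fg.
Qed.

End dct.

Lemma cvg_bigprod {R : realType} (I : Type) (s : seq I) (P : pred I)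
    (u : I -> nat -> R) (l : I -> R) :
  (forall i, u i k @[k --> \oo] --> l i) ->
  \prod_(i <- s | P i) u i k @[k --> \oo] --> \prod_(i <- s | P i) l i.
Proof.
move=> H; elim: s => [|i s IH].
  by under eq_fun do rewrite big_nil; rewrite big_nil; exact: cvg_cst.
under eq_fun do rewrite big_cons.
by rewrite big_cons; case: (P i) => //; exact: cvgM.
Qed.

(** * Test functions and weak derivatives *)

Section test_functions.
Context {R : realType} {n : nat}.
Implicit Types (a b x : 'rV[R]_n) (f g h : 'rV[R]_n -> R) (K Om : set 'rV[R]_n).
Local Notation mu := (@lebesgue_rV R n).

Lemma CkN k f : Ck k f -> Ck k (fun x => - f x).
Proof.
move=> /(CkM (Ck_cst k (- 1 : R))).
by congr Ck; apply/funext => x; rewrite mulN1r.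
Qed.

Lemma integral_indic_mul (D E : set 'rV[R]_n) f : E `<=` D ->
  (\int[mu]_(x in E) (f x)%:E = \int[mu]_(x in D) (f x * \1_E x)%:E)%E.
Proof.
move=> ED; rewrite [LHS]integral_mkcond [RHS]integral_mkcond.
apply: eq_integral => x _; rewrite !patchE indicE.
have [xE|xE] := boolP (x \in E); last by rewrite mulr0; case: ifP.
by rewrite mulr1 ifT//; apply/mem_set/ED/set_mem.
Qed.

Definition bump a b x :=
  \prod_i (flat 0 (x ord0 i - a ord0 i) * flat 0 (b ord0 i - x ord0 i)).

Lemma Coo_bump a b : Coo (bump a b).
Proof.
move=> k; apply: Ck_prod => i; apply: CkM; apply: Ck_flat.
- by apply: CkD; [exact: Ck_coord|exact: Ck_cst].
- apply: CkD; first exact: Ck_cst.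
  by apply: CkN; exact: Ck_coord.
Qed.

Lemma bump_ge0 a b x : 0 <= bump a b x.
Proof. by apply: prodr_ge0 => i _; rewrite mulr_ge0// flat_ge0. Qed.

Lemma bump_gt0 a b x : obox a b x -> 0 < bump a b x.
Proof.
by move=> xab; apply: prodr_gt0 => i _; have /andP[? ?] := xab i;
  rewrite mulr_gt0// flat_gt0 subr_gt0.
Qed.

Lemma bump_eq0 a b x : ~ obox a b x -> bump a b x = 0.
Proof.
move=> /existsNP[i /negP]; rewrite negb_and -!leNgt => xab.
apply/eqP; rewrite prodf_seq_eq0; apply/hasP; exists i; first by rewrite mem_index_enum.
rewrite /= mulf_eq0; case/orP: xab => h; apply/orP; [left|right];
  by rewrite flat_le0// subr_le0.
Qed.

Lemma CooM f g : Coo f -> Coo g -> Coo (fun x => f x * g x).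
Proof. by move=> cf cg k; exact: CkM. Qed.

Lemma Coo_partial i f : Coo f -> Coo (partial i f).
Proof. by move=> cf k; exact: Ck_partial (cf k.+1). Qed.

Lemma Coo_continuous f : Coo f -> continuous f.
Proof. by move=> /(_ 0%N) []. Qed.

Lemma continuous_bounded_compact K f : continuous f -> compact K ->
  exists2 M : R, 0 <= M & forall x, K x -> `|f x| <= M.
Proof.
move=> cf cK.
have /(@compact_bounded R R)[M [_ hM]] :=
  continuous_compact (continuous_subspaceT cf) cK.
exists (`|M| + 1); first by rewrite addr_ge0.
move=> x Kx; apply: hM; last by exists x.
by rewrite (le_lt_trans (ler_norm _))// ltrDl.
Qed.

Lemma test_functionM Om psi g : test_function Om psi -> Coo g ->
  test_function Om (fun x => psi x * g x).
Proof.
move=> [cpsi [K [cK KOm psi0]]] cg; split; first exact: CooM.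
by exists K; split => // x Kx; rewrite psi0// mul0r.
Qed.

Lemma partial_near_eq i f g x : (\forall y \near x, f y = g y) ->
  partial i f x = partial i g x.
Proof. exact: near_eq_derive. Qed.

Lemma partial_cst i (c : R) x : partial i (fun=> c) x = 0.
Proof. exact: derive_cst. Qed.

Lemma partial_eq0 Om psi K i x : compact K ->
  (forall y, ~ K y -> psi y = 0) -> ~ K x -> partial i psi x = 0.
Proof.
move=> cK psi0 Kx; rewrite -(partial_cst i 0 x); apply: partial_near_eq.
have oK : open (~` K).
  by apply: closed_openC; apply: compact_closed cK; exact: norm_hausdorff.
apply: filterS (open_nbhs_nbhs (conj oK Kx)) => y; exact: psi0.
Qed.

Lemma test_function_partial Om psi i : test_function Om psi ->
  test_function Om (partial i psi).
Proof.
move=> [cpsi [K [cK KOm psi0]]]; split; first exact: Coo_partial.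
by exists K; split => // x; exact: (partial_eq0 Om).
Qed.

Lemma continuous_measurable f Om : open Om -> continuous f -> measurable_fun Om f.
Proof.
by move=> oOm cf; apply: continuous_measurable_rV => //; exact: continuous_subspaceT.
Qed.

Lemma L1loc_mul_integrable Om f h K (M : R) : open Om -> L1loc Om f ->
  measurable_fun Om h -> compact K -> K `<=` Om ->
  (forall x, Om x -> ~ K x -> h x = 0) -> (forall x, K x -> `|h x| <= M) ->
  mu.-integrable Om (EFin \o (fun x => f x * h x)).
Proof.
move=> oOm [mf fK] mh cK KOm h0 hM.
have mK := compact_measurable_rV cK.
have mOm := open_measurable_rV oOm.
have i1 : mu.-integrable K (EFin \o (fun x => M * f x)).
  have : mu.-integrable K (EFin \o f).
    apply/integrableP; split; last exact: fK.
    by apply/measurable_EFinP; exact: measurable_funS mf.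
  exact: integrableZl.
have := (integrable_mkcond (EFin \o (fun x => M * f x)) mK).1 i1.
move=> /(integrableS measurableT mOm (@subsetT _ _)).
apply: le_integrable => //.
  by apply/measurable_EFinP; exact: measurable_funM.
move=> x Omx /=; rewrite patchE; case: ifPn => [/set_mem Kx|/negP Kx].
  rewrite /= lee_fin !normrM mulrC ler_wpM2r//.
  by rewrite (le_trans (hM _ Kx))// ler_norm.
rewrite h0 ?mulr0 ?normr0//; first exact: abse_ge0.
by move=> Kx'; apply: Kx; exact: mem_set.
Qed.

Lemma test_mul_integrable Om f psi : open Om -> L1loc Om f ->
  test_function Om psi -> mu.-integrable Om (EFin \o (fun x => f x * psi x)).
Proof.
move=> oOm fL [cpsi [K [cK KOm psi0]]].
have cc := Coo_continuous cpsi.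
have [M M0 hM] := continuous_bounded_compact cc cK.
apply: (L1loc_mul_integrable (K := K) (M := M)) => //.
  exact: continuous_measurable.
by move=> x _; exact: psi0.
Qed.

(** On each box of a countable cover, smooth functions supported in the closed box converge
    boundedly and pointwise to the indicator of the part of the open box in a given orthant.
    Dominated convergence then reduces the claim to [integral_lowset_ae0]. *)
Lemma fundamental_lemma Om f : open Om -> L1loc Om f ->
  (forall psi, test_function Om psi -> \int[mu]_(x in Om) (f x * psi x)%:E = 0)%E ->
  {ae mu, forall x, Om x -> f x = 0}.
Proof.
move=> oOm fL f0.
have mOm := open_measurable_rV oOm.
have [D [a [b [OmE Omcb]]]] := open_obox_cover oOm.
suff H k : {ae mu, forall x, D k -> obox (a k) (b k) x -> f x = 0}.
  have := ae_foralln (H); apply: filterS => x hx; rewrite OmE => -[k Dk]; exact: hx.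
have [Dk|nDk] := pselect (D k); last by apply/aeW => x.
have kOm : obox (a k) (b k) `<=` Om.
  by move=> x /obox_cbox; exact: Omcb.
have [mf fK] := fL.
have mo := @measurable_obox R n (a k) (b k).
have mc := @measurable_cbox R n (a k) (b k).
have ci : mu.-integrable (cbox (a k) (b k)) (EFin \o f).
  apply/integrableP; split; last by apply: fK; [exact: compact_cbox|exact: Omcb].
  by apply/measurable_EFinP; apply: measurable_funS mf => //; exact: Omcb.
suff : {ae mu, forall x, obox (a k) (b k) x -> f x = 0}.
  by apply: filterS => x hx _.
apply: integral_lowset_ae0 => //.
  by apply: integrableS ci => //; exact: obox_cbox.
move=> c.
(* The [flat] factors vanish outside the closed box, which gives compact support, and tend to strict
   inequalities; the [sigmoid] factor tends to the non-strict inequality that defines the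
   orthant. *)
pose w j x := \prod_i (flat 0 (j.+1%:R * (x ord0 i - a k ord0 i)) *
  flat 0 (j.+1%:R * (b k ord0 i - x ord0 i)) *
  sigmoid (j.+1%:R ^+ 2 * (c ord0 i - x ord0 i) + j.+1%:R)).
have Coow j : Coo (w j).
  move=> l; apply: Ck_prod => i.
  have dif (u : R) : Ck l (fun x : 'rV[R]_n => u - x ord0 i).
    apply: CkD; first exact: Ck_cst.
    by apply: CkN; exact: Ck_coord.
  apply: CkM; [apply: CkM; apply: Ck_flat; (apply: CkM; first exact: Ck_cst)|apply: Ck_sigmoid].
  - by apply: CkD; [exact: Ck_coord|exact: Ck_cst].
  - exact: dif.
  - by apply: CkD; [apply: CkM; [exact: Ck_cst|exact: dif]|exact: Ck_cst].
have w01 j x : 0 <= w j x <= 1.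
  have F i : 0 <= flat 0 (j.+1%:R * (x ord0 i - a k ord0 i)) *
    flat 0 (j.+1%:R * (b k ord0 i - x ord0 i)) *
    sigmoid (j.+1%:R ^+ 2 * (c ord0 i - x ord0 i) + j.+1%:R) <= 1.
    rewrite !mulr_ge0 ?flat_ge0 ?sigmoid_ge0//=.
    by rewrite !mulr_ile1 ?mulr_ge0 ?flat_ge0 ?sigmoid_ge0 ?flat_le1 ?sigmoid_le1.
  apply/andP; split; first by apply: prodr_ge0 => i _; case/andP: (F i).
  by apply: prodr_ile1 => i _; exact: F.
have w0 j x : ~ cbox (a k) (b k) x -> w j x = 0.
  move=> /existsNP[i /negP]; rewrite in_itv/= negb_and -!ltNge => xab.
  apply/eqP; rewrite prodf_seq_eq0; apply/hasP; exists i; first by rewrite mem_index_enum.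
  have j0 : 0 <= j.+1%:R :> R by [].
  rewrite /= !mulf_eq0; apply/orP; left; case/orP: xab => h; apply/orP; [left|right];
    by rewrite flat_le0// mulr_ge0_le0// subr_le0 ltW.
have testw j : test_function Om (w j).
  split => //; exists (cbox (a k) (b k)); split => //; first exact: compact_cbox.
  exact: Omcb.
  exact: w0.
pose E := obox (a k) (b k) `&` lowset c.
have cvw x : w j x @[j --> \oo] --> (\1_E x : R).
  have -> : \1_E x = \prod_i (((0 < x ord0 i - a k ord0 i)%R%:R *
     (0 < b k ord0 i - x ord0 i)%R%:R * (0 <= c ord0 i - x ord0 i)%R%:R) : R).
    rewrite indicE; have [xE|xE] := boolP (x \in E).
      rewrite big1// => i _; have [h1 h2] := set_mem xE.
      by have /andP[e1 e2] := h1 i; rewrite !subr_gt0 subr_ge0 h2 e1 e2 !mulr1.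
    apply/esym/eqP; rewrite prodf_seq_eq0; move: xE; apply: contraNT => /hasPn h.
    apply/mem_set; split => i; have := h i (mem_index_enum i);
      rewrite /= !subr_gt0 subr_ge0 !mulf_eq0 !negb_or !pnatr_eq0 !eqb0 !negbK.
      by move=> /andP[/andP[-> ->]].
    by move=> /andP[/andP[]].
  apply: (@cvg_bigprod _ _ _ _ (fun i j => _)) => i.
  apply: cvgM; [apply: cvgM; exact: cvg_flat|exact: cvg_sigmoid_ge].
have oE : E `<=` obox (a k) (b k) by exact: subIsetl.
have cOm := Omcb k Dk.
have gi : mu.-integrable Om (EFin \o (fun x => `|f x * \1_(cbox (a k) (b k)) x|)).
  apply: integrable_norm.
  apply: (L1loc_mul_integrable (K := cbox (a k) (b k)) (M := 1)) => //.
  - exact: compact_cbox.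
  - by move=> x _ xc; rewrite indicE memNset.
  - by move=> x xc; rewrite indicE mem_set// normr1.
have [|_ cv] := @dominated_cvg_real _ _ _ mu Om (fun j x => f x * w j x)
  (fun x => f x * \1_E x) _ mOm
  (fun j => measurable_funM mf (continuous_measurable oOm (Coo_continuous (Coow j))))
  (fun x _ => cvgM (cvg_cst (f x)) (cvw x)) gi.
  move=> j x Omx; rewrite !normrM ler_wpM2l//.
  have [xc|xc] := boolP (x \in cbox (a k) (b k)).
    by rewrite indicE xc normr1 ler_norml; have /andP[] := w01 j x; lra.
  by rewrite w0 ?normr0// => xc'; move/negP: xc; apply; exact: mem_set.
rewrite (integral_indic_mul (D := Om))//; last by move=> x /oE; exact: kOm.
rewrite -(cvg_lim _ cv)//; apply: cvg_lim => //.
by apply: cvg_near_cst; apply: nearW => j; exact: f0.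
Qed.

End test_functions.

(** * Smooth cutoffs *)

Section cutoff.
Context {R : realType} {n : nat}.
Implicit Types (a b x : 'rV[R]_n) (f g h : 'rV[R]_n -> R) (K Om : set 'rV[R]_n).
Local Notation mu := (@lebesgue_rV R n).

Lemma open_superlevel f (c : R) : continuous f -> open [set x | c < f x].
Proof.
move=> cf; have : open (f @^-1` [set y | c < y]).
  by apply: open_comp; [move=> x _; exact: cf|exact: open_gt].
by [].
Qed.

Lemma open_obox a b : open (obox a b).
Proof.
rewrite (_ : obox a b = [set x | 0 < bump a b x]).
  by apply: open_superlevel; apply: Coo_continuous; exact: Coo_bump.
apply/seteqP; split => x /=; first exact: bump_gt0.
by move=> h; apply: contrapT => /bump_eq0 h0; rewrite h0 ltxx in h.
Qed.

(** For [beta] a finite sum of bumps that is positive on [K], the quotient of [flat 0 (beta x)] by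
    its sum with [flat 0 (del - beta x)] is 0 where [beta] vanishes and 1 where [beta] exceeds
    [del]. Half the minimum of [beta] on [K] is a suitable [del]; the empty set is treated apart
    because it has no minimum point. *)
Lemma cutoff_exists Om K : open Om -> compact K -> K `<=` Om ->
  exists (eta : 'rV[R]_n -> R) (U : set 'rV[R]_n),
    [/\ test_function Om eta, open U, K `<=` U & forall x, U x -> eta x = 1].
Proof.
move=> oOm cK KOm.
have [K0|/set0P[x0 Kx0]] := eqVneq K set0.
  exists (fun=> 0), set0; split => //.
  - split; first by move=> k; exact: Ck_cst.
    by exists set0; split => //; exact: compact0.
  - by rewrite K0.
have [D [a [b [OmE Omcb]]]] := open_obox_cover oOm.
have := cK; rewrite compact_cover => /(_ nat D (fun k => obox (a k) (b k))).
have oo k : D k -> open (obox (a k) (b k)) by move=> _; exact: open_obox.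
move=> /(_ oo); rewrite /cover -OmE => /(_ KOm)[D' D'D KD'].
pose beta x := \sum_(k <- finmap.enum_fset D') bump (a k) (b k) x.
have Cb : Coo beta by move=> k; apply: Ck_sum => i; exact: Coo_bump.
have bge0 x : 0 <= beta x by apply: sumr_ge0 => k _; exact: bump_ge0.
have bpos x : K x -> 0 < beta x.
  move=> /KD'[k /= kD' xk]; rewrite /beta (big_rem k)//= ltr_wpDr ?bump_gt0//.
  by apply: sumr_ge0 => i _; exact: bump_ge0.
have [c /set_mem Kc cmin] := EVT_min_rV (ex_intro _ x0 Kx0) cK
  (continuous_subspaceT (Coo_continuous Cb)).
pose del := beta c / 2.
have del0 : 0 < del by rewrite divr_gt0// bpos.
have den x : 0 < flat 0 (beta x) + flat 0 (del - beta x).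
  have [bx|bx] := ltrP 0 (beta x); first by rewrite ltr_wpDr ?flat_ge0// flat_gt0.
  by rewrite ltr_wpDl ?flat_ge0// flat_gt0; lra.
exists (fun x => flat 0 (beta x) * (flat 0 (beta x) + flat 0 (del - beta x))^-1).
exists [set x | del < beta x]; split.
- split.
    move=> k; apply: CkM; first exact: Ck_flat.
    apply: CkV => [x|]; first by rewrite gt_eqF.
    apply: CkD; first exact: Ck_flat.
    by apply: Ck_flat; apply: CkD; [exact: Ck_cst|apply: CkN].
  exists (\big[setU/set0]_(k <- finmap.enum_fset D') cbox (a k) (b k)); split.
  + by apply: bigsetU_compact => k _; exact: compact_cbox.
  + rewrite -bigcup_seq => x [k /= kD' xk]; apply: (Omcb k) => //.
    exact/set_mem/D'D.
  + move=> x; rewrite -bigcup_seq => nx; rewrite [beta x]big_seq big1.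
      by rewrite flat_le0// mul0r.
    move=> k kD'; apply: bump_eq0 => /obox_cbox xk; apply: nx; by exists k.
- exact/open_superlevel/Coo_continuous.
- move=> x Kx /=; have := cmin x (mem_set Kx).
  by have := bpos _ Kc; rewrite /del; lra.
- move=> x /= dx; rewrite [flat 0 (del - _)]flat_le0 ?addr0; last lra.
  by rewrite mulfV// gt_eqF// flat_gt0; lra.
Qed.

End cutoff.

(** * Linearity and uniqueness of weak derivatives *)

Section weak_derivative.
Context {R : realType} {n : nat}.
Implicit Types (x : 'rV[R]_n) (f g h : 'rV[R]_n -> R) (K Om : set 'rV[R]_n).
Local Notation mu := (@lebesgue_rV R n).

Lemma L1locD Om f g : open Om -> L1loc Om f -> L1loc Om g ->
  L1loc Om (fun x => f x + g x).
Proof.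
move=> oOm [mf fK] [mg gK]; split; first exact: measurable_funD.
move=> K cK KOm; have mK := compact_measurable_rV cK.
have [mfK mgK] : measurable_fun K f /\ measurable_fun K g.
  have mOm := open_measurable_rV oOm.
  by split; [exact: measurable_funS mf|exact: measurable_funS mg].
apply: (@le_lt_trans _ _ (\int[mu]_(x in K) (`|f x|%:E + `|g x|%:E))%E).
  apply: ge0_le_integral => //.
  - by apply/measurable_EFinP; apply: measurableT_comp => //; exact: measurable_funD.
  - by apply: emeasurable_funD; apply/measurable_EFinP; apply: measurableT_comp.
  - by move=> x _; rewrite -EFinD lee_fin ler_normD.
rewrite ge0_integralD//.
- by apply: lte_add_pinfty; [exact: fK|exact: gK].
- by apply/measurable_EFinP; apply: measurableT_comp.
- by apply/measurable_EFinP; apply: measurableT_comp.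
Qed.

Lemma L1locZ Om f (c : R) : open Om -> L1loc Om f -> L1loc Om (fun x => c * f x).
Proof.
move=> oOm [mf fK]; split; first exact: measurable_funM.
move=> K cK KOm; have mK := compact_measurable_rV cK.
have mOm := open_measurable_rV oOm.
have mfK : measurable_fun K f by exact: measurable_funS mf.
under eq_integral do rewrite normrM EFinM.
rewrite ge0_integralZl//; last by apply/measurable_EFinP; apply: measurableT_comp.
by apply: lte_mul_pinfty => //; exact: fK.
Qed.

Lemma is_wpartialD Om i f f' g g' : open Om ->
  is_wpartial Om i f g -> is_wpartial Om i f' g' ->
  is_wpartial Om i (fun x => f x + f' x) (fun x => g x + g' x).
Proof.
move=> oOm [fL gL H] [fL' gL' H']; split; [exact: L1locD|exact: L1locD|].
move=> psi tpsi; have mOm := open_measurable_rV oOm.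
have tp := test_function_partial i tpsi.
under eq_integral do rewrite mulrDl EFinD.
rewrite integralD_EFin//; [|exact: test_mul_integrable..].
under [in RHS]eq_integral do rewrite mulrDl EFinD.
rewrite [in RHS]integralD_EFin//; [|exact: test_mul_integrable..].
rewrite H// H'// fin_num_oppeD//.
by apply: integrable_fin_num => //; exact: test_mul_integrable.
Qed.

Lemma is_wpartialZ Om i f g (c : R) : open Om ->
  is_wpartial Om i f g -> is_wpartial Om i (fun x => c * f x) (fun x => c * g x).
Proof.
move=> oOm [fL gL H]; split; [exact: L1locZ|exact: L1locZ|].
move=> psi tpsi; have mOm := open_measurable_rV oOm.
have tp := test_function_partial i tpsi.
under eq_integral do rewrite -mulrA EFinM.
rewrite integralZl//; last exact: test_mul_integrable.
under [in RHS]eq_integral do rewrite -mulrA EFinM.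
rewrite [in RHS]integralZl//; last exact: test_mul_integrable.
by rewrite H// muleN.
Qed.

Lemma is_wpartial_unique Om i f g g' : open Om ->
  is_wpartial Om i f g -> is_wpartial Om i f g' ->
  {ae mu, forall x, Om x -> g x = g' x}.
Proof.
move=> oOm H H'.
have := is_wpartialD oOm H (is_wpartialZ (- 1) oOm H').
move=> [_ L H0].
suff : {ae mu, forall x, Om x -> g x + -1 * g' x = 0}.
  by apply: filterS => x h Omx; have := h Omx; lra.
apply: fundamental_lemma => // psi tpsi.
have := H0 psi tpsi.
under eq_integral do rewrite mulN1r subrr mul0r.
by rewrite integral0 => /esym/eqP; rewrite oppe_eq0 => /eqP.
Qed.

Lemma wpartialP Om i f g : is_wpartial Om i f g -> is_wpartial Om i f (wpartial Om i f).
Proof. by move=> H; exact: (@getPex _ (is_wpartial Om i f) (ex_intro _ g H)). Qed.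

Lemma wpartial_ae Om i f g : open Om -> is_wpartial Om i f g ->
  {ae mu, forall x, Om x -> wpartial Om i f x = g x}.
Proof. by move=> oOm H; apply: is_wpartial_unique (H) => //; exact: wpartialP H. Qed.

End weak_derivative.

(** * Inequalities for powers and Euclidean norms *)

Section power_inequalities.
Context {R : realType}.
Implicit Types (p q r s t y z c : R).

(** Young's inequality for [y] and 1 with exponent [r] and its conjugate, whence the separate case
    [r = 1]. *)
Lemma bernoulli r y : 0 <= y -> 1 <= r -> 1 + r * (y - 1) <= y `^ r.
Proof.
move=> y0; rewrite le_eqVlt => /predU1P[<-|r1].
  by rewrite powRr1// mul1r addrC subrK.
have r0 : 0 < r by lra.
have q0 : 0 < (1 - r^-1)^-1 by rewrite invr_gt0 subr_gt0 invf_lt1.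
have := @conjugate_powR R y 1 r _ y0 ler01 r0 q0.
rewrite invrK addrC subrK => /(_ erefl); rewrite mulr1 powR1 mul1r.
have -> : r * (y - 1) = r * y - r by ring.
set w := y `^ r => h.
have : r * y <= r * (w / r + (1 - r^-1)) by rewrite ler_pM2l.
by rewrite mulrDr mulrBr mulr1 mulfV ?gt_eqF// mulrCA mulfV ?gt_eqF//; lra.
Qed.

(** [bernoulli] for the base z^r and the exponent 1/r. *)
Lemma bernoulli_concave r z : 0 <= z -> 0 < r <= 1 -> z `^ r <= 1 + r * (z - 1).
Proof.
move=> z0 /andP[r0 r1]; have r1' : 1 <= r^-1 by rewrite invf_ge1.
have := bernoulli (powR_ge0 z r) r1'.
rewrite -powRrM mulfV ?gt_eqF// powRr1// => h.
have : r * (1 + r^-1 * (z `^ r - 1)) <= r * z by rewrite ler_pM2l.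
by rewrite mulrDr mulr1 mulrA mulfV ?gt_eqF// mul1r; lra.
Qed.

(* With [y^(p-1) = (1/y)^-(p-1)] and concavity of [z^(p-1)], [y^p] is at least
   [y^2 / (y + (p-1)(1-y))], an explicit rational function. *)
Lemma powR_quadratic_lower p y : 1 < p <= 2 -> 0 <= y <= 2 ->
  1 + p * (y - 1) + (p - 1) ^+ 2 / 2 * (y - 1) ^+ 2 <= y `^ p.
Proof.
move=> /andP[p1 p2] /andP[y0 y2].
move: y0; rewrite le_eqVlt => /predU1P[<-|y0].
  by rewrite powR0 ?gt_eqF//; [nra|lra].
have a01 : 0 < p - 1 <= 1 by apply/andP; split; lra.
have yi : 0 <= y^-1 by rewrite invr_ge0 ltW.
have := bernoulli_concave yi a01; set w := _ `^ _ => hw.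
have w0 : 0 < w by rewrite powR_gt0// invr_gt0.
have yp : y `^ p * w = y.
  rewrite /w -[y^-1]powR_inv1 ?ltW// -powRrM -powRD; last by rewrite (gt_eqF y0) implybT.
  by rewrite (_ : p + _ = 1) ?powRr1 ?ltW//; ring.
set Y := y `^ p in yp *.
have Y0 : 0 < Y by rewrite powR_gt0.
have h1 : y * y <= Y * (y + (p - 1) * (1 - y)).
  have -> : y + (p - 1) * (1 - y) = y * (1 + (p - 1) * (y^-1 - 1)).
    by field; rewrite gt_eqF.
  by rewrite mulrCA ler_pM2l// -{1}yp ler_pM2l.
have den : 0 < y + (p - 1) * (1 - y) by nra.
rewrite -(ler_pM2r den); apply: le_trans h1.
set z := y - 1; have -> : y = 1 + z by rewrite /z; ring.
have zb : -1 <= z <= 1 by rewrite /z; apply/andP; split; lra.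
set a := p - 1 in a01 *; have -> : p = 1 + a by rewrite /a; ring.
move/andP: a01 zb => [a0 a1] /andP[z1 z2].
have -> : 1 + z + a * (1 - (1 + z)) = 1 + (1 - a) * z by ring.
have h3 : 1 + (1 - a) * z <= 2 by nra.
have : a ^+ 2 / 2 * z ^+ 2 * (1 + (1 - a) * z) <= a ^+ 2 * z ^+ 2.
  have -> : a ^+ 2 * z ^+ 2 = a ^+ 2 / 2 * z ^+ 2 * 2 by field.
  by rewrite ler_wpM2l// mulr_ge0 ?sqr_ge0// divr_ge0 ?sqr_ge0.
by nra.
Qed.

Lemma le_1DpowR p t : 0 <= t -> 1 <= p -> t <= 1 + t `^ p.
Proof.
move=> t0 p1; have [t1|t1] := lerP t 1; first by rewrite (le_trans t1)// lerDl powR_ge0.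
by rewrite ler_wpDl// le1r_powR// ltW.
Qed.

(** [bernoulli] for the base t^q and the exponent p/q. The constants do not involve [p], so the
    bound can be integrated when the exponent is unbounded. *)
Lemma powR_le_modular q p t : 1 <= q -> q <= p -> 0 <= t ->
  t `^ q <= 1 + q * (t `^ p / p).
Proof.
move=> q1 qp t0; have q0 : 0 < q by lra.
have p0 : 0 < p by lra.
have r1 : 1 <= p / q by rewrite ler_pdivlMr// mul1r.
have := bernoulli (powR_ge0 t q) r1; rewrite -powRrM mulrCA mulfV ?gt_eqF// mulr1 => h.
have : q / p * (1 + p / q * (t `^ q - 1)) <= q / p * t `^ p by rewrite ler_pM2l// divr_gt0.
have -> : q / p * (1 + p / q * (t `^ q - 1)) = q / p + t `^ q - 1.
  by field; rewrite !gt_eqF.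
have : 0 < q / p by rewrite divr_gt0.
have -> : q * (t `^ p / p) = q / p * t `^ p by ring.
lra.
Qed.

(** As 2^p >= 1 + p, a factor 1/2 inside the power absorbs the weight 1/p. Hence a finite modular
    implies membership in [Lp], with scale 1/2. *)
Lemma half_powR_le p t : 1 <= p -> 0 <= t -> (2^-1 * t) `^ p <= t `^ p / p.
Proof.
move=> p1 t0; have p0 : 0 < p by lra.
rewrite powRM ?invr_ge0// mulrC ler_wpM2l ?powR_ge0//.
rewrite -[2^-1]powR_inv1// -powRrM mulN1r powRN lef_pV2 ?posrE ?powR_gt0//.
have := @bernoulli p 2 _ p1; rewrite (_ : 2 - 1 = 1 :> R); last ring.
by rewrite mulr1 => /(_ (ler0n _ 2)); lra.
Qed.

(** Above the threshold [s] one has t = t^(1-q) t^q, and the first factor decreases in [t]. *)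
Lemma le_trunc_powR q s t : 1 <= q -> 0 < s -> 0 <= t ->
  t <= s + s `^ (1 - q) * t `^ q.
Proof.
move=> q1 s0 t0; have [ts|st] := lerP t s.
  by rewrite (le_trans ts)// lerDl mulr_ge0// powR_ge0.
have t1 : 0 < t by exact: lt_trans st.
apply: ler_wpDl; first exact: ltW.
apply: (@le_trans _ _ (t `^ (1 - q) * t `^ q)).
  rewrite -powRD ?subrK ?powRr1//; last by rewrite (gt_eqF t1) implybT.
rewrite ler_wpM2r ?powR_ge0// -opprB !powRN lef_pV2 ?posrE ?powR_gt0//.
by apply: ge0_ler_powR; rewrite ?nnegrE ?subr_ge0// ltW.
Qed.

(** [bernoulli] at y/w, multiplied by w^h. *)
Lemma powR_tangent h y w : 0 <= y -> 0 < w -> 1 <= h ->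
  w `^ h + h * w `^ (h - 1) * (y - w) <= y `^ h.
Proof.
move=> y0 w0 h1; have := bernoulli (divr_ge0 y0 (ltW w0)) h1.
rewrite -(ler_pM2r (powR_gt0 h w0)) -powRM ?divr_ge0 ?(ltW w0)// divfK ?gt_eqF//.
apply: le_trans; rewrite le_eqVlt; apply/orP; left; apply/eqP.
rewrite -(mulr_powRB1 (ltW w0)); last by lra.
by field; rewrite gt_eqF.
Qed.

Lemma powR_convex h x y : 0 <= x -> 0 <= y -> 1 <= h ->
  ((x + y) / 2) `^ h <= (x `^ h + y `^ h) / 2.
Proof.
move=> x0 y0 h1; have [/eqP|w0] := eqVneq ((x + y) / 2) 0.
  move=> /eqP ->; rewrite powR0; last by rewrite gt_eqF//; lra.
  by rewrite divr_ge0// addr_ge0// powR_ge0.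
have {}w0 : 0 < (x + y) / 2 by rewrite lt_neqAle eq_sym w0 divr_ge0// addr_ge0.
have := powR_tangent x0 w0 h1; have := powR_tangent y0 w0 h1.
set w := _ / 2 in w0 *; set W := w `^ h; set V := h * _.
have -> : x - w = - (y - w) by rewrite /w; field.
by lra.
Qed.

Lemma powR_superadd h s t : 0 <= s -> 0 <= t -> 1 <= h ->
  s `^ h + t `^ h <= (s + t) `^ h.
Proof.
move=> s0 t0 h1; have h0 : 0 < h by lra.
have st : 0 <= s + t by rewrite addr_ge0.
rewrite -(mulr_powRB1 s0 h0) -(mulr_powRB1 t0 h0) -(mulr_powRB1 st h0).
have h' : 0 <= h - 1 by lra.
rewrite mulrDl lerD// ler_wpM2l// ge0_ler_powR// ?nnegrE//; by [rewrite lerDl|rewrite lerDr].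
Qed.

Lemma powR_ge_linear p y : 0 <= y <= 1 -> 1 <= p -> y `^ p <= y.
Proof.
move=> /andP[]; rewrite le_eqVlt => /predU1P[<- _ p1|y0 y1 p1].
  by rewrite powR0// gt_eqF//; lra.
by apply: ge1r_powR => //; rewrite y0.
Qed.

(* In terms of [m = (x+y)/2] and [d = (x-y)/2]; either [d <= eta m], or the
   convexity gap controls [d^p]. *)
Lemma scalar_unif_convex p r x y eta : 1 < r -> r <= p -> r <= 2 -> p <= 2 ->
  0 < eta <= 1 ->
  (`|x - y| / 2) `^ p <=
    ((r - 1) ^+ 2 / 2 * eta ^+ 2)^-1 *
      ((`|x| `^ p + `|y| `^ p) / 2 - (`|x + y| / 2) `^ p) +
    eta * ((`|x| `^ p + `|y| `^ p) / 2).
Proof.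
move=> r1 rp r2 p2 /andP[e0 e1].
wlog xy : x y / `|y| <= `|x|.
  move=> H; have [h|/ltW h] := lerP `|y| `|x|; first exact: H.
  by have := H y x h; rewrite distrC (addrC (`|y| `^ p)) (addrC y).
wlog x0 : x y xy / 0 <= x.
  move=> H; have [h|/ltW h] := lerP 0 x; first exact: H.
  have := H (- x) (- y); rewrite !normrN oppr_ge0 => /(_ xy h).
  by rewrite opprK (addrC (- x)) (distrC y) -opprD normrN.
rewrite (ger0_norm x0) in xy *; have /ler_normlP[y1 y2] := xy.
set m := (x + y) / 2; set d := (x - y) / 2.
have m0 : 0 <= m by rewrite divr_ge0//; lra.
have d0 : 0 <= d by rewrite divr_ge0//; lra.
have xmy : 0 <= x - y by lra.
have xpy : 0 <= x + y by lra.
rewrite (ger0_norm xmy) (ger0_norm xpy).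
rewrite -/m -/d.
have -> : x = m + d by rewrite /m /d; field.
have -> : y = m - d by rewrite /m /d; field.
set c := (r - 1) ^+ 2 / 2; set S := (_ + _) / 2.
have p1 : 1 < p by lra.
have pb : 1 < p <= 2 by rewrite p1.
have c0 : 0 < c by rewrite divr_gt0// exprn_gt0//; lra.
have cp : c <= (p - 1) ^+ 2 / 2.
  by rewrite ler_pM2r ?invr_gt0// ler_sqr ?nnegrE; lra.
have c12 : c <= 1 / 2 by rewrite ler_pM2r ?invr_gt0//; nra.
(* The symmetric pair of arguments cancels the linear terms of [powR_quadratic_lower]. It is used
   with [M] the larger of [m] and [d], so that the ratio [z] of the two is at most 1. *)
have key M z : 0 <= M -> 0 <= z <= 1 ->
    M `^ p * (1 + c * z ^+ 2) <= ((M * (1 + z)) `^ p + (M * (1 - z)) `^ p) / 2.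
  move=> M0 /andP[z0 z1]; rewrite !powRM//; [|lra..].
  rewrite -mulrDr -mulrA ler_wpM2l ?powR_ge0//.
  have h1 : 0 <= 1 + z <= 2 by apply/andP; split; lra.
  have h2 : 0 <= 1 - z <= 2 by apply/andP; split; lra.
  have := powR_quadratic_lower pb h1; have := powR_quadratic_lower pb h2.
  have -> : 1 + z - 1 = z by ring.
  have -> : 1 - z - 1 = - z by ring.
  rewrite sqrrN; have : c * z ^+ 2 <= (p - 1) ^+ 2 / 2 * z ^+ 2.
    by rewrite ler_wpM2r// sqr_ge0.
  by lra.
have ce0 : 0 < c * eta ^+ 2 by rewrite mulr_gt0// exprn_gt0.
have cei : c^-1 <= (c * eta ^+ 2)^-1.
  by rewrite lef_pV2 ?posrE//; apply: ler_piMr; [exact: ltW|rewrite exprn_ile1// (ltW e0)].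
have [dm|md] := lerP d m.
  have [m00|mn0] := eqVneq m 0.
    have d00 : d = 0 by lra.
    rewrite /S d00 m00 addr0 subr0 normr0 powR0 ?gt_eqF//; last by lra.
    by rewrite addr0 mul0r subrr !mulr0 addr0.
  have mp : 0 < m by rewrite lt_neqAle eq_sym mn0.
  have z01 : 0 <= d / m <= 1 by rewrite divr_ge0//= ler_pdivrMr// mul1r.
  have := key m _ m0 z01.
  have -> : m * (1 + d / m) = m + d by field.
  have -> : m * (1 - d / m) = m - d by field.
  rewrite -[X in (_ + X `^ p) / 2]ger0_norm ?subr_ge0// -/S => h.
  have mS : m `^ p <= S.
    by apply: le_trans h; rewrite ler_peMr ?powR_ge0// lerDl mulr_ge0 ?sqr_ge0// ltW.
  have D0 : 0 <= S - m `^ p by rewrite subr_ge0.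
  have [de|ed] := lerP d (eta * m).
    rewrite ler_wpDl//; first by rewrite mulr_ge0// invr_ge0 ltW.
    apply: (@le_trans _ _ (eta * m `^ p)); last by rewrite ler_wpM2l// ltW.
    apply: (@le_trans _ _ ((eta * m) `^ p)).
      by apply: ge0_ler_powR; rewrite ?nnegrE ?mulr_ge0//; lra.
    rewrite powRM//; last exact: ltW.
    rewrite ler_wpM2r ?powR_ge0// powR_ge_linear ?e1 ?(ltW e0)//; exact: ltW.
  rewrite ler_wpDr//; first by rewrite mulr_ge0 ?(ltW e0)// (le_trans _ mS) ?powR_ge0.
  rewrite mulrC ler_pdivlMr//.
  have : m `^ p * (c * (d / m) ^+ 2) <= S - m `^ p by lra.
  apply: le_trans; rewrite ler_pM ?powR_ge0 ?(ltW ce0)//.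
    by apply: ge0_ler_powR; rewrite ?nnegrE//; lra.
  rewrite ler_pM2l// ler_sqr ?nnegrE ?divr_ge0 ?(ltW e0)//.
  by rewrite ler_pdivlMr// ltW.
have dp : 0 < d by exact: le_lt_trans md.
have z01 : 0 <= m / d <= 1 by rewrite divr_ge0//= ler_pdivrMr// mul1r ltW.
have := key d _ d0 z01.
have -> : d * (1 + m / d) = m + d by field; rewrite gt_eqF.
have -> : d * (1 - m / d) = d - m by field; rewrite gt_eqF.
rewrite -[X in (_ + X `^ p) / 2]ger0_norm ?subr_ge0 ?(ltW md)// distrC -/S => h.
set z := m / d in z01 h; have mE : m = d * z by rewrite /z mulrCA mulfV ?mulr1 ?gt_eqF.
have zp : z `^ p <= z by apply: powR_ge_linear => //; lra.
have dP : 0 < d `^ p by rewrite powR_gt0.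
have mp : m `^ p <= d `^ p * z.
  by rewrite mE powRM//; [rewrite ler_wpM2l// powR_ge0|case/andP: z01].
(* When d > m, [key] and m^p <= d^p z bound the gap below by d^p (1 + c z^2 - z), and this factor is
   at least [c] because (1 - z) (1 - c (1 + z)) >= 0. *)
have h2 : c * d `^ p <= S - m `^ p.
  have : d `^ p * (1 + c * z ^+ 2 - z) <= S - m `^ p by rewrite mulrBr; lra.
  apply: le_trans; rewrite mulrC ler_pM2l//; case/andP: z01 => z0 z1.
  have cz : c * (1 + z) <= 1 / 2 * 2.
    by apply: ler_pM; [exact: ltW|rewrite addr_ge0|exact: c12|rewrite lerD2l].
  have := mulr_ge0 (_ : 0 <= 1 - z) (_ : 0 <= 1 - c * (1 + z)).
  rewrite divfK ?pnatr_eq0// in cz; rewrite !subr_ge0 => /(_ z1 cz).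
  have -> : (1 - z) * (1 - c * (1 + z)) = 1 + c * z ^+ 2 - z - c by ring.
  by rewrite subr_ge0.
have S0 : 0 <= S by rewrite divr_ge0// addr_ge0// powR_ge0.
rewrite ler_wpDr//; first by rewrite mulr_ge0// ltW.
apply: (@le_trans _ _ (c^-1 * (S - m `^ p))).
  by rewrite mulrC ler_pdivlMr// mulrC.
rewrite ler_wpM2r//; by apply: le_trans h2; rewrite mulr_ge0// ltW.
Qed.

End power_inequalities.

(** * Euclidean norms: convexity and Clarkson's inequality *)

Section euclidean.
Context {R : realType} {n : nat}.
Implicit Types (a b c : 'rV[R]_n).

Lemma dotvC a b : dotv a b = dotv b a.
Proof. by apply: eq_bigr => i _; rewrite mulrC. Qed.

Lemma dotvDl a b c : dotv (a + b) c = dotv a c + dotv b c.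
Proof. by rewrite -big_split/=; apply: eq_bigr => i _; rewrite mxE mulrDl. Qed.

Lemma dotvZl (k : R) a b : dotv (k *: a) b = k * dotv a b.
Proof. by rewrite mulr_sumr; apply: eq_bigr => i _; rewrite mxE mulrA. Qed.

Lemma dotvNl a b : dotv (- a) b = - dotv a b.
Proof. by rewrite -scaleN1r dotvZl mulN1r. Qed.

Lemma dotvDr a b c : dotv c (a + b) = dotv c a + dotv c b.
Proof. by rewrite dotvC dotvDl !(dotvC c). Qed.

Lemma dotvZr (k : R) a b : dotv b (k *: a) = k * dotv b a.
Proof. by rewrite dotvC dotvZl dotvC. Qed.

Lemma dotvNr a b : dotv b (- a) = - dotv b a.
Proof. by rewrite dotvC dotvNl dotvC. Qed.

Lemma dotv_ge0 a : 0 <= dotv a a.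
Proof. by apply: sumr_ge0 => i _; rewrite -expr2 sqr_ge0. Qed.

Lemma dotv_eq0 a : dotv a a = 0 -> a = 0.
Proof.
move=> /eqP; rewrite psumr_eq0; last by move=> i _; rewrite -expr2 sqr_ge0.
move=> /allP h; apply/rowP => i; rewrite mxE.
by have := h i (mem_index_enum i); rewrite /= -expr2 sqrf_eq0 => /eqP.
Qed.

Lemma dotv0 a : dotv a 0 = 0.
Proof. by rewrite /dotv big1// => i _; rewrite mxE mulr0. Qed.

Lemma enorm_ge0 a : 0 <= enorm a.
Proof. exact: sqrtr_ge0. Qed.

Lemma sqr_enorm a : enorm a ^+ 2 = dotv a a.
Proof. by rewrite sqr_sqrtr// dotv_ge0. Qed.

Lemma enorm0 : enorm (0 : 'rV[R]_n) = 0.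
Proof. by rewrite /enorm dotv0 sqrtr0. Qed.

Lemma enorm_eq0 a : enorm a = 0 -> a = 0.
Proof. by move=> h; apply: dotv_eq0; rewrite -sqr_enorm h expr0n. Qed.

Lemma enormZ (k : R) a : enorm (k *: a) = `|k| * enorm a.
Proof. by rewrite /enorm dotvZl dotvZr mulrA -expr2 sqrtrM ?sqr_ge0// sqrtr_sqr. Qed.

Lemma enormN a : enorm (- a) = enorm a.
Proof. by rewrite -scaleN1r enormZ normrN1 mul1r. Qed.

Lemma cauchy_schwarz a b : dotv a b <= enorm a * enorm b.
Proof.
have [B0|B0] := eqVneq (dotv b b) 0.
  by rewrite (dotv_eq0 B0) dotv0 mulr_ge0// enorm_ge0.
have Bp : 0 < dotv b b by rewrite lt_neqAle eq_sym B0 dotv_ge0.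
have := dotv_ge0 (dotv b b *: a - dotv a b *: b).
rewrite dotvDl !dotvDr !dotvNl !dotvNr !dotvZl !dotvZr (dotvC b a) => h.
have : 0 <= dotv b b * (dotv a a * dotv b b - dotv a b ^+ 2).
  by apply: le_trans h _; rewrite le_eqVlt; apply/orP; left; apply/eqP; ring.
rewrite pmulr_rge0// subr_ge0 => h2.
rewrite -sqrtrM ?dotv_ge0//; apply: le_trans (ler_norm _) _.
by rewrite -sqrtr_sqr ler_wsqrtr.
Qed.

Lemma ler_enormD a b : enorm (a + b) <= enorm a + enorm b.
Proof.
rewrite -ler_sqr ?nnegrE ?addr_ge0 ?enorm_ge0// sqr_enorm dotvDl !dotvDr (dotvC b a).
have := cauchy_schwarz a b; have := sqr_enorm a; have := sqr_enorm b.
by move=> h1 h2; rewrite sqrrD h1 h2; lra.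
Qed.

Lemma enorm_coord a i : `|a ord0 i| <= enorm a.
Proof.
rewrite -sqrtr_sqr ler_wsqrtr// /dotv (bigD1 i)//= -expr2 lerDl.
by apply: sumr_ge0 => j _; rewrite -expr2 sqr_ge0.
Qed.

Lemma enorm_le_sum a : enorm a <= \sum_i `|a ord0 i|.
Proof.
have S0 : 0 <= \sum_i `|a ord0 i| by exact: sumr_ge0.
rewrite -ler_sqr ?nnegrE ?enorm_ge0// sqr_enorm expr2 mulr_suml.
apply: ler_sum => i _; rewrite (le_trans (ler_norm _))// normrM.
by rewrite ler_wpM2l// (bigD1 i)//= lerDl sumr_ge0.
Qed.

Lemma powR_enorm (p : R) a : enorm a `^ p = dotv a a `^ (p / 2).
Proof. by rewrite /enorm -powR12_sqrt ?dotv_ge0// -powRrM mulrC. Qed.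

Lemma plap_diag (p : R) a : 0 < p -> enorm a `^ (p - 2) * dotv a a = enorm a `^ p.
Proof.
move=> p0; have [/enorm_eq0 ->|a0] := eqVneq (enorm a) 0.
  by rewrite dotv0 mulr0 enorm0 powR0// gt_eqF.
rewrite -sqr_enorm -powR_mulrn ?enorm_ge0// -powRD ?subrK//.
by rewrite a0 implybT.
Qed.

(** The subgradient inequality for the convex function |b|^p/p. It is obtained from Cauchy-Schwarz
    and Young rather than by differentiation, so it includes [a = 0] for every p > 1. *)
Lemma plap_gradient_ineq (p : R) a b : 1 < p ->
  enorm a `^ p / p + enorm a `^ (p - 2) * dotv a (b - a) <= enorm b `^ p / p.
Proof.
move=> p1; have p0 : 0 < p by lra.
rewrite dotvDr dotvNr mulrDr mulrN (plap_diag a p0).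
have h1 : enorm a `^ (p - 2) * dotv a b <= enorm a `^ (p - 1) * enorm b.
  have [/enorm_eq0 ->|a0] := eqVneq (enorm a) 0.
    by rewrite dotvC dotv0 mulr0 mulr_ge0 ?powR_ge0 ?enorm_ge0.
  have -> : p - 1 = (p - 2) + 1 by ring.
  rewrite [X in _ <= X * _]powRD; last by rewrite a0 implybT.
  rewrite powRr1 ?enorm_ge0// -mulrA.
  by rewrite ler_wpM2l ?powR_ge0// cauchy_schwarz.
have q0 : 0 < p / (p - 1) by rewrite divr_gt0//; lra.
have e : (p / (p - 1))^-1 + p^-1 = 1 by field; rewrite !gt_eqF//; lra.
have := conjugate_powR (powR_ge0 (enorm a) (p - 1)) (enorm_ge0 b) q0 p0 e.
rewrite -powRrM (_ : (p - 1) * (p / (p - 1)) = p); last by field; rewrite gt_eqF//; lra.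
have -> : enorm a `^ p / (p / (p - 1)) = enorm a `^ p - enorm a `^ p / p.
  by field; rewrite !gt_eqF//; lra.
by lra.
Qed.

(** The gradient inequalities at the midpoint towards [a] and towards [b] have opposite linear
    terms. *)
Lemma enorm_midpoint_convex (p : R) a b : 1 < p ->
  enorm (2^-1 *: (a + b)) `^ p <= (enorm a `^ p + enorm b `^ p) / 2.
Proof.
move=> p1; have p0 : 0 < p by lra.
set m := 2^-1 *: (a + b); have := plap_gradient_ineq m a p1.
have := plap_gradient_ineq m b p1.
have -> : b - m = - (a - m).
  by apply/rowP => i; rewrite !mxE; field.
rewrite dotvNr mulrN; set D := _ * dotv _ _.
set A := enorm a `^ p / p; set B := enorm b `^ p / p; set M := enorm m `^ p / p => h1 h2.
have : M <= (A + B) / 2 by lra.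
rewrite /M /A /B.
by rewrite -mulrDl mulrAC ler_pM2r// invr_gt0.
Qed.

(** With h = p/2 >= 1: superadditivity of t^h, then the parallelogram identity, then convexity of
    t^h. *)
Lemma clarkson (p : R) a b : 2 <= p ->
  enorm (2^-1 *: (a - b)) `^ p <=
  (enorm a `^ p + enorm b `^ p) / 2 - enorm (2^-1 *: (a + b)) `^ p.
Proof.
move=> p2; have h1 : 1 <= p / 2 by rewrite ler_pdivlMr// mul1r.
rewrite !powR_enorm lerBrDr.
apply: le_trans (powR_superadd (dotv_ge0 _) (dotv_ge0 _) h1) _.
apply: le_trans _ (powR_convex (dotv_ge0 a) (dotv_ge0 b) h1).
rewrite le_eqVlt; apply/orP; left; apply/eqP; congr (_ `^ _).
by rewrite !dotvZl !dotvZr !dotvDl !dotvDr !dotvNl !dotvNr (dotvC b a); field.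
Qed.

End euclidean.

(** [C] depends on [r] and [e] only, so the estimate can be integrated where the exponent is
    unbounded. The loss of [e] times the mean is harmless since it is applied to functions of
    bounded energy. Truncating [r] at 2 and [e] at 1 meets the hypotheses of the scalar estimate. *)
Lemma unif_convex {R : realType} (n : nat) (r e : R) : 1 < r -> 0 < e ->
  exists2 C : R, 0 <= C & forall (p : R) (a b : 'rV[R]_n),
    r <= p -> 2 <= p \/ n = 1%N ->
    enorm (2^-1 *: (a - b)) `^ p <=
      C * ((enorm a `^ p + enorm b `^ p) / 2 - enorm (2^-1 *: (a + b)) `^ p)
      + e * ((enorm a `^ p + enorm b `^ p) / 2).
Proof.
move=> r1 e0.
pose r' := Num.min r 2; pose eta := Num.min e 1.
have r'1 : 1 < r' by rewrite lt_min r1; lra.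
have eta0 : 0 < eta <= 1 by rewrite lt_min e0 ltr01 ge_min lexx orbT.
have K0 : 0 < (r' - 1) ^+ 2 / 2 * eta ^+ 2.
  by rewrite mulr_gt0 ?divr_gt0 ?exprn_gt0//; [lra|case/andP: eta0].
exists (1 + ((r' - 1) ^+ 2 / 2 * eta ^+ 2)^-1).
  by rewrite addr_ge0// invr_ge0 ltW.
move=> p a b rp pn; have p1 : 1 < p by lra.
set S := (enorm a `^ p + enorm b `^ p) / 2.
have S0 : 0 <= S by rewrite divr_ge0// addr_ge0// powR_ge0.
have D0 : 0 <= S - enorm (2^-1 *: (a + b)) `^ p.
  by rewrite subr_ge0; exact: enorm_midpoint_convex.
have Ki : 0 <= ((r' - 1) ^+ 2 / 2 * eta ^+ 2)^-1 by rewrite invr_ge0 ltW.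
have [p2|p2] := lerP 2 p.
  have := clarkson a b p2; rewrite -/S mulrDl mul1r => h.
  apply: le_trans h _; rewrite -addrA lerDl addr_ge0//.
    exact: mulr_ge0.
  by rewrite mulr_ge0// ltW.
case: pn => [|n1]; first by rewrite leNgt p2.
move: a b @S S0 D0; rewrite n1 => a b S S0 D0.
have E (c : 'rV[R]_1) : enorm c = `|c ord0 ord0|.
  by rewrite /enorm /dotv big_ord_recl big_ord0 addr0 -expr2 sqrtr_sqr.
have r'p : r' <= p by rewrite ge_min rp.
have r'2 : r' <= 2 by rewrite ge_min lexx orbT.
have := scalar_unif_convex (a ord0 ord0) (b ord0 ord0) r'1 r'p r'2 (ltW p2) eta0.
move: @S S0 D0; rewrite !enormZ !E !mxE (ger0_norm (_ : 0 <= 2^-1))// => S S0 D0.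
rewrite -/S ![2^-1 * _]mulrC [_ * S]mulrC.
rewrite [2^-1 * _]mulrC in D0 => h.
apply: le_trans h _; rewrite [S * e]mulrC.
have S0' : 0 <= S - (`|a ord0 ord0 + b ord0 ord0| / 2) `^ p by [].
apply: lerD; first by rewrite mulrDl mul1r lerDr.
by rewrite ler_wpM2r// ge_min lexx.
Qed.

(** * Spaces with variable exponent *)

Section real_integrals.
Context d {T : measurableType d} {R : realType} (mu : {measure set T -> \bar R}).
Variables (D : set T) (mD : measurable D).
Implicit Types f g : T -> R.

Lemma measurable_normr_fun f : measurable_fun D f -> measurable_fun D (fun x => `|f x|).
Proof. by move=> mf; exact: measurableT_comp. Qed.

Lemma measurable_powR2 f g : measurable_fun D f -> measurable_fun D g ->
  measurable_fun D (fun x => f x `^ g x).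
Proof.
(* Follows the definition of the power: base 0 gives the indicator of exponent 0, any other base an
   exponential. *)
move=> mf mg; apply: measurable_fun_if => //.
- by apply: measurable_fun_eqr.
- apply: (measurable_funS mD); first exact: subIsetl.
  rewrite (_ : (fun x => _) = (fun x => if g x == 0 then 1 else 0)); last first.
    by apply/funext => x; case: (g x == 0).
  apply: measurable_fun_if => //; first by apply: measurable_fun_eqr.
- apply: (measurable_funS mD); first exact: subIsetl.
  apply: (@measurableT_comp _ _ _ _ _ _ (@expR R) _ (fun t => g t * ln (f t))) => //.
  apply: measurable_funM => //.
  exact: measurableT_comp.
Qed.

Lemma le_int f g : measurable_fun D f -> measurable_fun D g ->
  (forall x, D x -> 0 <= f x) -> (forall x, D x -> f x <= g x) ->
  (\int[mu]_(x in D) (f x)%:E <= \int[mu]_(x in D) (g x)%:E)%E.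
Proof.
move=> mf mg f0 fg; apply: ge0_le_integral => //.
- exact/measurable_EFinP.
- exact/measurable_EFinP.
Qed.

Lemma le_int_ae f g : measurable_fun D f -> measurable_fun D g ->
  (forall x, D x -> 0 <= f x) -> (forall x, D x -> 0 <= g x) ->
  {ae mu, forall x, D x -> f x <= g x} ->
  (\int[mu]_(x in D) (f x)%:E <= \int[mu]_(x in D) (g x)%:E)%E.
Proof.
move=> mf mg f0 g0 fg; apply: ae_ge0_le_integral => //.
- exact/measurable_EFinP.
- exact/measurable_EFinP.
Qed.

Lemma intD f g : measurable_fun D f -> measurable_fun D g ->
  (forall x, D x -> 0 <= f x) -> (forall x, D x -> 0 <= g x) ->
  (\int[mu]_(x in D) (f x + g x)%:E =
   \int[mu]_(x in D) (f x)%:E + \int[mu]_(x in D) (g x)%:E)%E.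
Proof.
move=> mf mg f0 g0; under eq_integral do rewrite EFinD.
apply: ge0_integralD => //.
- exact/measurable_EFinP.
- exact/measurable_EFinP.
Qed.

Lemma intZ (k : R) f : 0 <= k -> measurable_fun D f ->
  (forall x, D x -> 0 <= f x) ->
  (\int[mu]_(x in D) (k * f x)%:E = k%:E * \int[mu]_(x in D) (f x)%:E)%E.
Proof.
move=> k0 mf f0; under eq_integral do rewrite EFinM.
by apply: ge0_integralZl_EFin => //; exact/measurable_EFinP.
Qed.

Lemma ge0_integrable f : measurable_fun D f -> (forall x, D x -> 0 <= f x) ->
  (\int[mu]_(x in D) (f x)%:E < +oo)%E -> mu.-integrable D (EFin \o f).
Proof.
move=> mf f0 fi; apply/integrableP; split; first exact/measurable_EFinP.
under eq_integral => x /set_mem Dx do rewrite /= ger0_norm ?f0//.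
exact: fi.
Qed.

Lemma integrable_measurable f : mu.-integrable D (EFin \o f) -> measurable_fun D f.
Proof. by move=> /measurable_int /measurable_EFinP. Qed.

Lemma integrable_norm_lt f : mu.-integrable D (EFin \o f) ->
  (\int[mu]_(x in D) `|f x|%:E < +oo)%E.
Proof. by case/integrableP. Qed.

Lemma le_integrable_real f g : measurable_fun D f -> mu.-integrable D (EFin \o g) ->
  (forall x, D x -> `|f x| <= g x) -> mu.-integrable D (EFin \o f).
Proof.
move=> mf ig fg; apply: le_integrable ig => //; first exact/measurable_EFinP.
by move=> x Dx; rewrite /= lee_fin (le_trans (fg _ Dx))// ler_norm.
Qed.

Lemma integrable_cst_fin (c : R) : (mu D < +oo)%E ->
  mu.-integrable D (EFin \o (fun=> c)).
Proof.
move=> fD; apply/integrableP; split; first exact/measurable_EFinP/measurable_cst.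
by rewrite integral_cst//= lte_mul_pinfty.
Qed.

Lemma integrableD_real f g : mu.-integrable D (EFin \o f) ->
  mu.-integrable D (EFin \o g) -> mu.-integrable D (EFin \o (fun x => f x + g x)).
Proof. by move=> fi gi; have := integrableD mD fi gi. Qed.

Lemma integrableZ_real (k : R) f : mu.-integrable D (EFin \o f) ->
  mu.-integrable D (EFin \o (fun x => k * f x)).
Proof. by move=> fi; have := integrableZl mD k fi. Qed.

Lemma ae_integrable_real f g : {ae mu, forall x, D x -> f x = g x} ->
  measurable_fun D g -> mu.-integrable D (EFin \o f) -> mu.-integrable D (EFin \o g).
Proof.
move=> fg mg fi; apply/integrableP; split; first exact/measurable_EFinP.
apply: le_lt_trans (integrable_norm_lt fi).
apply: le_int_ae => //.
- exact: measurableT_comp.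
- by apply: measurableT_comp => //; exact: integrable_measurable.
- by apply: filterS fg => x h Dx; rewrite h.
Qed.

Lemma ae_eq_int f g : measurable_fun D f -> measurable_fun D g ->
  {ae mu, forall x, D x -> f x = g x} ->
  (\int[mu]_(x in D) (f x)%:E = \int[mu]_(x in D) (g x)%:E)%E.
Proof.
move=> mf mg fg; apply: ae_eq_integral => //.
- exact/measurable_EFinP.
- exact/measurable_EFinP.
- by apply: filterS fg => x h Dx; rewrite h.
Qed.

End real_integrals.

(** * Modulars and Lebesgue spaces with variable exponent *)

Section exponent_spaces.
Context {R : realType} {n : nat}.
Variables (Om : set 'rV[R]_n) (p : 'rV[R]_n -> R).
Hypothesis oOm : open Om.
Hypothesis bOm : bounded_set Om.
Hypothesis mp : measurable_fun Om p.
Hypothesis p1 : forall x, Om x -> 1 < p x.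
Local Notation mu := (@lebesgue_rV R n).
Local Notation fn := ('rV[R]_n -> R).
Implicit Types (f g h : fn) (v w : 'rV[R]_n -> 'rV[R]_n).

Let mOm : measurable Om := open_measurable_rV oOm.

Lemma Om_fin : (mu Om < +oo)%E.
Proof. exact: bounded_lebesgue_fin. Qed.

Let p_gt0 x : Om x -> 0 < p x.
Proof. by move=> /p1; exact: lt_trans. Qed.

Lemma measurable_modular f : measurable_fun Om f ->
  measurable_fun Om (fun x => `|f x| `^ p x / p x).
Proof.
move=> mf; apply: measurable_funM.
  by apply: measurable_powR2 => //; exact: measurable_normr_fun.
apply: (eq_measurable_fun (fun x => p x `^ (-1))).
  by move=> x /set_mem Ox; rewrite powR_inv1// ltW// p_gt0.
exact: measurable_powR2.
Qed.

Lemma measurable_pow f : measurable_fun Om f ->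
  measurable_fun Om (fun x => `|f x| `^ p x).
Proof. by move=> mf; apply: measurable_powR2 => //; exact: measurable_normr_fun. Qed.

Lemma modular_ge0 f x : Om x -> 0 <= `|f x| `^ p x / p x.
Proof. by move=> Ox; rewrite divr_ge0 ?powR_ge0// ltW// p_gt0. Qed.

Lemma le_powRn (x y r : R) : 0 < r -> 0 <= x -> x <= y -> x `^ r <= y `^ r.
Proof.
by move=> r0 x0 xy; apply: ge0_ler_powR; rewrite ?nnegrE// ?(ltW r0)// (le_trans x0).
Qed.

Lemma Lp_le f g : measurable_fun Om g -> {ae mu, forall x, Om x -> `|g x| <= `|f x|} ->
  Lp Om p f -> Lp Om p g.
Proof.
move=> mg gf [mf [lam l0 fin]]; split; [exact: mg|exists lam; first exact: l0].
apply: le_lt_trans fin; apply: le_int_ae => //.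
- by apply: measurable_pow; exact: measurable_funM.
- by apply: measurable_pow; exact: measurable_funM.
apply: filterS gf => x gfx Ox; apply: le_powRn; [exact: p_gt0|by []|].
by rewrite !normrM ler_wpM2l// gfx.
Qed.

Lemma Lp_ae f g : measurable_fun Om g -> {ae mu, forall x, Om x -> f x = g x} ->
  Lp Om p f -> Lp Om p g.
Proof. by move=> mg fg; apply: Lp_le => //; apply: filterS fg => x h Ox; rewrite h. Qed.

Lemma Lp_integrable f : Lp Om p f -> mu.-integrable Om (EFin \o f).
Proof.
move=> [mf [lam l0 fin]].
apply: (@le_integrable_real _ _ _ mu Om mOm _
  (fun x => lam^-1 * (1 + `|lam * f x| `^ p x))) => //.
- apply: integrableZ_real => //; apply: integrableD_real => //.
    exact/integrable_cst_fin/Om_fin.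
  apply: ge0_integrable => //.
  by apply: measurable_pow; exact: measurable_funM.
- move=> x Ox; rewrite -(ler_pM2l l0) mulVKf ?gt_eqF//.
  rewrite -{1}(gtr0_norm l0) -normrM; apply: le_1DpowR => //.
  exact/ltW/p1.
Qed.

Lemma integrable_L1loc f : mu.-integrable Om (EFin \o f) -> L1loc Om f.
Proof.
move=> fi; split; first exact: integrable_measurable fi.
move=> K cK KOm; have mK := compact_measurable_rV cK.
by have /integrableP[] := integrableS mOm mK KOm fi.
Qed.

Lemma LpD f g : Lp Om p f -> Lp Om p g -> Lp Om p (fun x => f x + g x).
Proof.
move=> [mf [l1 l10 f1]] [mg [l2 l20 f2]]; split; first exact: measurable_funD.
(* At this scale the sum is at most the mean of [|l1 * f x|] and [|l2 * g x|], hence at most the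
   larger one, and no factor 2^p appears. *)
pose lam := Num.min l1 l2 / 2.
have m0 : 0 < Num.min l1 l2 by rewrite lt_min l10.
have lam0 : 0 < lam by rewrite divr_gt0.
exists lam; first exact: lam0.
have mf1 : measurable_fun Om (fun x => `|l1 * f x| `^ p x).
  by apply: measurable_pow; exact: measurable_funM.
have mg1 : measurable_fun Om (fun x => `|l2 * g x| `^ p x).
  by apply: measurable_pow; exact: measurable_funM.
apply: (@le_lt_trans _ _
  (\int[mu]_(x in Om) (`|l1 * f x| `^ p x + `|l2 * g x| `^ p x)%:E)%E).
  apply: le_int => //.
  - by apply: measurable_pow; apply: measurable_funM => //; exact: measurable_funD.
  - exact: measurable_funD.
  - move=> x Ox.
    have A0 : 0 <= `|l1 * f x| by [].
    have B0 : 0 <= `|l2 * g x| by [].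
    have h : `|lam * (f x + g x)| <= (`|l1 * f x| + `|l2 * g x|) / 2.
      rewrite /lam !normrM (gtr0_norm l10) (gtr0_norm l20) (gtr0_norm m0).
      rewrite (ger0_norm (_ : 0 <= 2^-1))// mulrAC ler_pM2r ?invr_gt0//.
      apply: (@le_trans _ _ (Num.min l1 l2 * (`|f x| + `|g x|))).
        by rewrite ler_wpM2l ?(ltW m0)// ler_normD.
      by rewrite mulrDr lerD// ler_wpM2r// ge_min lexx ?orbT.
    have [AB|/ltW BA] := lerP `|l1 * f x| `|l2 * g x|.
      rewrite ler_wpDl ?powR_ge0//; apply: le_powRn => //; first exact: p_gt0.
      by lra.
    rewrite ler_wpDr ?powR_ge0//; apply: le_powRn => //; first exact: p_gt0.
    by lra.
by rewrite intD//; exact: lte_add_pinfty.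
Qed.

Lemma LpZ (c : R) f : Lp Om p f -> Lp Om p (fun x => c * f x).
Proof.
move=> [mf [lam l0 fin]]; split; first exact: measurable_funM.
have c1 : 0 < `|c| + 1 by rewrite ltr_wpDl.
exists (lam / (`|c| + 1)); first by rewrite divr_gt0.
apply: le_lt_trans fin; apply: le_int => //.
- by apply: measurable_pow; apply: measurable_funM => //; exact: measurable_funM.
- by apply: measurable_pow; exact: measurable_funM.
move=> x Ox; apply: le_powRn; [exact: p_gt0|by []|].
rewrite !normrM normfV (gtr0_norm l0) (gtr0_norm c1) -!mulrA ler_pM2l//.
by rewrite mulrA ler_piMl// mulrC ler_pdivrMr// mul1r lerDl.
Qed.

Lemma Lp_bounded f (M : R) : measurable_fun Om f ->
  {ae mu, forall x, Om x -> `|f x| <= M} -> Lp Om p f.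
Proof.
move=> mf fM; apply: (@Lp_le (fun=> M)) => //.
  by apply: filterS fM => x h Ox; rewrite (le_trans (h Ox))// ler_norm.
split; first exact: measurable_cst.
(* Brings the constant below 1, where its powers are bounded whatever the exponent. *)
exists (`|M| + 1)^-1; first by rewrite invr_gt0 ltr_wpDl.
apply: (@le_lt_trans _ _ (\int[mu]_(x in Om) (cst 1%E x))%E); last first.
  by rewrite integral_cst// mul1e Om_fin.
apply: (@le_int _ _ _ mu Om mOm _ (fun=> 1)) => //.
- by apply: measurable_pow; exact: measurable_cst.
- move=> x Ox; have := powR_ge_linear; set a := `|_|.
  have a1 : 0 <= a <= 1.
    rewrite /a normr_ge0/= normrM normfV (ger0_norm (_ : 0 <= `|M| + 1)) ?addr_ge0//.
    by rewrite mulrC ler_pdivrMr ?ltr_wpDl// mul1r lerDl.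
  move=> /(_ R (p x) a a1 (ltW (p1 Ox))) /le_trans; apply; by case/andP: a1.
Qed.

Lemma Lp_modular f : measurable_fun Om f ->
  (\int[mu]_(x in Om) (`|f x| `^ p x / p x)%:E < +oo)%E -> Lp Om p f.
Proof.
move=> mf fin; split; [exact: mf|exists 2^-1; first by rewrite invr_gt0].
apply: le_lt_trans fin; apply: le_int => //.
- by apply: measurable_pow; exact: measurable_funM.
- exact: measurable_modular.
- move=> x Ox; rewrite normrM (ger0_norm (_ : 0 <= 2^-1))//.
  by apply: half_powR_le => //; exact/ltW/p1.
Qed.

(* On [{p <= M}] a lower bound [|f|^q > del] forces [|f|^p / p] away from [0],
   while [{p > M}] has small measure. *)
Lemma modular_power_bound (q : R) : 1 <= q -> (forall x, Om x -> q <= p x) ->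
  forall e : R, 0 < e -> exists2 C : R, 0 <= C & forall f, measurable_fun Om f ->
    (\int[mu]_(x in Om) (`|f x| `^ q)%:E <=
      e%:E + C%:E * \int[mu]_(x in Om) (`|f x| `^ p x / p x)%:E)%E.
Proof.
move=> q1 qp e e0; have q0 : 0 < q by lra.
pose A (k : nat) := Om `&` [set x | k%:R < p x].
have mA k : measurable (A k).
  rewrite /A (_ : [set x | _] = p @^-1` `]k%:R, +oo[); first exact: mp.
  by apply/seteqP; split => x /=; rewrite in_itv/= andbT.
have A0 : \bigcap_k A k = set0.
  rewrite -subset0 => x h; have := h (Num.truncn (p x)).+1 Logic.I => -[Ox /=].
  by move=> /(lt_trans (truncnS_gt _)); rewrite ltxx.
have ndA : {homo A : k m / (k <= m)%N >-> (m <= k)%O}.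
  move=> k m km; apply/subsetPset => x [Ox /= h]; split => //=.
  by apply: le_lt_trans h; rewrite ler_nat.
have A0fin : (mu (A 0%N) < +oo)%E.
  apply: (le_lt_trans _ Om_fin).
  by apply: le_measure; [apply: mem_set; exact: mA|exact: mem_set|exact: subIsetl].
have := @nonincreasing_cvg_mu _ _ _ mu A A0fin mA (bigcap_measurable (ex_intro _ 0%N Logic.I)
  (fun k _ => mA k)) ndA.
rewrite A0 measure0 => cvA.
have e20 : 0 < e / 2 by rewrite divr_gt0.
have [M _ hM] : \forall k \near \oo, (mu (A k) < (e / 2)%:E)%E.
  have /fine_cvgP[fA cA] := cvA.
  have /cvgrPdist_lt/(_ _ e20) cA' := cA.
  near=> k; have : mu (A k) \is a fin_num by near: k.
  move=> /fineK <-; rewrite lte_fin.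
  have : `|0 - fine (mu (A k))| < e / 2 by near: k.
  by rewrite sub0r normrN; apply: le_lt_trans; exact: ler_norm.
pose m := M.+1; have {hM}mA2 := hM m (leqnSn M).
pose V := fine (mu Om); have V0 : 0 <= V by exact/fine_ge0/measure_ge0.
(* The set where |f|^q <= del then contributes at most e/2. The cap at 1 gives [tau <= 1], hence
   tau^p >= tau^m wherever p <= m. *)
pose del := Num.min 1 (e / 2 / (V + 1)).
have V1 : 0 < V + 1 by lra.
have del0 : 0 < del by rewrite lt_min ltr01/= divr_gt0.
have del1 : del <= 1 by rewrite ge_min lexx.
pose tau := del `^ q^-1.
have tau0 : 0 < tau by rewrite powR_gt0.
have tau1 : tau <= 1.
  have -> : (1 : R) = 1 `^ q^-1 by rewrite powR1.
  by apply: le_powRn; rewrite ?invr_gt0// ltW.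
(* Where |f| >= tau and p <= m the modular integrand is at least tau^m/m, so [K] times it absorbs
   the summand 1 of [powR_le_modular]; the extra [q] below is the other constant of that bound. *)
pose K := m%:R / tau `^ m%:R.
have K0 : 0 <= K by rewrite divr_ge0// powR_ge0.
exists (K + q); first by rewrite addr_ge0// ltW.
move=> f mf.
pose F x := `|f x| `^ p x / p x.
have mF : measurable_fun Om F by exact: measurable_modular.
have F0 x : Om x -> 0 <= F x by exact: modular_ge0.
have miA : measurable_fun Om (\1_(A m) : fn) by exact: measurable_indic.
have pt x : Om x -> `|f x| `^ q <= del + \1_(A m) x + (K + q) * F x.
  move=> Ox; have [h|h] := lerP (`|f x| `^ q) del.
    by rewrite -addrA ler_wpDr// addr_ge0// mulr_ge0 ?F0// addr_ge0// ltW.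
  have h2 := powR_le_modular q1 (qp _ Ox) (normr_ge0 (f x)).
  rewrite -/(F x) in h2; have KF : 0 <= K * F x by rewrite mulr_ge0// F0.
  have [mpx|pmx] := ltrP m%:R (p x).
    have -> : \1_(A m) x = 1 :> R by rewrite indicE mem_set.
    by rewrite mulrDl; lra.
  suff : 1 <= K * F x.
    have : 0 <= \1_(A m) x :> R by rewrite indicE.
    by rewrite mulrDl; lra.
  have ft : tau <= `|f x|.
    rewrite -[leRHS]powRr1// -(mulfV (lt0r_neq0 q0)) powRrM.
    by apply: le_powRn; rewrite ?invr_gt0// ltW.
  have fp : tau `^ m%:R <= `|f x| `^ p x.
    apply: (@le_trans _ _ (tau `^ p x)); first by apply: ger_powR; rewrite ?tau0.
    by apply: le_powRn; [exact: p_gt0|exact: ltW|].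
  rewrite /K /F mulrACA -invfM mulrC ler_pdivlMl; last first.
    by rewrite mulr_gt0 ?powR_gt0// p_gt0.
  by rewrite mulr1 mulrC ler_pM// ?powR_ge0// ltW// p_gt0.
apply: (@le_trans _ _ (\int[mu]_(x in Om) (del + \1_(A m) x + (K + q) * F x)%:E)%E).
  apply: le_int => //.
  - by apply: measurable_powR2 => //; exact: measurable_normr_fun.
  - by apply: measurable_funD; [apply: measurable_funD|apply: measurable_funM].
have i0 x : 0 <= \1_(A m) x :> R by rewrite indicE.
have Kq : 0 <= K + q by rewrite addr_ge0// ltW.
have mdA : measurable_fun Om (fun x => del + \1_(A m) x) by exact: measurable_funD.
rewrite (@intD _ _ _ mu Om mOm (fun x => del + \1_(A m) x) (fun x => (K + q) * F x))//;
  last 3 first.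
- by apply: measurable_funM.
- by move=> x Ox; rewrite addr_ge0// ltW.
- by move=> x Ox; rewrite mulr_ge0// F0.
rewrite intZ// leeD2r//.
rewrite intD//; last by move=> x _; exact: ltW.
rewrite integral_cst// integral_indic//.
have -> : e%:E = ((e / 2)%:E + (e / 2)%:E)%E by rewrite -EFinD; congr EFin; field.
apply: leeD; last first.
  apply: le_trans (ltW mA2); apply: le_measure; [apply: mem_set|apply: mem_set;
    exact: mA|exact: subIsetl].
  exact: measurableI.
have VE : mu Om = V%:E by rewrite /V fineK// ge0_fin_numE// Om_fin.
rewrite [X in (_ * X <= _)%E](VE : _ = V%:E) -EFinM lee_fin -/V.
apply: (@le_trans _ _ (e / 2 / (V + 1) * V)).
  by rewrite ler_wpM2r// ge_min lexx orbT.
by rewrite mulrAC ler_pdivrMr// ler_pM2l// lerDl.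
Unshelve. all: by end_near. Qed.

End exponent_spaces.

Lemma ecvg0_lt {R : realType} (u : nat -> \bar R) (e : R) :
  u k @[k --> \oo] --> 0%E -> 0 < e -> \forall k \near \oo, (u k < e%:E)%E.
Proof.
move=> /fine_cvgP[fu cu] e0; have /cvgrPdist_lt/(_ _ e0) cu' := cu.
near=> k; have : u k \is a fin_num by near: k.
move=> /fineK <-; rewrite lte_fin.
have : `|0 - fine (u k)| < e by near: k.
by rewrite sub0r normrN; apply: le_lt_trans; exact: ler_norm.
Unshelve. all: by end_near. Qed.

Section almost_everywhere.
Context d {T : measurableType d} {R : realType} (mu : {measure set T -> \bar R}).

Lemma ae_conj (P Q : T -> Prop) : {ae mu, forall x, P x} -> {ae mu, forall x, Q x} ->
  {ae mu, forall x, P x /\ Q x}.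
Proof. by move=> hP hQ; apply: filterS2 hP hQ => x; split. Qed.

Lemma ae_forall_fin (I : finType) (P : I -> T -> Prop) :
  (forall i, {ae mu, forall x, P i x}) -> {ae mu, forall x, forall i, P i x}.
Proof. by move=> h; apply: filter_forall. Qed.

End almost_everywhere.

Section vector_fields.
Context {R : realType} {n : nat}.
Variables (Om : set 'rV[R]_n).
Implicit Types v w : 'rV[R]_n -> 'rV[R]_n.

Lemma measurable_dotv v w : (forall i, measurable_fun Om (fun x => v x ord0 i)) ->
  (forall i, measurable_fun Om (fun x => w x ord0 i)) ->
  measurable_fun Om (fun x => dotv (v x) (w x)).
Proof.
by move=> mv mw; apply: measurable_sum => i; exact: measurable_funM.
Qed.

Lemma measurable_enorm v : measurable Om ->
  (forall i, measurable_fun Om (fun x => v x ord0 i)) ->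
  measurable_fun Om (fun x => enorm (v x)).
Proof.
move=> mOm mv; rewrite (_ : (fun x => _) = (fun x => dotv (v x) (v x) `^ 2^-1)).
  by apply: measurable_powR2 => //; exact: measurable_dotv.
by apply/funext => x; rewrite powR12_sqrt// dotv_ge0.
Qed.

End vector_fields.

(** * Sobolev spaces and the modular closure of the compactly supported functions *)

Section sobolev_spaces.
Context {R : realType} {n : nat}.
Variables (Om : set 'rV[R]_n) (p : 'rV[R]_n -> R).
Hypothesis oOm : open Om.
Hypothesis bOm : bounded_set Om.
Hypothesis mp : measurable_fun Om p.
Hypothesis p1 : forall x, Om x -> 1 < p x.
Local Notation mu := (@lebesgue_rV R n).
Local Notation fn := ('rV[R]_n -> R).
Implicit Types (f g h : fn).

Let mOm : measurable Om := open_measurable_rV oOm.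

Lemma W1p_is_wpartial f i : W1p Om p f -> is_wpartial Om i f (wpartial Om i f).
Proof. by move=> [_ /(_ i)[g fg _]]; exact: wpartialP fg. Qed.

Lemma W1p_measurable f : W1p Om p f -> measurable_fun Om f.
Proof. by move=> [[]]. Qed.

Lemma W1p_wpartial_measurable f i : W1p Om p f -> measurable_fun Om (wpartial Om i f).
Proof. by move=> /(@W1p_is_wpartial f i)[_ []]. Qed.

Lemma W1p_wpartial_Lp f i : W1p Om p f -> Lp Om p (wpartial Om i f).
Proof.
move=> fW; have [_ /(_ i)[g fg gL]] := fW.
apply: (@Lp_ae _ _ Om p oOm mp p1 g) => //; first exact: W1p_wpartial_measurable.
by apply: filterS (wpartial_ae oOm fg) => x h Ox; rewrite h.
Qed.

Lemma W1p_integrable f : W1p Om p f -> mu.-integrable Om (EFin \o f).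
Proof. by move=> [fL _]; exact: Lp_integrable fL. Qed.

Lemma W1p_wpartial_integrable f i : W1p Om p f ->
  mu.-integrable Om (EFin \o wpartial Om i f).
Proof. by move=> /(@W1p_wpartial_Lp f i); exact: Lp_integrable. Qed.

Lemma W1pI f (g : 'I_n -> fn) : Lp Om p f ->
  (forall i, is_wpartial Om i f (g i)) -> (forall i, Lp Om p (g i)) -> W1p Om p f.
Proof.
by move=> fL fg gL; split; [exact: fL|move=> i; exists (g i); [exact: fg|exact: gL]].
Qed.

Lemma W1pD f g : W1p Om p f -> W1p Om p g -> W1p Om p (fun x => f x + g x).
Proof.
move=> fW gW; apply: (@W1pI _ (fun i x => wpartial Om i f x + wpartial Om i g x)).
- by apply: LpD => //; [case: fW|case: gW].
- by move=> i; apply: is_wpartialD => //; exact: W1p_is_wpartial.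
- by move=> i; apply: LpD => //; exact: W1p_wpartial_Lp.
Qed.

Lemma W1pZ (c : R) f : W1p Om p f -> W1p Om p (fun x => c * f x).
Proof.
move=> fW; apply: (@W1pI _ (fun i x => c * wpartial Om i f x)).
- by apply: LpZ => //; case: fW.
- by move=> i; apply: is_wpartialZ => //; exact: W1p_is_wpartial.
- by move=> i; apply: LpZ => //; exact: W1p_wpartial_Lp.
Qed.

Lemma W1pN f : W1p Om p f -> W1p Om p (fun x => - f x).
Proof.
move=> /(W1pZ (- 1)); congr W1p; by apply/funext => x; rewrite mulN1r.
Qed.

Lemma W1pB f g : W1p Om p f -> W1p Om p g -> W1p Om p (fun x => f x - g x).
Proof. by move=> fW gW; apply: W1pD => //; exact: W1pN. Qed.

Lemma wgrad_ae f (g : 'I_n -> fn) : (forall i, is_wpartial Om i f (g i)) ->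
  {ae mu, forall x, Om x -> wgrad Om f x = \row_i g i x}.
Proof.
move=> fg; have := ae_forall_fin (fun i => wpartial_ae oOm (fg i)).
by apply: filterS => x h Ox; apply/rowP => i; rewrite !mxE h.
Qed.

Lemma wgradD f g : W1p Om p f -> W1p Om p g ->
  {ae mu, forall x, Om x -> wgrad Om (fun x => f x + g x) x = wgrad Om f x + wgrad Om g x}.
Proof.
move=> fW gW; have := @wgrad_ae (fun x => f x + g x)
  (fun i x => wpartial Om i f x + wpartial Om i g x)
  (fun i => is_wpartialD oOm (W1p_is_wpartial i fW) (W1p_is_wpartial i gW)).
by apply: filterS => x h Ox; rewrite h//; apply/rowP => i; rewrite !mxE.
Qed.

Lemma wgradZ (c : R) f : W1p Om p f ->
  {ae mu, forall x, Om x -> wgrad Om (fun x => c * f x) x = c *: wgrad Om f x}.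
Proof.
move=> fW; have := @wgrad_ae (fun x => c * f x)
  (fun i x => c * wpartial Om i f x)
  (fun i => is_wpartialZ c oOm (W1p_is_wpartial i fW)).
by apply: filterS => x h Ox; rewrite h//; apply/rowP => i; rewrite !mxE.
Qed.

Lemma wgradN f : W1p Om p f ->
  {ae mu, forall x, Om x -> wgrad Om (fun x => - f x) x = - wgrad Om f x}.
Proof.
move=> fW; have := wgradZ (- 1) fW.
rewrite (_ : (fun x => - 1 * f x) = (fun x => - f x)); last first.
  by apply/funext => x; rewrite mulN1r.
by apply: filterS => x h Ox; rewrite h// scaleN1r.
Qed.

Lemma wgradB f g : W1p Om p f -> W1p Om p g ->
  {ae mu, forall x, Om x -> wgrad Om (fun x => f x - g x) x = wgrad Om f x - wgrad Om g x}.
Proof.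
move=> fW gW; have := ae_conj (wgradD fW (W1pN gW)) (wgradN gW).
by apply: filterS => x [h1 h2] Ox; rewrite h1// h2.
Qed.

Lemma measurable_wgrad f i : W1p Om p f -> measurable_fun Om (fun x => wgrad Om f x ord0 i).
Proof.
by move=> fW; under eq_fun do rewrite mxE; exact: W1p_wpartial_measurable.
Qed.

Lemma measurable_enorm_wgrad f : W1p Om p f ->
  measurable_fun Om (fun x => enorm (wgrad Om f x)).
Proof. by move=> fW; apply: measurable_enorm => // i; exact: measurable_wgrad. Qed.

Lemma le_rho_ae f g : measurable_fun Om f -> measurable_fun Om g ->
  {ae mu, forall x, Om x -> `|f x| <= `|g x|} -> (rho Om p f <= rho Om p g)%E.
Proof.
move=> mf mg fg; apply: le_int_ae => //; [exact: measurable_modular..| | |].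
- by move=> x; exact: modular_ge0.
- by move=> x; exact: modular_ge0.
apply: filterS fg => x h Ox; have p0 : 0 < p x := lt_trans ltr01 (p1 Ox).
by rewrite ler_pM2r ?invr_gt0//; apply: le_powRn => //; exact: h.
Qed.

Lemma rho_ge0 f : (0 <= rho Om p f)%E.
Proof. by apply: integral_ge0 => x Ox; rewrite lee_fin; exact: (modular_ge0 p1). Qed.

Lemma rho1_scale (c : R) h : `|c| <= 1 -> W1p Om p h ->
  (rho1 Om p (fun x => c * h x)%R <= rho1 Om p h)%E.
Proof.
move=> c1 hW; apply: leeD.
- apply: le_rho_ae; [|exact: W1p_measurable|].
    by apply: measurable_funM => //; exact: W1p_measurable.
  by apply/aeW => x Ox; rewrite normrM ler_piMl.
- apply: le_rho_ae; [by apply: measurable_enorm_wgrad; exact: W1pZ|exact: measurable_enorm_wgrad|].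
  apply: filterS (wgradZ c hW) => x h' Ox.
  by rewrite h'// !ger0_norm ?enorm_ge0// enormZ ler_piMl// enorm_ge0.
Qed.

Lemma W1p_closed : rho1_closed Om p (W1p Om p).
Proof. by split. Qed.

Lemma W1p_comp_W1p v : W1p_comp Om p v -> W1p Om p v.
Proof. by case. Qed.

(** The induction principle that replaces approximating sequences: a single passage to sequential
    limits need not produce a closed set. *)
Lemma U1p_0_ind (A : set fn) : rho1_closed Om p A -> W1p_comp Om p `<=` A ->
  U1p_0 Om p `<=` A.
Proof. by move=> cA WA; exact: smallest_sub. Qed.

Lemma W1p_comp_U1p_0 v : W1p_comp Om p v -> U1p_0 Om p v.
Proof. by move=> vW A [_ WA]; exact: WA. Qed.

Lemma U1p_0_W1p v : U1p_0 Om p v -> W1p Om p v.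
Proof. by apply: U1p_0_ind; [exact: W1p_closed|exact: W1p_comp_W1p]. Qed.

Lemma U1p_0_closed (f_ : nat -> fn) f : (forall k, U1p_0 Om p (f_ k)) -> W1p Om p f ->
  rho1 Om p (f_ k \- f)%R @[k --> \oo] --> 0%E -> U1p_0 Om p f.
Proof.
move=> fU fW cv A [cA WA]; apply: (cA.2 f_) => // k.
exact: (fU k A (conj cA WA)).
Qed.

Lemma W1p_compZ (c : R) v : W1p_comp Om p v -> W1p_comp Om p (fun x => c * v x).
Proof.
move=> [vW [K [cK KOm v0]]]; split; first exact: W1pZ.
by exists K; split => //; apply: filterS v0 => x h Ox Kx; rewrite h// mulr0.
Qed.

Lemma W1p_compD u v : W1p_comp Om p u -> W1p_comp Om p v ->
  W1p_comp Om p (fun x => u x + v x).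
Proof.
move=> [uW [K [cK KOm u0]]] [vW [L [cL LOm v0]]]; split; first exact: W1pD.
exists (K `|` L); split.
- exact: compactU.
- by rewrite subUset.
have := ae_conj u0 v0; apply: filterS => x [h1 h2] Ox /not_orP[Kx Lx].
by rewrite h1// h2// addr0.
Qed.

(** Scaling down does not increase the modular, so the functions whose multiple by [c] lies in
    [U1p_0] form a closed set. Larger factors are reached through sums. *)
Lemma U1p_0Z (c : R) v : `|c| <= 1 -> U1p_0 Om p v -> U1p_0 Om p (fun x => c * v x).
Proof.
move=> c1 vU.
suff : U1p_0 Om p `<=` [set f | W1p Om p f /\ U1p_0 Om p (fun x => c * f x)].
  by move=> /(_ v vU)[].
apply: U1p_0_ind; last first.
  move=> w wW; split; first exact: W1p_comp_W1p.
  by apply: W1p_comp_U1p_0; exact: W1p_compZ.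
split; first by move=> f [].
move=> f_ f fA fW cv; split => //.
apply: (@U1p_0_closed (fun k x => c * f_ k x)); [by move=> k; case: (fA k)|exact: W1pZ|].
apply: (squeeze_cvge _ (@cvg_cst _ 0%E _ _ _) cv); apply: nearW => k.
apply/andP; split.
  by apply: adde_ge0; exact: rho_ge0.
rewrite (_ : (_ \- _)%R = (fun x => c * (f_ k \- f)%R x)).
  by apply: rho1_scale => //; apply: W1pB => //; case: (fA k).
by apply/funext => x /=; rewrite mulrBr.
Qed.

(** Adding a fixed [g] to a sequence and its limit leaves their differences unchanged, so the [f]
    with [f + g] in [U1p_0] form a closed set. The induction runs twice: with [g] of compact
    support, then with [g] in [U1p_0]. *)
Lemma U1p_0D u v : U1p_0 Om p u -> U1p_0 Om p v -> U1p_0 Om p (fun x => u x + v x).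
Proof.
have step (g : fn) : W1p Om p g ->
    (forall w, W1p_comp Om p w -> U1p_0 Om p (fun x => w x + g x)) ->
    forall f, U1p_0 Om p f -> U1p_0 Om p (fun x => f x + g x).
  move=> gW gA f fU.
  suff : U1p_0 Om p `<=` [set f | W1p Om p f /\ U1p_0 Om p (fun x => f x + g x)].
    by move=> /(_ f fU)[].
  apply: U1p_0_ind; last by move=> w wW; split; [exact: W1p_comp_W1p|exact: gA].
  split; first by move=> h [].
  move=> f_ h fA hW cv; split => //.
  apply: (@U1p_0_closed (fun k x => f_ k x + g x)); [by move=> k; case: (fA k)|exact: W1pD|].
  have E k : ((fun x => f_ k x + g x) \- (fun x => h x + g x) = f_ k \- h)%R.
    by apply/funext => x /=; ring.
  rewrite (_ : (fun k => rho1 Om p ((fun x => f_ k x + g x) \- (fun x => h x + g x))%R) =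
    (fun k => rho1 Om p (f_ k \- h)%R)); first exact: cv.
  by apply/funext => k; rewrite E.
move=> uU vU; apply: (step v) => //; first exact: U1p_0_W1p.
move=> w wW; rewrite (_ : (fun x => _) = (fun x => v x + w x)).
  apply: (step w) => //; first exact: W1p_comp_W1p.
  by move=> w' wW'; apply: W1p_comp_U1p_0; exact: W1p_compD.
by apply/funext => x; rewrite addrC.
Qed.

Lemma U1p_0N v : U1p_0 Om p v -> U1p_0 Om p (fun x => - v x).
Proof.
move=> vU; have : `|- 1 : R| <= 1 by rewrite normrN1.
move=> /U1p_0Z /(_ vU); congr U1p_0.
by apply/funext => x; rewrite mulN1r.
Qed.

Lemma U1p_0B u v : U1p_0 Om p u -> U1p_0 Om p v -> U1p_0 Om p (fun x => u x - v x).
Proof. by move=> uU vU; apply: U1p_0D => //; exact: U1p_0N. Qed.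

(* The extension of [v] by [0] to R^n has the extensions of [wpartial Om i v]
   as weak derivatives: test functions need not vanish near the boundary. *)
Definition zero_extension (v : fn) : Prop := W1p Om p v /\
  forall i psi, Coo psi ->
    (\int[mu]_(x in Om) (v x * partial i psi x + wpartial Om i v x * psi x)%:E = 0)%E.

Lemma bounded_on_Om f : continuous f -> exists2 M : R, 0 <= M & forall x, Om x -> `|f x| <= M.
Proof.
move=> cf; have [N _ ON] := bounded_cbox bOm.
have [M M0 hM] := continuous_bounded_compact cf
  (@compact_cbox R n (\row__ - N) (\row__ N)).
by exists M => // x /ON; exact: hM.
Qed.

Lemma integrable_mul_bounded f g (M : R) : mu.-integrable Om (EFin \o f) ->
  measurable_fun Om g -> (forall x, Om x -> `|g x| <= M) ->
  mu.-integrable Om (EFin \o (fun x => f x * g x)).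
Proof.
move=> fi mg gM.
apply: (@le_integrable_real _ _ _ mu Om mOm _ (fun x => M * `|f x|)).
- by apply: measurable_funM => //; exact: integrable_measurable fi.
- by apply: integrableZ_real => //; exact: integrable_norm.
- by move=> x Ox; rewrite normrM mulrC ler_wpM2r// gM.
Qed.

(** The pairing with [psi] and its derivative is linear and bounded by the L^1 norms of the function
    and its gradient; [modular_power_bound] with exponent 1 makes these small together with the
    modular. *)
Lemma zero_extension_closed : (0 < n)%N -> rho1_closed Om p [set v | zero_extension v].
Proof.
move=> n0; split; first by move=> v [].
move=> f_ f fB fW cv; split => // i psi Cpsi.
pose L (v : fn) x := v x * partial i psi x + wpartial Om i v x * psi x.
have cpsi := Coo_continuous Cpsi.
have cdpsi := Coo_continuous (Coo_partial i Cpsi).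
have [M1 M10 hM1] := bounded_on_Om cpsi.
have [M2 M20 hM2] := bounded_on_Om cdpsi.
have mpsi := continuous_measurable oOm cpsi.
have mdpsi := continuous_measurable oOm cdpsi.
have Li v : W1p Om p v -> mu.-integrable Om (EFin \o L v).
  move=> vW; apply: integrableD_real => //.
    apply: (@integrable_mul_bounded _ _ M2) => //; exact: W1p_integrable.
  apply: (@integrable_mul_bounded _ _ M1) => //; exact: W1p_wpartial_integrable.
pose h k := (f_ k \- f)%R.
have fkW k : W1p Om p (f_ k) by case: (fB k).
have hW k : W1p Om p (h k) by exact: W1pB.
have E k : (\int[mu]_(x in Om) (L f x)%:E = - \int[mu]_(x in Om) (L (h k) x)%:E)%E.
  have e1 : (\int[mu]_(x in Om) (L (f_ k) x)%:E = 0)%E by have [_] := fB k; exact.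
  have e2 : (\int[mu]_(x in Om) (L (f_ k) x)%:E =
      \int[mu]_(x in Om) (L f x + L (h k) x)%:E)%E.
    apply: ae_eq_int => //; [exact: integrable_measurable (Li _ (fkW k))|
      apply: measurable_funD; exact: integrable_measurable (Li _ _)|].
    apply: filterS (wgradB (fkW k) fW) => x hx Ox; have /rowP/(_ i) := hx Ox.
    by rewrite !mxE /L => ->; rewrite /h/=; ring.
  move: e2; rewrite e1; under [in X in _ = X -> _]eq_integral do rewrite EFinD.
  rewrite integralD_EFin//; [|exact: Li..].
  have /fineK <- := integrable_fin_num mOm (Li _ fW).
  have /fineK <- := integrable_fin_num mOm (Li _ (hW k)).
  rewrite -EFinD => -[] h0; rewrite -EFinN; congr EFin.
  by apply/eqP; rewrite -addr_eq0 -h0.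
pose M := M1 + M2.
have M0 : 0 <= M by exact: addr_ge0.
have Lb k x : Om x -> `|L (h k) x| <= M * (`|h k x| `^ 1 + `|enorm (wgrad Om (h k) x)| `^ 1).
  move=> Ox; rewrite !powRr1// mulrDr (le_trans (ler_normD _ _))// !normrM.
  rewrite lerD// mulrC; apply: ler_pM => //.
  - by rewrite (le_trans (hM2 _ Ox))// /M lerDr.
  - by rewrite (le_trans (hM1 _ Ox))// /M lerDl.
  - rewrite (ger0_norm (enorm_ge0 _)); have := enorm_coord (wgrad Om (h k) x) i.
    by rewrite mxE.
apply/eqP; rewrite -abse_eq0 eq_le abse_ge0 andbT.
apply/lee_addgt0Pr => e e0; rewrite add0e.
(* Three equal shares: one for each of the two uses of [modular_power_bound] and one for the modular
   term. The factor [M + 1] compensates the bound on [psi] and its derivative. *)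
pose e' := e / (3 * (M + 1)).
have M1' : 0 < M + 1 by rewrite ltr_wpDl.
have e'0 : 0 < e' by rewrite divr_gt0// mulr_gt0.
have q1 : forall x, Om x -> 1 <= p x by move=> x /p1/ltW.
have [C C0 hC] := modular_power_bound oOm bOm mp p1 (lexx 1) q1 e'0.
have d0 : 0 < e' / (C + 1) by rewrite divr_gt0// ltr_wpDl.
have [k _ hk] := ecvg0_lt cv d0.
have {hk} := hk k (leqnn k); rewrite -/(h k) => hk.
rewrite (E k) abseN.
have mh := W1p_measurable (hW k).
have mg := measurable_enorm_wgrad (hW k).
have mp1 g : measurable_fun Om g -> measurable_fun Om (fun x => `|g x| `^ 1).
  by move=> mg'; apply: measurable_powR2 => //; exact: measurable_normr_fun.
apply: (@le_trans _ _ (\int[mu]_(x in Om) `|L (h k) x|%:E)%E).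
  apply: le_abse_integral => //.
  by apply/measurable_EFinP; exact: integrable_measurable (Li _ (hW k)).
apply: (@le_trans _ _ (\int[mu]_(x in Om)
    (M * (`|h k x| `^ 1 + `|enorm (wgrad Om (h k) x)| `^ 1))%:E)%E).
  apply: le_int => //.
  - apply: measurable_normr_fun; exact: integrable_measurable (Li _ (hW k)).
  - by apply: measurable_funM => //; apply: measurable_funD; exact: mp1.
  - by move=> x; exact: Lb.
rewrite intZ//; last by apply: measurable_funD; exact: mp1.
rewrite intD//; [|exact: mp1..].
have -> : e%:E = ((M + 1) * (3 * e'))%:E.
  by congr EFin; rewrite /e'; field; rewrite gt_eqF.
rewrite EFinM; apply: lee_pmul => //.
- by apply: adde_ge0; apply: integral_ge0 => x _; rewrite lee_fin powR_ge0.
- by rewrite lee_fin lerDl.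
apply: (le_trans (leeD (hC _ mh) (hC _ mg))).
rewrite addeACA -muleDr//; last first.
  by rewrite ge0_adde_def// inE rho_ge0.
have : ((C%:E * rho1 Om p (h k))%E <= e'%:E)%E.
  apply: (@le_trans _ _ (C%:E * (e' / (C + 1))%:E)%E).
    by rewrite lee_wpmul2l ?lee_fin// ltW.
  rewrite -EFinM lee_fin mulrCA ler_piMr// ?(ltW e'0)//.
  by rewrite ler_pdivrMr ?ltr_wpDl// mul1r lerDl.
move=> h2; have := leeD (lexx (e'%:E + e'%:E)%E) h2.
move=> /le_trans; apply; rewrite -!EFinD lee_fin; lra.
Qed.

(** Weak derivatives are local: test functions on the open set [Om] minus [K] do not see [v], so the
    fundamental lemma applies there. *)
Lemma W1p_comp_wpartial_ae0 v K i : W1p Om p v -> compact K -> K `<=` Om ->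
  {ae mu, forall x, Om x -> ~ K x -> v x = 0} ->
  {ae mu, forall x, Om x -> ~ K x -> wpartial Om i v x = 0}.
Proof.
move=> vW cK KOm v0; pose O' := Om `&` ~` K.
have cloK : closed K by apply: compact_closed cK; exact: norm_hausdorff.
have oO' : open O' by apply: openI => //; exact: closed_openC.
have [vL gL H] := W1p_is_wpartial i vW.
suff : {ae mu, forall x, O' x -> wpartial Om i v x = 0}.
  by apply: filterS => x h Ox Kx; exact: h.
have OO : O' `<=` Om by exact: subIsetl.
have mO' := open_measurable_rV oO'.
apply: fundamental_lemma => //.
  have [mg gK] := gL; split; first exact: measurable_funS mg.
  by move=> L cL LO; apply: gK => //; exact: subset_trans OO.
move=> psi [Cpsi [L [cL LO psi0]]].
have tpsi : test_function Om psi.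
  by split => //; exists L; split => //; exact: subset_trans OO.
have psiK x : K x -> psi x = 0 by move=> Kx; apply: psi0 => /LO[_]; exact.
rewrite (@integral_indic_mul R n Om O' (fun x => wpartial Om i v x * psi x) OO).
under eq_integral.
  move=> x /set_mem Ox; rewrite (_ : _ * \1_O' x = wpartial Om i v x * psi x); last first.
    rewrite indicE; have [/set_mem Kx|/negP Kx] := boolP (x \in K).
      by rewrite psiK// mulr0 mul0r.
    by rewrite mem_set ?mulr1//; split => //; move=> Kx'; apply: Kx; exact: mem_set.
  over.
have : (\int[mu]_(x in Om) (v x * partial i psi x)%:E = 0)%E.
  have -> : (0 = \int[mu]_(x in Om) (0 : R)%:E)%E by rewrite integral0.
  apply: ae_eq_int => //.
    apply: measurable_funM; first exact: W1p_measurable.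
    by apply: continuous_measurable => //; apply: Coo_continuous; exact: Coo_partial.
  apply: filterS v0 => x hx Ox; have [Kx|Kx] := pselect (K x); last by rewrite hx// mul0r.
  rewrite (partial_eq0 Om i cL psi0) ?mulr0// => /LO[_]; exact.
by rewrite (H psi tpsi) => /eqP; rewrite oppe_eq0 => /eqP.
Qed.

(** Replacing [psi] by its product with a cutoff gives an admissible test function. The cutoff is 1
    in a neighbourhood of [K], so the derivatives agree on [K] as well. *)
Lemma W1p_comp_zero_extension v : W1p_comp Om p v -> zero_extension v.
Proof.
move=> [vW [K [cK KOm v0]]]; split => // i psi Cpsi.
have g0 := W1p_comp_wpartial_ae0 i vW cK KOm v0.
have [vL gL H] := W1p_is_wpartial i vW.
have [eta [U [teta oU KU eta1]]] := cutoff_exists oOm cK KOm.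
have tp := test_functionM teta Cpsi.
have := H _ tp.
set phi := (fun x => eta x * psi x) in tp *.
have tdp := test_function_partial i tp.
have i1 := test_mul_integrable oOm vL tdp.
have i2 := test_mul_integrable oOm gL tp.
move=> H'; have : (\int[mu]_(x in Om) (v x * partial i phi x + wpartial Om i v x * phi x)%:E = 0)%E.
  under eq_integral do rewrite EFinD.
  rewrite integralD_EFin// H' addeC; apply: subee.
  exact: integrable_fin_num.
move=> <-; apply: ae_eq_int => //.
- apply: measurable_funD; apply: measurable_funM.
  + exact: W1p_measurable.
  + by apply: continuous_measurable => //; apply: Coo_continuous; exact: Coo_partial.
  + exact: W1p_wpartial_measurable.
  + by apply: continuous_measurable => //; exact: Coo_continuous.
- by apply: measurable_funD; [exact: integrable_measurable i1|exact: integrable_measurable i2].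
have := ae_conj v0 g0; apply: filterS => x [h1 h2] Ox.
have [Kx|Kx] := pselect (K x); last by rewrite h1// h2// !mul0r.
have near1 : \forall y \near x, psi y = phi y.
  apply: filterS (open_nbhs_nbhs (conj oU (KU _ Kx))) => y Uy.
  by rewrite /phi eta1// mul1r.
by rewrite (partial_near_eq i near1) (nbhs_singleton near1).
Qed.

Lemma U1p_0_zero_extension v : (0 < n)%N -> U1p_0 Om p v -> zero_extension v.
Proof.
by move=> n0; apply: U1p_0_ind; [exact: zero_extension_closed|exact: W1p_comp_zero_extension].
Qed.

End sobolev_spaces.

(** * Morrey's estimate *)

Section interval_profiles.
Context {R : realType}.
Implicit Types (a b c t : R).

(** The indicator of the closed interval, written as the difference of the two step functions that
    arise as limits in [cvg_sigmoid_ge] and [cvg_sigmoid_gt]. *)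
Definition itv_ind a b t : R := (0 <= t - a)%R%:R - (0 < t - b)%R%:R.

Definition itv_avg a b t : R := (b - a)^-1 * itv_ind a b t.

(** The primitive of [itv_avg] that is 0 to the left of [a]; it is 1 to the right of [b]. *)
Definition ramp a b t : R := (b - a)^-1 * (Num.max 0 (t - a) - Num.max 0 (t - b)).

Lemma itv_ind01 a b t : a <= b -> 0 <= itv_ind a b t <= 1.
Proof.
move=> ab; rewrite /itv_ind (subr_ge0 a t) (subr_gt0 b t).
by case: (lerP a t) => h1; case: (ltrP b t) => h2; rewrite ?subrr ?subr0 ?sub0r ?lexx ?ler01//; lra.
Qed.

Lemma itv_indE a b t : a <= b -> itv_ind a b t = (a <= t <= b)%R%:R.
Proof.
move=> ab; rewrite /itv_ind subr_ge0 subr_gt0.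
by case: lerP => h1; case: ltrP => h2; rewrite ?subrr ?subr0//=; lra.
Qed.

Lemma itv_avg_bound a b t : a < b -> 0 <= itv_avg a b t <= (b - a)^-1.
Proof.
move=> ab; have /andP[h0 h1] := itv_ind01 t (ltW ab).
have i0 : 0 < (b - a)^-1 by rewrite invr_gt0 subr_gt0.
by rewrite mulr_ge0 ?(ltW i0)//= ler_piMr// ltW.
Qed.

Lemma itv_avg_out a b t : a <= b -> ~~ (a <= t <= b) -> itv_avg a b t = 0.
Proof. by move=> ab h; rewrite /itv_avg itv_indE// (negbTE h) mulr0. Qed.

Lemma ramp01 a b t : a < b -> 0 <= ramp a b t <= 1.
Proof.
move=> ab; have i0 : 0 < b - a by rewrite subr_gt0.
rewrite /ramp; set y := Num.max 0 (t - a) - Num.max 0 (t - b).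
have /andP[y0 y1] : 0 <= y <= b - a.
  rewrite /y; case: (lerP 0 (t - a)) => h1; case: (lerP 0 (t - b)) => h2;
  apply/andP; split; lra.
rewrite mulr_ge0 ?invr_ge0 ?(ltW i0)//=.
by rewrite mulrC ler_pdivrMr// mul1r.
Qed.

Lemma ramp_left a b t : a < b -> t <= a -> ramp a b t = 0.
Proof.
move=> ab ta; rewrite /ramp (max_idPl _) ?subr_le0// (max_idPl _) ?subr_le0.
  by rewrite subrr mulr0.
by rewrite (le_trans ta)// ltW.
Qed.

Lemma ramp_right a b t : a < b -> b <= t -> ramp a b t = 1.
Proof.
move=> ab bt; rewrite /ramp (max_idPr _) ?subr_ge0; last by rewrite (le_trans _ bt)// ltW.
rewrite (max_idPr _) ?subr_ge0//.
have -> : t - a - (t - b) = b - a by ring.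
by rewrite mulVf// gt_eqF// subr_gt0.
Qed.

(* Smooth approximations of [itv_avg] and [ramp]; without the shifts by [k.+1]
   the first one would tend to half its value at the end points. *)
Definition smooth_avg (k : nat) a b t : R := (b - a)^-1 *
  (sigmoid (k.+1%:R ^+ 2 * (t - a) + k.+1%:R) - sigmoid (k.+1%:R ^+ 2 * (t - b) - k.+1%:R)).

Definition smooth_ramp (k : nat) a b t : R := (b - a)^-1 *
  (softplus (k.+1%:R ^+ 2 * (t - a) + 1 * k.+1%:R) / k.+1%:R ^+ 2 -
   softplus (k.+1%:R ^+ 2 * (t - b) + -1 * k.+1%:R) / k.+1%:R ^+ 2).

Lemma smooth_avg_cvg a b t : smooth_avg k a b t @[k --> \oo] --> itv_avg a b t.
Proof.
apply: cvgM; first exact: cvg_cst.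
by apply: cvgB; [exact: cvg_sigmoid_ge|exact: cvg_sigmoid_gt].
Qed.

Lemma smooth_ramp_cvg a b t : smooth_ramp k a b t @[k --> \oo] --> ramp a b t.
Proof.
apply: cvgM; first exact: cvg_cst.
by apply: cvgB; apply: cvg_softplus; rewrite ?normrN normr1.
Qed.

Lemma smooth_avg_bound k a b t : a < b -> `|smooth_avg k a b t| <= (b - a)^-1.
Proof.
move=> ab; have i0 : 0 < (b - a)^-1 by rewrite invr_gt0 subr_gt0.
rewrite normrM (gtr0_norm i0) ler_piMr ?(ltW i0)// ler_norml.
set x : R := _ * (t - a) + _; set y : R := _ * (t - b) + _.
have := sigmoid_ge0 x; have := sigmoid_le1 x.
by have := sigmoid_ge0 y; have := sigmoid_le1 y; move=> *; apply/andP; split; lra.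
Qed.

Lemma softplus_scaled (k : nat) (e s : R) : `|e| <= 1 ->
  `|softplus (k.+1%:R ^+ 2 * s + e * k.+1%:R) / k.+1%:R ^+ 2| <= `|s| + 2.
Proof.
move=> e1; set K : R := k.+1%:R.
have K1 : 1 <= K by rewrite ler1n.
have KK : 0 < K ^+ 2 by rewrite exprn_gt0// ltr0n.
rewrite normrM normfV (gtr0_norm KK) ler_pdivrMr//.
have /andP[h1 h2] := softplus_bound (K ^+ 2 * s + e * K).
have h0 : 0 <= softplus (K ^+ 2 * s + e * K) by apply: le_trans h1; rewrite le_max lexx.
rewrite ger0_norm//; apply: (le_trans h2).
have h3 : K <= K ^+ 2 by rewrite expr2 ler_peMl// (le_trans _ K1).
have h4 : 1 <= K ^+ 2 by exact: le_trans h3.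
have h5 : `|K ^+ 2 * s + e * K| <= K ^+ 2 * `|s| + K.
  rewrite (le_trans (ler_normD _ _))// normrM (gtr0_norm KK) lerD2l normrM.
  by rewrite (ger0_norm (le_trans ler01 K1)) ler_piMl// (le_trans _ K1).
have h6 : Num.max 0 (K ^+ 2 * s + e * K) <= K ^+ 2 * `|s| + K.
  rewrite ge_max (le_trans (ler_norm _) h5) andbT.
  by rewrite addr_ge0 ?(le_trans _ K1)// mulr_ge0// ltW.
have -> : (`|s| + 2) * K ^+ 2 = K ^+ 2 * `|s| + K ^+ 2 + K ^+ 2 by ring.
by lra.
Qed.

Lemma smooth_ramp_bound k a b t : a < b ->
  `|smooth_ramp k a b t| <= (b - a)^-1 * (`|t - a| + `|t - b| + 4).
Proof.
move=> ab; have i0 : 0 < (b - a)^-1 by rewrite invr_gt0 subr_gt0.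
rewrite normrM (gtr0_norm i0) ler_pM2l// (le_trans (ler_normB _ _))//.
have e1 : `|1 : R| <= 1 by rewrite normr1.
have e2 : `|-1 : R| <= 1 by rewrite normrN1.
have := softplus_scaled k (t - a) e1; have := softplus_scaled k (t - b) e2.
by lra.
Qed.

Lemma is_derive_scaled_softplus (k : nat) (e a t : R) :
  is_derive t 1 (fun t => softplus (k.+1%:R ^+ 2 * (t - a) + e * k.+1%:R) / k.+1%:R ^+ 2)
    (sigmoid (k.+1%:R ^+ 2 * (t - a) + e * k.+1%:R)).
Proof.
set K : R := k.+1%:R; have K0 : K != 0 by rewrite pnatr_eq0.
have d1 : is_derive t (1 : R) (fun t : R => K ^+ 2 * (t - a) + e * K) (K ^+ 2).
  have h := is_deriveD (is_deriveM_real (is_derive_cst (K ^+ 2) t (1 : R))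
    (is_deriveB (is_derive_id t (1 : R)) (is_derive_cst a t (1 : R))))
    (is_derive_cst (e * K) t (1 : R)).
  by apply: (is_derive_eq h); rewrite /=; ring.
have d2 := is_derive_comp_real (is_derive_softplus _) d1.
have d3 := is_deriveM_real d2 (is_derive_cst (K ^- 2) t (1 : R)).
by apply: (is_derive_eq d3); rewrite mulr0 addr0 mulfK// expf_neq0.
Qed.

Lemma is_derive_smooth_ramp k a b t : is_derive t 1 (smooth_ramp k a b) (smooth_avg k a b t).
Proof.
have h := is_deriveM_real (is_derive_cst ((b - a)^-1) t (1 : R))
  (is_deriveB (is_derive_scaled_softplus k 1 a t) (is_derive_scaled_softplus k (-1) b t)).
by apply: (is_derive_eq h); rewrite mul0r add0r /smooth_avg mul1r mulN1r.
Qed.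

End interval_profiles.

Section box_profiles.
Context {R : realType} {n : nat}.
Implicit Types (a b : 'I_n -> R) (y : 'rV[R]_n).
Local Notation mu := (@lebesgue_rV R n).

Lemma is_derive_coord i j y :
  is_derive y (delta_mx ord0 i) (fun y : 'rV[R]_n => y ord0 j) (j == i)%:R.
Proof.
apply/is_derive_line.
have -> : (fun h : R => (h *: delta_mx ord0 i + y) ord0 j) =
    (fun h : R => h * (j == i)%:R) \+ cst (y ord0 j).
  by apply/funext => h; rewrite !mxE eqxx.
rewrite -[X in is_derive _ _ _ X]addr0; apply: is_deriveD.
have := is_deriveM_real (is_derive_id (0 : R) 1)
  (is_derive_cst ((j == i)%:R : R) (0 : R) 1).
by rewrite mul1r mulr0 addr0.
Qed.

Lemma Coo_smooth_avg k (c d : R) j : Coo (fun y : 'rV[R]_n => smooth_avg k c d (y ord0 j)).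
Proof.
move=> l; apply: CkM; first exact: Ck_cst.
have aff (u w : R) : Ck l (fun y : 'rV[R]_n => k.+1%:R ^+ 2 * (y ord0 j - u) + w).
  apply: CkD; last exact: Ck_cst.
  by apply: CkM; [exact: Ck_cst|apply: CkD; [exact: Ck_coord|exact: Ck_cst]].
by apply: CkD; [|apply: CkN]; apply: Ck_sigmoid; exact: aff.
Qed.

Lemma Coo_smooth_ramp k (c d : R) j : Coo (fun y : 'rV[R]_n => smooth_ramp k c d (y ord0 j)).
Proof.
move=> l; apply: CkM; first exact: Ck_cst.
have aff (u w : R) : Ck l (fun y : 'rV[R]_n => k.+1%:R ^+ 2 * (y ord0 j - u) + w).
  apply: CkD; last exact: Ck_cst.
  by apply: CkM; [exact: Ck_cst|apply: CkD; [exact: Ck_coord|exact: Ck_cst]].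
by apply: CkD; [|apply: CkN]; apply: CkM; try exact: Ck_cst; apply: Ck_softplus; exact: aff.
Qed.

(** Independent of coordinate [i], so multiplying it by a ramp in that coordinate gives a primitive
    of [box_avg] in direction [i]. *)
Definition slab_avg i a b y := \prod_(j | j != i) itv_avg (a j) (b j) (y ord0 j).

Definition box_avg a b y := \prod_j itv_avg (a j) (b j) (y ord0 j).

Lemma box_avgE i a b y : box_avg a b y = itv_avg (a i) (b i) (y ord0 i) * slab_avg i a b y.
Proof. by rewrite /box_avg (bigD1 i). Qed.

Lemma itv_avg_ge0 (c d t : R) : c < d -> 0 <= itv_avg c d t.
Proof. by move=> /(itv_avg_bound t)/andP[]. Qed.

Lemma slab_avg_ge0 i a b y : (forall j, a j < b j) -> 0 <= slab_avg i a b y.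
Proof. by move=> ab; apply: prodr_ge0 => j _; exact: itv_avg_ge0. Qed.

Lemma measurable_itv_ind d (T : measurableType d) (D : set T) (f g h : T -> R) :
  measurable D -> measurable_fun D f -> measurable_fun D g -> measurable_fun D h ->
  measurable_fun D (fun x => itv_ind (f x) (g x) (h x)).
Proof.
move=> mD mf mg mh.
have E (b : T -> bool) : measurable_fun D b -> measurable_fun D (fun x => (b x)%:R : R).
  move=> mb; rewrite (_ : (fun x => _) = (fun x => if b x then 1 else 0)); last first.
    by apply/funext => x; case: (b x).
  apply: measurable_fun_if => //; exact: measurable_cst.
apply: measurable_funB; apply: E.
  by apply: measurable_fun_ler => //; exact: measurable_funB.
by apply: measurable_fun_ltr => //; exact: measurable_funB.
Qed.

Lemma measurable_coord (D : set 'rV[R]_n) j : measurable_fun D (fun y : 'rV[R]_n => y ord0 j).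
Proof. exact: measurable_funS (measurable_rV_coord j). Qed.

Lemma measurable_slab_avg (D : set 'rV[R]_n) i a b : measurable D ->
  measurable_fun D (slab_avg i a b).
Proof.
move=> mD; rewrite (_ : slab_avg i a b = fun y =>
    \prod_(j < n) (if j != i then itv_avg (a j) (b j) (y ord0 j) else 1)); last first.
  by apply/funext => y; rewrite /slab_avg big_mkcond.
apply: (@measurable_prod _ _ _ _ _ _
  (fun (j : 'I_n) y => if j != i then itv_avg (a j) (b j) (y ord0 j) else 1)) => j _.
case: (j != i); last exact: measurable_cst.
apply: measurable_funM; first exact: measurable_cst.
apply: measurable_itv_ind; [exact: mD|exact: measurable_cst|exact: measurable_cst|].
exact: measurable_coord.
Qed.

Lemma measurable_box_avg (D : set 'rV[R]_n) a b : measurable D ->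
  measurable_fun D (box_avg a b).
Proof.
move=> mD; apply: (@measurable_prod _ _ _ _ _ _
  (fun (j : 'I_n) (y : 'rV[R]_n) => itv_avg (a j) (b j) (y ord0 j))) => j _.
apply: measurable_funM; first exact: measurable_cst.
apply: measurable_itv_ind; [exact: mD|exact: measurable_cst|exact: measurable_cst|].
exact: measurable_coord.
Qed.

End box_profiles.

(** * Box averages and their change when the box is deformed *)

Section box_average.
Context {R : realType} {n : nat}.
Variables (Om : set 'rV[R]_n) (p : 'rV[R]_n -> R).
Hypothesis oOm : open Om.
Hypothesis bOm : bounded_set Om.
Hypothesis mp : measurable_fun Om p.
Hypothesis p1 : forall x, Om x -> 1 < p x.
Local Notation mu := (@lebesgue_rV R n).
Local Notation fn := ('rV[R]_n -> R).

Let mOm : measurable Om := open_measurable_rV oOm.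

Definition smooth_slab k i (a b : 'I_n -> R) (y : 'rV[R]_n) :=
  \prod_(j | j != i) smooth_avg k (a j) (b j) (y ord0 j).

Lemma Coo_smooth_slab k i a b : Coo (smooth_slab k i a b).
Proof.
move=> l; apply: (@Ck_prod R n l _ _ _
  (fun (j : 'I_n) (y : 'rV[R]_n) => smooth_avg k (a j) (b j) (y ord0 j))) => j.
exact: Coo_smooth_avg.
Qed.

Lemma smooth_slab_cvg i a b y : smooth_slab k i a b y @[k --> \oo] --> slab_avg i a b y.
Proof. by apply: cvg_bigprod => j; exact: smooth_avg_cvg. Qed.

Definition slab_height i (a b : 'I_n -> R) := \prod_(j | j != i) (b j - a j)^-1.

Lemma smooth_slab_bound k i a b y : (forall j, a j < b j) ->
  `|smooth_slab k i a b y| <= slab_height i a b.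
Proof.
move=> ab; rewrite normr_prod; apply: ler_prod => j _.
by rewrite normr_ge0 smooth_avg_bound.
Qed.

Lemma slab_avg_bound i a b y : (forall j, a j < b j) ->
  0 <= slab_avg i a b y <= slab_height i a b.
Proof.
move=> ab; rewrite slab_avg_ge0//=; apply: ler_prod => j _; exact: itv_avg_bound.
Qed.

Lemma box_avg_bound (a b : 'I_n -> R) y : (forall j, a j < b j) ->
  0 <= box_avg a b y <= \prod_j (b j - a j)^-1.
Proof.
move=> ab; apply/andP; split; first by apply: prodr_ge0 => j _; exact: itv_avg_ge0.
by apply: ler_prod => j _; exact: itv_avg_bound.
Qed.

Lemma partial_smooth_ramp_slab k c d i a b (y : 'rV[R]_n) :
  partial i (fun y => smooth_ramp k c d (y ord0 i) * smooth_slab k i a b y) y =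
  smooth_avg k c d (y ord0 i) * smooth_slab k i a b y.
Proof.
have d1 := is_derive_comp_real (is_derive_smooth_ramp k c d _) (is_derive_coord i i y).
have d2 : is_derive y (delta_mx ord0 i) (smooth_slab k i a b) 0.
  apply: is_derive_invariant => h; apply: eq_bigr => j ji.
  by rewrite !mxE eqxx (negbTE ji) mulr0 add0r.
rewrite /partial; have [_ ->] := is_deriveM_real d1 d2.
by rewrite eqxx mulr1 mulr0 addr0.
Qed.

Let coord_bound : exists2 N : R, 0 <= N & forall y j, Om y -> `|y ord0 j| <= N.
Proof.
have [N N0 hN] := bounded_cbox bOm; exists N; first exact: ltW.
by move=> y j /hN/(_ j); rewrite in_itv/= !mxE ler_norml.
Qed.

(** The limit of the identity of [zero_extension] for smooth ramps times smooth slabs. A ramp stays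
    equal to 1 beyond the box, so these functions need not vanish near the boundary of [Om]: this is
    where the extension by 0 is used. *)
Lemma box_identity v i a b c d : zero_extension Om p v -> (forall j, a j < b j) -> c < d ->
  (\int[mu]_(y in Om) (v y * (itv_avg c d (y ord0 i) * slab_avg i a b y) +
    wpartial Om i v y * (ramp c d (y ord0 i) * slab_avg i a b y))%:E = 0)%E.
Proof.
move=> [Wv hv] ab cd; have [N N0 hN] := coord_bound.
pose psi k (y : 'rV[R]_n) := smooth_ramp k c d (y ord0 i) * smooth_slab k i a b y.
have Cpsi k : Coo (psi k).
  by apply: CooM; [exact: Coo_smooth_ramp|exact: Coo_smooth_slab].
have vi : mu.-integrable Om (EFin \o v) by exact: W1p_integrable Wv.
have gi : mu.-integrable Om (EFin \o wpartial Om i v) by exact: W1p_wpartial_integrable Wv.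
have dc0 : 0 <= (d - c)^-1 by rewrite invr_ge0 subr_ge0 ltW.
have H0 : 0 <= slab_height i a b.
  by apply: prodr_ge0 => j _; rewrite invr_ge0 subr_ge0 ltW.
pose A1 := (d - c)^-1 * slab_height i a b.
pose A2 := (d - c)^-1 * (N + `|c| + (N + `|d|) + 4) * slab_height i a b.
pose F k y := v y * partial i (psi k) y + wpartial Om i v y * psi k y.
have [_ cv] : mu.-integrable Om (EFin \o (fun y =>
    v y * (itv_avg c d (y ord0 i) * slab_avg i a b y) +
    wpartial Om i v y * (ramp c d (y ord0 i) * slab_avg i a b y))) /\
  (\int[mu]_(y in Om) (F k y)%:E)%E @[k --> \oo] -->
  (\int[mu]_(y in Om) (v y * (itv_avg c d (y ord0 i) * slab_avg i a b y) +
    wpartial Om i v y * (ramp c d (y ord0 i) * slab_avg i a b y))%:E)%E.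
  apply: (@dominated_cvg_real _ _ _ mu Om F _ (fun y => A1 * `|v y| + A2 * `|wpartial Om i v y|)).
  - exact: mOm.
  - move=> k; apply: measurable_funD; apply: measurable_funM.
    + exact: integrable_measurable vi.
    + apply: continuous_measurable => //; apply: Coo_continuous; exact: Coo_partial.
    + exact: integrable_measurable gi.
    + by apply: continuous_measurable => //; apply: Coo_continuous.
  - move=> y Oy; rewrite /F; under eq_fun do rewrite partial_smooth_ramp_slab.
    apply: cvgD; apply: cvgM; try exact: cvg_cst; apply: cvgM; try exact: smooth_slab_cvg.
      exact: smooth_avg_cvg.
    exact: smooth_ramp_cvg.
  - by apply: integrableD_real => //; apply: integrableZ_real => //; exact: integrable_norm.
  - move=> k y Oy; rewrite /F partial_smooth_ramp_slab (le_trans (ler_normD _ _))//.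
    have hs := smooth_slab_bound k i y ab.
    have h1 : `|smooth_avg k c d (y ord0 i) * smooth_slab k i a b y| <= A1.
      by rewrite normrM; apply: ler_pM => //; exact: smooth_avg_bound.
    have h2 : `|psi k y| <= A2.
      rewrite normrM; apply: ler_pM => //; apply: le_trans (smooth_ramp_bound _ _ cd) _.
      rewrite ler_wpM2l// lerD2r; have h3 := hN y i Oy.
      by apply: lerD; apply: (le_trans (ler_normB _ _)); rewrite lerD2r.
    rewrite (normrM (v y)) (normrM (wpartial Om i v y)) mulrC (mulrC `|wpartial _ _ _ _|).
    by apply: lerD; rewrite ler_wpM2r.
rewrite -(cvg_lim _ cv)//; apply: cvg_lim => //; apply: cvg_near_cst; apply: nearW => k.
by apply: hv.
Qed.

(** The mean over the box of the extension of [v] by 0: only the part of the box in [Om]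
    contributes, but the normalization is that of the whole box. *)
Definition avg (v : fn) (a b : 'I_n -> R) : R := \int[mu]_(y in Om) (v y * box_avg a b y).

Lemma integrable_mul_box v a b : W1p Om p v -> (forall j, a j < b j) ->
  mu.-integrable Om (EFin \o (fun y => v y * box_avg a b y)).
Proof.
move=> Wv ab; apply: (integrable_mul_bounded oOm (M := \prod_j (b j - a j)^-1)).
- exact: W1p_integrable Wv.
- exact: measurable_box_avg.
- by move=> y _; have /andP[h1 h2] := box_avg_bound y ab; rewrite ger0_norm.
Qed.

Definition ramp_slab i (a b : 'I_n -> R) (y : 'rV[R]_n) :=
  ramp (a i) (b i) (y ord0 i) * slab_avg i a b y.

Lemma measurable_ramp (D : set 'rV[R]_n) c d i : measurable D ->
  measurable_fun D (fun y : 'rV[R]_n => ramp c d (y ord0 i)).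
Proof.
move=> mD; apply: measurable_funM => //; apply: measurable_funB;
by apply: measurable_maxr => //; apply: measurable_funB => //; exact: measurable_coord.
Qed.

Lemma measurable_ramp_slab (D : set 'rV[R]_n) i a b : measurable D ->
  measurable_fun D (ramp_slab i a b).
Proof.
by move=> mD; apply: measurable_funM; [exact: measurable_ramp|exact: measurable_slab_avg].
Qed.

Lemma ramp_slab_bound i a b y : (forall j, a j < b j) -> `|ramp_slab i a b y| <= slab_height i a b.
Proof.
move=> ab; have /andP[h1 h2] := slab_avg_bound i y ab;
  have /andP[h3 h4] := ramp01 (y ord0 i) (ab i).
rewrite /ramp_slab normrM (ger0_norm h1) (ger0_norm h3); exact: le_trans (ler_piMl h1 h4) h2.
Qed.

Lemma integrable_mul_ramp_slab v i a b : W1p Om p v -> (forall j, a j < b j) ->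
  mu.-integrable Om (EFin \o (fun y => wpartial Om i v y * ramp_slab i a b y)).
Proof.
move=> Wv ab; apply: (integrable_mul_bounded oOm (M := slab_height i a b)).
- exact: W1p_wpartial_integrable Wv.
- exact: measurable_ramp_slab.
- by move=> y _; exact: ramp_slab_bound.
Qed.

Lemma avg_by_parts v i a b : zero_extension Om p v -> (forall j, a j < b j) ->
  avg v a b = - \int[mu]_(y in Om) (wpartial Om i v y * ramp_slab i a b y).
Proof.
move=> zv ab; apply/eqP; rewrite -addr_eq0 /avg -RintegralD//; last 2 first.
- by apply: integrable_mul_box => //; exact: zv.1.
- by apply: integrable_mul_ramp_slab => //; exact: zv.1.
rewrite /Rintegral -[X in _ == X]/(fine 0%E) -(box_identity i zv ab (ab i)); apply/eqP.
by congr fine; apply: eq_integral => y _; rewrite (box_avgE i).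
Qed.

(** Both ramps are 0 before and 1 after the two intervals, so their difference, unlike each ramp, is
    supported near the boxes. This makes the estimate local. *)
Lemma avg_change v i a b a' b' : zero_extension Om p v ->
  (forall j, a j < b j) -> (forall j, a' j < b' j) ->
  (forall j, j != i -> a j = a' j /\ b j = b' j) ->
  `|avg v a b - avg v a' b'| <= \int[mu]_(y in Om) (`|wpartial Om i v y| *
    (`|ramp (a i) (b i) (y ord0 i) - ramp (a' i) (b' i) (y ord0 i)| * slab_avg i a b y)).
Proof.
move=> zv ab ab' E; rewrite (avg_by_parts i zv ab) (avg_by_parts i zv ab').
have I1 := integrable_mul_ramp_slab i zv.1 ab; have I2 := integrable_mul_ramp_slab i zv.1 ab'.
rewrite opprK addrC -RintegralB//.
have S y : slab_avg i a' b' y = slab_avg i a b y.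
  by apply: eq_bigr => j /E[-> ->].
apply: le_trans (le_normr_Rintegral _ _) _ => //; first exact: integrableB I2 I1.
rewrite le_eqVlt; apply/orP; left; apply/eqP; apply: eq_Rintegral => y _.
rewrite /ramp_slab S -mulrBr -mulrBl normrM distrC normrM (ger0_norm (slab_avg_ge0 i y ab)).
by [].
Qed.

Variables (q : R) (q1 : 1 <= q).

Lemma powRB1 (x r : R) : 0 < x -> x `^ (1 - r) = x / x `^ r.
Proof. by move=> x0; rewrite powRB ?powRr1 ?(ltW x0)// (gt_eqF x0) implybT. Qed.

(* [|g| <= s + s^(1-q) |g|^q] with [s = sg l^(-n/q)] balances the two terms of
   the integral over a cube of side [l]. *)
Lemma cube_change v i a b a' b' (c : 'I_n -> R) (l sg : R) : zero_extension Om p v ->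
  0 < l -> 0 < sg ->
  (\int[mu]_(y in Om) (`|wpartial Om i v y| `^ q)%:E <= (sg `^ q)%:E)%E ->
  (forall j, c j <= a j /\ a j < b j <= c j + l) ->
  (forall j, c j <= a' j /\ a' j < b' j <= c j + l) ->
  (forall j, j != i -> [/\ a j = a' j, b j = b' j & l / 2 <= b j - a j]) ->
  `|avg v a b - avg v a' b'| <= 2 ^+ n * (sg * (l * l `^ (- (n%:R / q)))).
Proof.
move=> zv l0 sg0 hq hab hab' E; have q0 : 0 < q by exact: lt_le_trans q1.
have ab j : a j < b j by have [_ /andP[]] := hab j.
have ab' j : a' j < b' j by have [_ /andP[]] := hab' j.
have {}E' j : j != i -> a j = a' j /\ b j = b' j by move=> /E[].
apply: (le_trans (avg_change zv ab ab' E')).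
(* Bounds the slab height: each of the n - 1 other sides has length at least l/2. *)
pose H : R := (2 / l) ^+ n.-1.
pose s : R := sg * l `^ (- (n%:R / q)).
have lE : 0 < l `^ (- (n%:R / q)) by exact: powR_gt0.
have s0 : 0 < s by rewrite mulr_gt0.
have H0 : 0 <= H by rewrite exprn_ge0// divr_ge0// ltW.
have Hh : slab_height i a b <= H.
  rewrite /slab_height (le_trans (y := \prod_(j < n | j != i) (2 / l)))//.
    apply: ler_prod => j /E[_ _ h]; have h0 : 0 < b j - a j by rewrite subr_gt0.
    rewrite invr_ge0 (ltW h0)/= -invf_div lef_pV2// posrE divr_gt0//.
  rewrite prodr_const (_ : #|_| = n.-1)//.
  by have := cardC1 i; rewrite card_ord.
pose Q := cbox (\row_j c j) (\row_j (c j + l)) : set 'rV[R]_n.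
have mQ : measurable Q by exact: measurable_cbox.
have muQ : mu Q = (l ^+ n)%:E.
  rewrite lebesgue_rV_box => [|j]; last by rewrite !mxE lerDl ltW.
  congr EFin; under eq_bigr do rewrite !mxE addrAC subrr add0r.
  by rewrite prodr_const card_ord.
pose g := wpartial Om i v.
have gi : mu.-integrable Om (EFin \o g) by exact: W1p_wpartial_integrable zv.1.
have mg := integrable_measurable gi.
have mgq : measurable_fun Om (fun y => `|g y| `^ q).
  by apply: measurable_powR2 => //; exact: measurable_normr_fun.
have pw y : Om y ->
    `|g y| * (`|ramp (a i) (b i) (y ord0 i) - ramp (a' i) (b' i) (y ord0 i)| * slab_avg i a b y) <=
    H * (s * \1_Q y + s `^ (1 - q) * `|g y| `^ q).
  move=> Oy; have /andP[S0 SH] := slab_avg_bound i y ab.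
  have R0 : 0 <= H * (s * \1_Q y + s `^ (1 - q) * `|g y| `^ q).
    apply: mulr_ge0 => //; apply: addr_ge0; first by rewrite mulr_ge0// ltW.
    by rewrite mulr_ge0 ?powR_ge0.
  have [yQ|yQ] := pselect (Q y).
    rewrite indicE mem_set// mulr1 mulrC ler_pM//; first by rewrite mulr_ge0.
      rewrite (le_trans _ (le_trans SH Hh))// ler_piMl//.
      have /andP[? ?] := ramp01 (y ord0 i) (ab i); have /andP[? ?] := ramp01 (y ord0 i) (ab' i).
      by rewrite ler_norml; apply/andP; split; lra.
    by apply: le_trunc_powR.
  (* Outside the cube the left-hand side is 0: either the two ramps agree ([j = i]) or the slab
     average vanishes. *)
  apply: le_trans R0; rewrite le_eqVlt; apply/orP; left; apply/eqP.
  have /existsNP[j /negP yj] : ~ (forall j, y ord0 j \in `[(\row_j c j) ord0 j,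
    (\row_j (c j + l)) ord0 j]).
    by [].
  move: yj; rewrite in_itv/= !mxE => yj.
  have [cj /andP[_ bj]] := hab j; have [cj' /andP[_ bj']] := hab' j.
  have [ji|ji] := eqVneq j i.
    subst j; rewrite (_ : _ - _ = 0) ?normr0 ?mul0r ?mulr0//.
    move: yj; rewrite negb_and -!ltNge => /orP[yj|yj].
      by rewrite !ramp_left ?subrr// (le_trans (ltW yj)).
    by rewrite !ramp_right ?subrr// (le_trans _ (ltW yj)).
  rewrite /slab_avg (bigD1 j)//= itv_avg_out ?mul0r ?mulr0//; first exact: ltW.
  apply: contra yj => /andP[h1 h2]; rewrite (le_trans cj h1)/=; exact: le_trans h2 bj.
have T : (\int[mu]_(y in Om) (H * (s * \1_Q y + s `^ (1 - q) * `|g y| `^ q))%:E <=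
    (2 ^+ n * (sg * (l * l `^ (- (n%:R / q)))))%:E)%E.
  have m1 : measurable_fun Om (fun y => s * \1_Q y) by apply: measurable_funM => //;
    exact: measurable_indic.
  have m2 : measurable_fun Om (fun y => s `^ (1 - q) * `|g y| `^ q) by exact: measurable_funM.
  rewrite intZ//; last 2 first.
  - exact: measurable_funD.
  - by move=> y _; rewrite addr_ge0// mulr_ge0 ?powR_ge0// ltW.
  rewrite intD//; last 2 first.
  - by move=> y _; rewrite mulr_ge0// ltW.
  - by move=> y _; rewrite mulr_ge0 ?powR_ge0.
  rewrite intZ ?(ltW s0)//.
  rewrite intZ ?powR_ge0//.
  rewrite integral_indic//.
  apply: (@le_trans _ _ (H%:E * (s%:E * (l ^+ n)%:E + (s `^ (1 - q))%:E * (sg `^ q)%:E))%E).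
    apply: lee_wpmul2l; first by rewrite lee_fin.
    apply: leeD; apply: lee_wpmul2l; rewrite ?lee_fin ?powR_ge0 ?(ltW s0)//.
    by rewrite -muQ; apply: le_measure; [apply: mem_set;
      exact: measurableI|exact: mem_set|exact: subIsetl].
  change ((H * (s * l ^+ n + s `^ (1 - q) * sg `^ q))%:E <=
    (2 ^+ n * (sg * (l * l `^ (- (n%:R / q)))))%:E)%E.
  rewrite lee_fin.
  have -> : s `^ (1 - q) * sg `^ q = s * l ^+ n.
    rewrite /s powRM ?(ltW sg0) ?(ltW lE)// powRB1// powRB1//.
    have -> : (l `^ (- (n%:R / q))) `^ q = l ^- n.
      by rewrite -powRrM mulNr divfK ?gt_eqF// powRN powR_mulrn// ltW.
    rewrite invrK.
    have : sg `^ q != 0 by rewrite gt_eqF ?powR_gt0.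
    by move=> ?; field.
  have n1 : (0 < n)%N by exact: leq_ltn_trans (leq0n i) (ltn_ord i).
  have pS (x : R) : x ^+ n = x * x ^+ n.-1 by rewrite -exprS prednK.
  rewrite /H /s le_eqVlt; apply/orP; left; apply/eqP.
  rewrite !pS exprMn exprVn.
  have ? : l ^+ n.-1 != 0 by rewrite expf_neq0// gt_eqF.
  by field.
rewrite -lee_fin; set A := (X in X%:E); apply: le_trans (T).
have mA : measurable_fun Om (fun y => `|g y| *
    (`|ramp (a i) (b i) (y ord0 i) - ramp (a' i) (b' i) (y ord0 i)| * slab_avg i a b y)).
  apply: measurable_funM; first exact: measurable_normr_fun.
  apply: measurable_funM; last exact: measurable_slab_avg.
  by apply: measurable_normr_fun => //; apply: measurable_funB; exact: measurable_ramp.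
have A0 y : Om y -> 0 <= `|g y| *
    (`|ramp (a i) (b i) (y ord0 i) - ramp (a' i) (b' i) (y ord0 i)| * slab_avg i a b y).
  by move=> _; rewrite mulr_ge0// mulr_ge0// slab_avg_ge0.
have mB : measurable_fun Om (fun y => H * (s * \1_Q y + s `^ (1 - q) * `|g y| `^ q)).
  by apply: measurable_funM => //; apply: measurable_funD; apply: measurable_funM.
have le1 := le_int mu mOm mA mB A0 pw.
rewrite /A /Rintegral fineK; first exact: le1.
rewrite ge0_fin_numE; last by apply: integral_ge0 => y Oy; rewrite lee_fin A0.
exact: le_lt_trans (le_trans le1 T) (ltry _).
Qed.

(* Passes from one box to the other by changing one side at a time. *)
Lemma box_change v (a b a' b' c : 'I_n -> R) (l sg : R) : zero_extension Om p v ->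
  0 < l -> 0 < sg ->
  (forall i, (\int[mu]_(y in Om) (`|wpartial Om i v y| `^ q)%:E <= (sg `^ q)%:E)%E) ->
  (forall j, [/\ c j <= a j, l / 2 <= b j - a j & b j <= c j + l]) ->
  (forall j, [/\ c j <= a' j, l / 2 <= b' j - a' j & b' j <= c j + l]) ->
  `|avg v a b - avg v a' b'| <= n%:R * (2 ^+ n * (sg * (l * l `^ (- (n%:R / q))))).
Proof.
move=> zv l0 sg0 hq hab hab'; set K := 2 ^+ n * _.
have l2 : 0 < l / 2 by rewrite divr_gt0.
pose hyb (f f' : 'I_n -> R) k (j : 'I_n) := if (j < k)%N then f' j else f j.
suff H k : (k <= n)%N -> `|avg v a b - avg v (hyb a a' k) (hyb b b' k)| <= k%:R * K.
  have E f f' : hyb f f' n = f' by apply/funext => j; rewrite /hyb ltn_ord.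
  by have := H n (leqnn n); rewrite !E.
elim: k => [_|k IH kn].
  by rewrite (_ : hyb a a' 0%N = a)// (_ : hyb b b' 0%N = b)// subrr normr0 mul0r.
have := ler_distD (avg v (hyb a a' k) (hyb b b' k)) (avg v a b)
  (avg v (hyb a a' k.+1) (hyb b b' k.+1)).
move=> /le_trans; apply; rewrite -natr1 mulrDl mul1r; apply: lerD; first by apply: IH; exact: ltnW.
have hh m j : [/\ c j <= hyb a a' m j,
  l / 2 <= hyb b b' m j - hyb a a' m j & hyb b b' m j <= c j + l].
  by rewrite /hyb; case: ifP.
apply: (@cube_change v (Ordinal kn) _ _ _ _ c) => //.
- by move=> j; have [-> h ->] := hh k j; split => //; rewrite andbT -subr_gt0 (lt_le_trans l2).
- by move=> j; have [-> h ->] := hh k.+1 j; split => //; rewrite andbT -subr_gt0 (lt_le_trans l2).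
- move=> j jk; have jk' : (j < k.+1)%N = (j < k)%N.
    by rewrite ltnS leq_eqVlt -(inj_eq val_inj) in jk *; rewrite (negbTE jk).
  have [_ h _] := hh k j; split => //; by rewrite /hyb jk'.
Qed.

(** [x] is the lower corner rather than the centre: halving then keeps the corner, and a shift along
    the diagonal eventually leaves [Om]. *)
Definition cube_avg v (l : R) (x : 'rV[R]_n) := avg v (fun j => x ord0 j) (fun j => x ord0 j + l).

Lemma cube_avg_halve v x (l sg : R) : zero_extension Om p v -> 0 < l -> 0 < sg ->
  (forall i, (\int[mu]_(y in Om) (`|wpartial Om i v y| `^ q)%:E <= (sg `^ q)%:E)%E) ->
  `|cube_avg v l x - cube_avg v (l / 2) x| <= n%:R * (2 ^+ n * (sg * (l * l `^ (- (n%:R / q))))).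
Proof.
move=> zv l0 sg0 hq; apply: (@box_change _ _ _ _ _ (fun j => x ord0 j)) => // j; split => //; lra.
Qed.

(** Both cubes lie in the cube of side 2l with lower corner [x], and their sides are exactly half of
    its side, as [box_change] requires. *)
Lemma cube_avg_shift v x (l sg : R) : zero_extension Om p v -> 0 < l -> 0 < sg ->
  (forall i, (\int[mu]_(y in Om) (`|wpartial Om i v y| `^ q)%:E <= (sg `^ q)%:E)%E) ->
  `|cube_avg v l x - cube_avg v l (\row_j (x ord0 j + l))| <=
  n%:R * (2 ^+ n * (sg * (2 * l * (2 * l) `^ (- (n%:R / q))))).
Proof.
move=> zv l0 sg0 hq; apply: (@box_change _ _ _ _ _ (fun j => x ord0 j)) => //; first lra.
  by move=> j; split => //; lra.
by move=> j; split; rewrite ?mxE//; lra.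
Qed.

Lemma cube_avg_out v (x : 'rV[R]_n) (l : R) : (0 < n)%N -> 0 < l ->
  (forall y, Om y -> forall j, y ord0 j < x ord0 j) -> cube_avg v l x = 0.
Proof.
move=> n0 l0 h; rewrite /cube_avg /avg /Rintegral.
rewrite (eq_integral (cst 0%E)) ?integral0// => y /set_mem Oy.
rewrite (box_avgE (Ordinal n0)) itv_avg_out ?mul0r ?mulr0//.
  by rewrite lerDl ltW.
by apply/negP => /andP[]; rewrite leNgt h.
Qed.

End box_average.

(** * Convergence of averages over shrinking cubes *)

Section geometric_convergence.
Context {R : realType}.

Lemma powR_exprn (x r : R) m : 0 <= x -> (x ^+ m) `^ r = (x `^ r) ^+ m.
Proof.
by move=> x0; rewrite -(powR_mulrn m x0) -(powR_mulrn m (powR_ge0 x r)) -!powRrM mulrC.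
Qed.

Lemma geometric_increments (u : R ^nat) (K r : R) : 0 <= K -> 0 < r < 1 ->
  (forall m, `|u m - u m.+1| <= K * r ^+ m) ->
  cvgn u /\ forall m, `|u m - u 0%N| <= K / (1 - r).
Proof.
move=> K0 /andP[r0 r1] H.
have nr : `|r| < 1 by rewrite ger0_norm// ltW.
have tK m : `|telescope u m| <= geometric K r m by rewrite /telescope distrC; exact: H.
have uE : u = (fun m => u 0%N + series (telescope u) m).
  by apply/funext => m; exact: eq_sum_telescope.
split.
  rewrite uE; apply: is_cvgD; first exact: is_cvg_cst.
  apply: normed_cvg; apply: (series_le_cvg (v_ := geometric K r)) => //.
  - by move=> m; exact: normr_ge0.
  - by move=> m; apply: geometric_ge0 => //; exact: ltW.
  - exact: is_cvg_geometric_series.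
move=> m; rewrite (eq_sum_telescope u m) (addrC (u 0%N)) addrK.
apply: le_trans (geometric_le_lim m K0 r0 nr).
by apply: le_trans (ler_norm_sum _ _ _) _; apply: ler_sum => k _; exact: tK.
Qed.

End geometric_convergence.

Section morrey.
Context {R : realType} {n : nat}.
Variables (Om : set 'rV[R]_n) (p : 'rV[R]_n -> R).
Hypothesis n0 : (0 < n)%N.
Hypothesis oOm : open Om.
Hypothesis bOm : bounded_set Om.
Hypothesis mp : measurable_fun Om p.
Hypothesis p1 : forall x, Om x -> 1 < p x.
Local Notation mu := (@lebesgue_rV R n).
Local Notation fn := ('rV[R]_n -> R).

Let mOm : measurable Om := open_measurable_rV oOm.

(** Halving the cube changes the average by a multiple of l^(1 - n/q), a geometric sequence along
    dyadic sides because q > n. The first average is bounded by comparison with a cube that misses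
    [Om], where the average is 0. *)
Lemma cube_avg_cvg (q : R) : 1 <= q -> n%:R < q -> exists L M : R, [/\ 0 < L, 0 <= M &
  forall v sg, zero_extension Om p v -> 0 < sg ->
  (forall i, (\int[mu]_(y in Om) (`|wpartial Om i v y| `^ q)%:E <= (sg `^ q)%:E)%E) ->
  forall x, Om x -> cvgn (fun m => cube_avg Om v (L * 2^-1 ^+ m) x) /\
    forall m, `|cube_avg Om v (L * 2^-1 ^+ m) x| <= M * sg].
Proof.
move=> q1 nq; have q0 : 0 < q by exact: lt_le_trans q1.
have [N N0 hN] := bounded_cbox bOm.
have hc y j : Om y -> - N <= y ord0 j <= N.
  by move=> /hN/(_ j); rewrite in_itv/= !mxE.
(* Coordinates in [Om] are at most [N] in absolute value, so a shift by [L] puts the lower corner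
   beyond all of [Om]. *)
pose L := 2 * N + 1; have L0 : 0 < L by rewrite /L; lra.
pose th : R := 1 - n%:R / q.
have th0 : 0 < th by rewrite /th subr_gt0 ltr_pdivrMr// mul1r.
pose r : R := 2^-1 `^ th.
have r0 : 0 < r by rewrite powR_gt0.
have r1 : r < 1.
  rewrite -[X in _ < X](_ : 1 `^ th = 1); last by rewrite powR1.
  by apply: gt0_ltr_powR => //; rewrite ?nnegrE ?invf_lt1// ?ltr1n// invr_ge0.
have r01 : 0 < r < 1 by rewrite r0.
pose K1 : R := n%:R * (2 ^+ n * (2 * L * (2 * L) `^ (- (n%:R / q)))).
pose K2 : R := n%:R * (2 ^+ n * L `^ th).
have K1_ge0 : 0 <= K1.
  by rewrite /K1 !mulr_ge0// ?exprn_ge0// ?powR_ge0// ltW.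
have K2_ge0 : 0 <= K2.
  by rewrite /K2 !mulr_ge0// ?exprn_ge0// ?powR_ge0.
have thE (l : R) : 0 < l -> l * l `^ (- (n%:R / q)) = l `^ th.
  by move=> l0; rewrite /th powRB1// powRN.
exists L, (K1 + K2 / (1 - r)); split => //.
  by rewrite addr_ge0// divr_ge0// subr_ge0 ltW.
move=> v sg zv sg0 hq x Ox.
have l0 m : 0 < L * 2^-1 ^+ m :> R by rewrite mulr_gt0// exprn_gt0.
pose u m := cube_avg Om v (L * 2^-1 ^+ m) x.
have u0 : `|u 0%N| <= K1 * sg.
  have := cube_avg_shift oOm bOm mp p1 q1 x zv L0 sg0 hq.
  rewrite (_ : cube_avg Om v L (\row_j _) = 0); last first.
    apply: cube_avg_out => // y Oy j; rewrite mxE /L.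
    by have := hc x j Ox; have := hc y j Oy; lra.
  by rewrite subr0 /u expr0 mulr1 => /le_trans; apply; rewrite /K1 le_eqVlt; apply/orP; left;
    apply/eqP; ring.
have step m : `|u m - u m.+1| <= K2 * sg * r ^+ m.
  have := cube_avg_halve oOm bOm mp p1 q1 x zv (l0 m) sg0 hq.
  rewrite -mulrA -exprSr => /le_trans; apply.
  rewrite thE// (powRM _ (ltW L0)) ?exprn_ge0 ?invr_ge0// (_ : (2^-1 ^+ m) `^ th = r ^+ m);
    last first.
    exact: powR_exprn.
  rewrite (_ : n%:R * _ = K2 * sg * r ^+ m)//.
  by rewrite /K2; ring.
have [cu bu] := geometric_increments (mulr_ge0 K2_ge0 (ltW sg0)) r01 step.
split; first exact: cu.
move=> m; rewrite -/(u m) -(subrK (u 0%N) (u m)) (le_trans (ler_normD _ _))//.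
rewrite addrC mulrDl; apply: lerD => //; apply: le_trans (bu m) _.
by rewrite mulrAC.
Qed.

Definition cube_kernel (l : R) (x y : 'rV[R]_n) :=
  box_avg (fun j => x ord0 j) (fun j => x ord0 j + l) y.

Let lower (l : R) (y : 'rV[R]_n) : 'rV[R]_n := \row_j (y ord0 j - l).

(** Exchanges the roles of the points: as a function of the corner [x], the kernel is the normalized
    indicator of the cube with upper corner [y]. *)
Lemma cube_kernelE l x y : 0 < l ->
  cube_kernel l x y = l ^- n * \1_(cbox (lower l y) y) x.
Proof.
move=> l0; rewrite indicE; have lx j : x ord0 j < x ord0 j + l by rewrite ltrDl.
have E j : (x ord0 j \in `[(lower l y) ord0 j, y ord0 j]) = (x ord0 j <= y ord0 j <= x ord0 j + l).
  by rewrite in_itv/= mxE lerBlDr andbC.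
have [xC|xC] := pselect (cbox (lower l y) y x).
  rewrite mem_set// mulr1 /cube_kernel /box_avg.
  rewrite (eq_bigr (fun=> l^-1)); first by rewrite prodr_const card_ord exprVn.
  move=> j _; rewrite /itv_avg itv_indE ?(ltW (lx j))// -E xC mulr1.
  by rewrite addrAC subrr add0r.
rewrite memNset// mulr0.
have /existsNP[j] := xC; rewrite E => /negP xj.
by rewrite /cube_kernel (box_avgE j) itv_avg_out ?mul0r// ltW.
Qed.

Lemma measurable_cube_kernel l : 0 < l ->
  measurable_fun setT (fun z : 'rV[R]_n * 'rV[R]_n => cube_kernel l z.1 z.2).
Proof.
move=> l0; rewrite (_ : (fun z => _) = fun z : 'rV[R]_n * 'rV[R]_n =>
    \prod_(j < n) (l^-1 * itv_ind (z.1 ord0 j) (z.1 ord0 j + l) (z.2 ord0 j))); last first.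
  apply/funext => z; apply: eq_bigr => j _; rewrite /itv_avg; congr (_^-1 * _).
  by rewrite addrAC subrr add0r.
apply: (@measurable_prod _ _ _ _ _ _
  (fun (j : 'I_n) (z : 'rV[R]_n * 'rV[R]_n) =>
     l^-1 * itv_ind (z.1 ord0 j) (z.1 ord0 j + l) (z.2 ord0 j))) => j _.
have m1 : measurable_fun setT (fun z : 'rV[R]_n * 'rV[R]_n => z.1 ord0 j).
  exact: (measurableT_comp (measurable_rV_coord j) measurable_fst).
have m2 : measurable_fun setT (fun z : 'rV[R]_n * 'rV[R]_n => z.2 ord0 j).
  exact: (measurableT_comp (measurable_rV_coord j) measurable_snd).
apply: measurable_funM; first exact: measurable_cst.
by apply: measurable_itv_ind => //; apply: measurable_funD => //.
Qed.

(** The fraction of the cube of side [l] with upper corner [y] that lies in [D]. *)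
Definition cube_weight (D : set 'rV[R]_n) (l : R) (y : 'rV[R]_n) : R :=
  \int[mu]_(x in D) cube_kernel l x y.

Let subset_fin (D : set 'rV[R]_n) : measurable D -> D `<=` Om -> (mu D < +oo)%E.
Proof.
move=> mD DO; apply: le_lt_trans (Om_fin oOm bOm).
by apply: le_measure; [exact: mem_set|exact: mem_set|].
Qed.

Lemma cube_kernel_bound l x y : 0 < l -> 0 <= cube_kernel l x y <= l ^- n.
Proof.
move=> l0; have li : 0 <= l ^- n by rewrite invr_ge0 exprn_ge0// ltW.
by rewrite cube_kernelE// indicE; case: (_ \in _); rewrite ?mulr0 ?mulr1 li lexx.
Qed.

Lemma integrable_cube_kernel D l y : measurable D -> D `<=` Om -> 0 < l ->
  mu.-integrable D (EFin \o (fun x => cube_kernel l x y)).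
Proof.
move=> mD DO l0; apply: (@le_integrable_real _ _ _ mu D mD _ (fun=> l ^- n)).
- rewrite (_ : (fun x => _) = fun x => l ^- n * \1_(cbox (lower l y) y) x).
    by apply: measurable_funM => //; apply: measurable_indic; exact: measurable_cbox.
  by apply/funext => x; exact: cube_kernelE.
- by apply: integrable_cst_fin => //; exact: subset_fin.
- by move=> x _; have /andP[h1 h2] := cube_kernel_bound x y l0; rewrite ger0_norm.
Qed.

Lemma measurable_cube_weight D l : measurable D -> D `<=` Om -> 0 < l ->
  measurable_fun setT (cube_weight D l).
Proof.
move=> mD DO l0; apply/measurable_EFinP.
have mi : measurable_fun setT (\1_D : 'rV[R]_n -> R) by exact: measurable_indic.
pose F (z : 'rV[R]_n * 'rV[R]_n) : R := cube_kernel l z.1 z.2 * \1_D z.1.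
have mF : measurable_fun setT (EFin \o F).
  apply/measurable_EFinP; apply: measurable_funM; first exact: measurable_cube_kernel.
  exact: (measurableT_comp mi measurable_fst).
have F0 z : (0 <= (EFin \o F) z)%E.
  by have /andP[h _] := cube_kernel_bound z.1 z.2 l0; rewrite lee_fin mulr_ge0.
rewrite (_ : EFin \o _ = fubini_G mu (EFin \o F)).
  exact: measurable_fun_fubini_tonelli_G mF F0.
apply/funext => y; rewrite /fubini_G/= /F/= -integral_indic_mul// /cube_weight /Rintegral.
by rewrite fineK//; apply: integrable_fin_num (integrable_cube_kernel y mD DO l0).
Qed.

Lemma fubini_cube D v l : measurable D -> D `<=` Om -> W1p Om p v -> 0 < l ->
  [/\ mu.-integrable D (EFin \o cube_avg Om v l),
    measurable_fun Om (fun y => v y * cube_weight D l y) &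
    (\int[mu]_(x in D) (cube_avg Om v l x)%:E =
     \int[mu]_(y in Om) (v y * cube_weight D l y)%:E)%E].
Proof.
move=> mD DO Wv l0.
(* The indicators are moved into the integrand so that Fubini's theorem applies on the whole product
   space; the one of [Om] is attached to [v], whose values elsewhere are arbitrary. *)
pose F (z : 'rV[R]_n * 'rV[R]_n) : R := \1_D z.1 * (v z.2 * \1_Om z.2) * cube_kernel l z.1 z.2.
have vi : mu.-integrable Om (EFin \o v) by exact: W1p_integrable Wv.
have mv := integrable_measurable vi.
have mvO : measurable_fun setT (fun y => v y * \1_Om y).
  have /(measurable_restrictT _ mOm) := mv; rewrite (_ : v \_ Om = fun y => v y * \1_Om y)//.
  by apply/funext => y; rewrite patchE indicE; case: (_ \in _); rewrite ?mulr1 ?mulr0.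
have mF : measurable_fun setT F.
  apply: measurable_funM; last exact: measurable_cube_kernel.
  apply: measurable_funM.
    have mi : measurable_fun setT (\1_D : 'rV[R]_n -> R) by exact: measurable_indic.
    exact: (measurableT_comp mi measurable_fst).
  exact: (measurableT_comp mvO measurable_snd).
have li : 0 <= l ^- n by rewrite invr_ge0 exprn_ge0// ltW.
have mabs : measurable_fun setT (fun y => `|v y * \1_Om y|) by exact: measurable_normr_fun.
pose A := (\int[mu]_y `|v y * \1_Om y|%:E)%E.
have A0 : (0 <= A)%E by apply: integral_ge0 => y _; rewrite lee_fin.
have Afin : A \is a fin_num.
  rewrite ge0_fin_numE// /A.
  rewrite (eq_integral (fun y => (`|v y| * \1_Om y)%:E)); last first.
    by move=> y _; rewrite normrM indicE; case: (_ \in _); rewrite ?normr1 ?normr0.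
  by rewrite -integral_indic_mul//; exact: integrable_norm_lt vi.
pose H (z : 'rV[R]_n * 'rV[R]_n) : R := l ^- n * \1_D z.1 * `|v z.2 * \1_Om z.2|.
have D0 x : 0 <= \1_D x :> R by rewrite indicE; case: (_ \in _).
have mi : measurable_fun setT (\1_D : 'rV[R]_n -> R) by exact: measurable_indic.
have mH : measurable_fun setT H.
  apply: measurable_funM; last exact: (measurableT_comp mabs measurable_snd).
  by apply: measurable_funM => //; exact: (measurableT_comp mi measurable_fst).
have iH : (mu \x mu)%E.-integrable setT (EFin \o H).
  apply/integrable12ltyP; first exact/measurable_EFinP.
  rewrite (eq_integral (fun x => ((l ^- n * fine A) * \1_D x)%:E)); last first.
    move=> x _; rewrite (eq_integral (fun y => ((l ^- n * \1_D x) * `|v y * \1_Om y|)%:E));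
      last first.
      by move=> y _; rewrite /H/= ger0_norm// mulr_ge0// mulr_ge0.
    rewrite intZ//; last by rewrite mulr_ge0.
    by rewrite -/A -(fineK Afin) -EFinM; congr EFin; rewrite mulrAC.
  rewrite intZ//; last by rewrite mulr_ge0// fine_ge0.
  by rewrite integral_indic// setIT lte_mul_pinfty// ?lee_fin ?mulr_ge0 ?fine_ge0//;
    exact: subset_fin.
have iF : (mu \x mu)%E.-integrable setT (EFin \o F).
  apply: (@le_integrable_real _ _ _ (mu \x mu)%E setT measurableT F H) => // -[x y] _.
  have /andP[k0 k1] := cube_kernel_bound x y l0.
  rewrite /F /H/= normrM normrM (ger0_norm (D0 x)) (ger0_norm k0) mulrC -mulrA.
  by rewrite ler_wpM2r// mulr_ge0.
have EF x : (\int[mu]_y (EFin \o F) (x, y) = (\1_D x * cube_avg Om v l x)%:E)%E.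
  rewrite (eq_integral (fun y => (\1_D x * (v y * cube_kernel l x y) * \1_Om y)%:E)); last first.
    by move=> y _; congr EFin; rewrite /F/=; ring.
  rewrite -integral_indic_mul//; under eq_integral do rewrite EFinM.
  have ivk : mu.-integrable Om (EFin \o (fun y => v y * cube_kernel l x y)).
    by apply: (integrable_mul_box oOm bOm mp p1 Wv) => j; rewrite ltrDl.
  rewrite integralZl// EFinM /cube_avg /avg /Rintegral fineK//.
  exact: integrable_fin_num ivk.
have EG y : (\int[mu]_x (EFin \o F) (x, y) = (v y * cube_weight D l y * \1_Om y)%:E)%E.
  rewrite (eq_integral (fun x => (v y * \1_Om y * cube_kernel l x y * \1_D x)%:E)); last first.
    by move=> x _; congr EFin; rewrite /F/=; ring.
  rewrite -integral_indic_mul//; under eq_integral do rewrite EFinM.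
  have ik := integrable_cube_kernel y mD DO l0.
  transitivity ((v y * \1_Om y)%:E * \int[mu]_(x in D) (cube_kernel l x y)%:E)%E.
    exact: integralZl.
  rewrite -(fineK (integrable_fin_num mD ik)) -EFinM; congr EFin.
  by rewrite /cube_weight /Rintegral mulrAC.
have EF' : fubini_F mu (EFin \o F) = EFin \o (fun x => \1_D x * cube_avg Om v l x).
  by apply/funext => x; exact: EF.
have := integrable_fubini_F iF; rewrite EF' => iFF.
split.
- have h := integrableS measurableT mD (@subsetT _ D) iFF.
  apply: eq_integrable h => // x xD; congr EFin; by rewrite indicE xD mul1r.
- by apply: measurable_funM => //; apply: measurable_funS (measurable_cube_weight mD DO l0).
have := Fubini iF.
rewrite (eq_integral (fun x => (cube_avg Om v l x * \1_D x)%:E)); last first.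
  by move=> x _; rewrite EF mulrC.
rewrite [in X in _ = X -> _](eq_integral (fun y => (v y * cube_weight D l y * \1_Om y)%:E));
  last first.
  by move=> y _; rewrite EG.
by rewrite -!integral_indic_mul.
Qed.

Lemma lebesgue_cube l y : 0 < l -> mu (cbox (lower l y) y) = (l ^+ n)%:E.
Proof.
move=> l0; rewrite lebesgue_rV_box => [|j]; last by rewrite mxE lerBlDr lerDl ltW.
rewrite (eq_bigr (fun=> l)) => [|j _]; last by rewrite mxE opprB addrCA subrr addr0.
by rewrite prodr_const card_ord.
Qed.

Lemma cube_weight01 D l y : measurable D -> D `<=` Om -> 0 < l -> 0 <= cube_weight D l y <= 1.
Proof.
move=> mD DO l0; have ik := integrable_cube_kernel y mD DO l0.
have li : 0 <= l ^- n by rewrite invr_ge0 exprn_ge0// ltW.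
apply/andP; split.
  by apply: Rintegral_ge0 => x _; have /andP[] := cube_kernel_bound x y l0.
rewrite -lee_fin /cube_weight /Rintegral fineK; last exact: integrable_fin_num ik.
have mQ : measurable (cbox (lower l y) y) by exact: measurable_cbox.
rewrite (eq_integral (fun x => (l ^- n * \1_(cbox (lower l y) y) x)%:E)); last first.
  by move=> x _; rewrite cube_kernelE.
rewrite intZ// integral_indic//.
apply: (@le_trans _ _ ((l ^- n)%:E * mu (cbox (lower l y) y))%E).
  apply: lee_wpmul2l; first by rewrite lee_fin.
  by apply: le_measure; [apply: mem_set; exact: measurableI|exact: mem_set|exact: subIsetl].
by rewrite lebesgue_cube// -EFinM lee_fin mulVf// expf_neq0// gt_eqF.
Qed.

Lemma cube_weight1 D l y : measurable D -> 0 < l -> cbox (lower l y) y `<=` D ->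
  cube_weight D l y = 1.
Proof.
move=> mD l0 QD; rewrite /cube_weight /Rintegral.
have li : 0 <= l ^- n by rewrite invr_ge0 exprn_ge0// ltW.
have mQ : measurable (cbox (lower l y) y) by exact: measurable_cbox.
rewrite (eq_integral (fun x => (l ^- n * \1_(cbox (lower l y) y) x)%:E)); last first.
  by move=> x _; rewrite cube_kernelE.
rewrite intZ// integral_indic// (setIidl QD).
transitivity (fine ((l ^- n)%:E * (l ^+ n)%:E)%E).
  by congr (fine (_ * _)%E); exact: lebesgue_cube.
by rewrite -EFinM/= mulVf// expf_neq0// gt_eqF.
Qed.

Lemma cube_weight0 D l y : 0 < l -> (forall x, D x -> ~ cbox (lower l y) y x) ->
  cube_weight D l y = 0.
Proof.
move=> l0 QD; rewrite /cube_weight /Rintegral (eq_integral (cst 0%E)) ?integral0//.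
by move=> x /set_mem/QD h; rewrite cube_kernelE// indicE memNset// mulr0.
Qed.

(** The cube lies below its corner [y] and orthants are downward closed, so the weight is eventually
    exactly 0 or 1 at every point of [Om], also on the boundary of the orthant. *)
Lemma cube_weight_cvg (L : R) b y : 0 < L -> Om y ->
  cube_weight (Om `&` lowset b) (L * 2^-1 ^+ m) y @[m --> \oo] --> (\1_(lowset b) y : R).
Proof.
move=> L0 Oy.
have small e : 0 < e -> \forall m \near \oo, L * 2^-1 ^+ m < e.
  move=> e0; have : geometric L 2^-1 m @[m --> \oo] --> (0 : R).
    by apply: cvg_geometric; rewrite ger0_norm// invf_lt1// ltr1n.
  move=> /cvgr0Pnorm_lt/(_ e e0); apply: filterS => m.
  by rewrite /= ger0_norm// mulr_ge0// ltW.
have l0 m : 0 < L * 2^-1 ^+ m by rewrite mulr_gt0// exprn_gt0.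
apply: cvg_near_cst; rewrite indicE.
have [yb|yb] := pselect (lowset b y); last first.
  rewrite memNset//.
  have [j /negP] : exists j, ~ (y ord0 j <= b ord0 j) by apply/existsNP.
  rewrite -ltNge -subr_gt0 => /small; apply: filterS => m hm.
  apply: cube_weight0 => // x [_ /(_ j) xb] /(_ j); rewrite in_itv/= mxE => /andP[h1 h2].
  by lra.
rewrite mem_set//.
have /nbhs_rV_ball[e e0 he] : nbhs y Om by exact: open_nbhs_nbhs.
move: (small e e0); apply: filterS => m hm.
apply: cube_weight1 => [|//|x xQ].
  by apply: measurableI => //; exact: measurable_lowset.
have hx j : y ord0 j - L * 2^-1 ^+ m <= x ord0 j <= y ord0 j by have := xQ j; rewrite in_itv/= mxE.
split.
  by apply: he => j; have := hx j; move: (l0 m) hm; rewrite ltr_norml; set c := L * _; lra.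
by move=> j; have /andP[_ h] := hx j; exact: le_trans h (yb j).
Qed.

(* By Fubini's theorem the limit of the averages has the same integrals as [v]
   over the sets [Om `&` lowset b], so it is [v] almost everywhere; this avoids
   Lebesgue's differentiation theorem on R^n. *)
Lemma ae_le_cube_limit v (L M : R) : W1p Om p v -> 0 < L ->
  (forall x, Om x -> cvgn (fun m => cube_avg Om v (L * 2^-1 ^+ m) x) /\
     forall m, `|cube_avg Om v (L * 2^-1 ^+ m) x| <= M) ->
  {ae mu, forall x, Om x -> `|v x| <= M}.
Proof.
move=> Wv L0 H; have l0 m : 0 < L * 2^-1 ^+ m :> R by rewrite mulr_gt0// exprn_gt0.
have vi : mu.-integrable Om (EFin \o v) by exact: W1p_integrable Wv.
have mv := integrable_measurable vi.
pose vm m x := cube_avg Om v (L * 2^-1 ^+ m) x.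
pose vb x := limn (vm ^~ x).
have cvb x : Om x -> vm m x @[m --> \oo] --> vb x by move=> /H[].
have vbM x : Om x -> `|vb x| <= M.
  move=> Ox; have h : `|vm m x| @[m --> \oo] --> `|vb x| by apply: cvg_norm; exact: cvb.
  rewrite -(cvg_lim _ h)//; apply: limr_le; first by apply/cvg_ex; exists `|vb x|.
  by apply: nearW => m; exact: (H x Ox).2.
have lim D : measurable D -> D `<=` Om ->
  mu.-integrable D (EFin \o vb) /\
  (\int[mu]_(x in D) (vm m x)%:E)%E @[m --> \oo] --> (\int[mu]_(x in D) (vb x)%:E)%E.
  move=> mD DO; apply: (@dominated_cvg_real _ _ _ mu D vm vb (fun=> M)) => //.
  - by move=> m; have [h _ _] := fubini_cube mD DO Wv (l0 m); exact: integrable_measurable h.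
  - by move=> x /DO; exact: cvb.
  - by apply: integrable_cst_fin => //; exact: subset_fin.
  - by move=> m x /DO Ox; exact: (H x Ox).2.
have [vbi _] := lim Om mOm (@subset_refl _ Om).
have E b : (\int[mu]_(x in Om `&` lowset b) (vb x)%:E = \int[mu]_(x in Om `&` lowset b) (v x)%:E)%E.
  have mD : measurable (Om `&` lowset b) by apply: measurableI => //; exact: measurable_lowset.
  have [_ c1] := lim _ mD (@subIsetl _ _ _).
  have c2 : (\int[mu]_(y in Om) (v y * cube_weight (Om `&` lowset b) (L * 2^-1 ^+ m) y)%:E)%E
      @[m --> \oo] --> (\int[mu]_(y in Om) (v y * \1_(lowset b) y)%:E)%E.
    apply: (proj2 (@dominated_cvg_real _ _ _ mu Om
      (fun m y => v y * cube_weight (Om `&` lowset b) (L * 2^-1 ^+ m) y)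
      (fun y => v y * \1_(lowset b) y) (fun y => `|v y|) mOm _ _ _ _)).
    - by move=> m; have [_ h _] := fubini_cube mD (@subIsetl _ _ _) Wv (l0 m).
    - by move=> y Oy; apply: cvgM; [exact: cvg_cst|exact: cube_weight_cvg].
    - exact: integrable_norm.
    - move=> m y Oy; have /andP[w0 w1] := cube_weight01 y mD (@subIsetl _ _ _) (l0 m).
      by rewrite normrM (ger0_norm w0) ler_piMr.
  have e1 : (fun m => \int[mu]_(x in Om `&` lowset b) (vm m x)%:E)%E =
      (fun m => \int[mu]_(y in Om) (v y * cube_weight (Om `&` lowset b) (L * 2^-1 ^+ m) y)%:E)%E.
    by apply/funext => m; have [_ _ h] := fubini_cube mD (@subIsetl _ _ _) Wv (l0 m).
  rewrite e1 in c1; rewrite -(cvg_lim _ c1)// (cvg_lim _ c2)//.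
  rewrite [RHS](@integral_indic_mul R n Om)//; apply: eq_integral => y /set_mem Oy.
  by rewrite !indicE in_setI (mem_set Oy).
have di : mu.-integrable Om (EFin \o (fun x => v x - vb x)) by exact: (integrableB mOm vi vbi).
have : {ae mu, forall x, Om x -> v x - vb x = 0}.
  apply: integral_lowset_ae0 => // b.
  have mD : measurable (Om `&` lowset b) by apply: measurableI => //; exact: measurable_lowset.
  have i1 := integrableS mOm mD (@subIsetl _ _ _) vi.
  have i2 := integrableS mOm mD (@subIsetl _ _ _) vbi.
  under eq_integral do rewrite EFinB.
  rewrite integralB_EFin// E subee//; exact: integrable_fin_num i1.
by apply: filterS => x h Ox; rewrite (subr0_eq (h Ox)); exact: vbM.
Qed.

Theorem morrey (q : R) : 1 <= q -> n%:R < q -> exists2 M : R, 0 <= M &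
  forall v sg, zero_extension Om p v -> 0 < sg ->
  (forall i, (\int[mu]_(y in Om) (`|wpartial Om i v y| `^ q)%:E <= (sg `^ q)%:E)%E) ->
  {ae mu, forall x, Om x -> `|v x| <= M * sg}.
Proof.
move=> q1 nq; have [L [M [L0 M0 H]]] := cube_avg_cvg q1 nq.
exists M => // v sg zv sg0 hq; apply: (ae_le_cube_limit zv.1 L0) => x Ox.
exact: H.
Qed.

End morrey.

(** * Limits in L^1 and energies *)

Section powR_limits.
Context {R : realType}.
Implicit Types (u : R ^nat) (a r : R).

Lemma cvg_powR_gt0 u a r : 0 < a -> u k @[k --> \oo] --> a -> u k `^ r @[k --> \oo] --> a `^ r.
Proof.
move=> a0 ua; have h : {for a, continuous (fun t : R => t `^ r)}.
  apply: differentiable_continuous; apply/derivable1_diffP.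
  by apply: derivable_powR; rewrite in_itv/= a0.
exact: (cvg_comp u (fun t => t `^ r) ua h).
Qed.

(** The power need not be differentiable at 0, so a limit 0 is treated apart, with the threshold
    e^(1/r). *)
Lemma cvg_powR u a r : 0 < r -> (forall k, 0 <= u k) -> u k @[k --> \oo] --> a ->
  u k `^ r @[k --> \oo] --> a `^ r.
Proof.
move=> r0 u0 ua; have : 0 <= a.
  rewrite -(cvg_lim _ ua)//; apply: limr_ge; first by apply/cvg_ex; exists a.
  by apply: nearW.
rewrite le_eqVlt => /predU1P[a0|a0]; last exact: cvg_powR_gt0.
rewrite -a0 powR0 ?gt_eqF// in ua *; apply/cvgr0Pnorm_lt => e e0.
have d0 : 0 < e `^ r^-1 by exact: powR_gt0.
move/cvgr0Pnorm_lt : ua => /(_ _ d0); apply: filterS => k.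
rewrite (ger0_norm (u0 k)) ger0_norm ?powR_ge0// => h.
have -> : e = (e `^ r^-1) `^ r by rewrite -powRrM mulVf ?gt_eqF// powRr1// ltW.
by apply: gt0_ltr_powR => //; rewrite nnegrE ?u0 ?powR_ge0.
Qed.

End powR_limits.

(** * Fatou's lemma and fast Cauchy sequences in L^1 *)

Section sequences_of_functions.
Context d {T : measurableType d} {R : realType} (mu : {measure set T -> \bar R}).
Variables (D : set T) (mD : measurable D).

Lemma fatou_ae_le (f_ : nat -> T -> R) (f : T -> R) (c : \bar R) :
  (forall k, measurable_fun D (f_ k)) -> measurable_fun D f ->
  (forall k x, D x -> 0 <= f_ k x) -> (forall x, D x -> 0 <= f x) ->
  {ae mu, forall x, D x -> f_ k x @[k --> \oo] --> f x} ->
  (forall k, \int[mu]_(x in D) (f_ k x)%:E <= c)%E -> (\int[mu]_(x in D) (f x)%:E <= c)%E.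
Proof.
move=> mf_ mf f_0 f0 cv fc.
have mE k : measurable_fun D (EFin \o f_ k) by exact/measurable_EFinP.
have E0 k x : D x -> (0 <= (EFin \o f_ k) x)%E by move=> Dx; rewrite lee_fin f_0.
have mN (g : T -> \bar R) : measurable_fun D g -> measurable_fun D (fun x => - g x)%E.
  move=> mg; rewrite (_ : (fun x => _) = fun x => (cst 0 x - g x)%E).
    by apply: emeasurable_funB => //; exact: measurable_cst.
  by apply/funext => x; rewrite /= sub0e.
have e0 (x : T) : D x -> (0 <= limn_einf (fun k => (f_ k x)%:E))%E.
  move=> Dx; rewrite limn_einf_lim; apply: lime_ge; first exact: is_cvg_einfs.
  by apply: nearW => k; apply: le_ereal_inf_tmp => _ [j _ <-]; exact: E0.
apply: (@le_trans _ _ (\int[mu]_(x in D) limn_einf (fun k => (f_ k x)%:E))%E).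
  apply: ae_ge0_le_integral => //.
  - exact/measurable_EFinP.
  - rewrite (_ : (fun x => _) = fun x => (- limn_esup (fun k => - (f_ k x)%:E))%E).
      by apply: (mN _); apply: measurable_fun_limn_esup => k; exact: mN (mE k).
    by apply/funext => x; rewrite -limn_einfN; congr limn_einf; apply/funext => k; exact/esym/oppeK.
  apply: filterS cv => x h Dx.
  have /cvg_limn_einf_sup[-> _] : (f_ k x)%:E @[k --> \oo] --> (f x)%:E.
    by apply: cvg_EFin; [exact: nearW|exact: h].
  by [].
apply: le_trans (fatou mu mD mE E0) _.
rewrite limn_einf_lim; apply: lime_le; first exact: is_cvg_einfs.
by apply: nearW => k; apply: le_trans (fc k); apply: ereal_inf_lbound; exists k => /=.
Qed.

(** The Riesz-Fischer argument: the sum of the absolute increments has finite integral, hence is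
    finite almost everywhere, and there the telescoping series converges. Multiplication by the
    indicator of that set makes the sequence converge at every point, which gives the measurability
    of the limit. *)
Lemma fast_cvg_ae (f_ : nat -> T -> R) (K : R) : 0 <= K ->
  (forall k, measurable_fun D (f_ k)) ->
  (forall k, \int[mu]_(x in D) `|f_ k x - f_ k.+1 x|%:E <= (K * 2^-1 ^+ k)%:E)%E ->
  exists2 f : T -> R, measurable_fun D f &
    {ae mu, forall x, D x -> f_ k x @[k --> \oo] --> f x}.
Proof.
move=> K0 mf H.
pose g k x : \bar R := `|f_ k x - f_ k.+1 x|%:E.
have mg k : measurable_fun D (g k).
  by apply/measurable_EFinP; apply: measurable_normr_fun => //; exact: measurable_funB.
have g0 k x : D x -> (0 <= g k x)%E by rewrite lee_fin.
pose S x : \bar R := (\sum_(0 <= k <oo) g k x)%E.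
have mS : measurable_fun D S.
  by apply: ge0_emeasurable_sum => // k x Dx _; exact: g0.
have S0 x : (0 <= S x)%E by apply: nneseries_ge0 => k _ _; rewrite lee_fin.
have Sfin : (\int[mu]_(x in D) S x < +oo)%E.
  rewrite integral_nneseries//.
  apply: (@le_lt_trans _ _ (K * 2)%:E); last exact: ltry.
  apply: lime_le.
    by apply: is_cvg_nneseries => k _ _; apply: integral_ge0 => x; exact: g0.
  apply: nearW => m; apply: (@le_trans _ _ (\sum_(0 <= k < m) (K * 2^-1 ^+ k)%:E)%E).
    by apply: lee_sum => k _; exact: H.
  rewrite sumEFin lee_fin.
  have h : `|2^-1 : R| < 1 by rewrite ger0_norm// invf_lt1// ltr1n.
  have := geometric_le_lim m K0 (_ : 0 < 2^-1 :> R) h.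
  rewrite invr_gt0 ltr0n => /(_ isT); rewrite (_ : 1 - 2^-1 = 2^-1 :> R) ?invrK//; lra.
have iS : mu.-integrable D S.
  apply/integrableP; split => //.
  by under eq_integral do rewrite gee0_abs//.
pose A := D `&` [set x | (S x < +oo)%E].
have mA : measurable A
  by exact: (measurable_lte mD mS (@measurable_cst _ _ _ _ D (+oo%E : \bar R))).
have cvA x : A x -> cvgn (fun k => f_ k x).
  move=> [Dx Sx].
  have uE : (fun k => f_ k x) = (fun m => f_ 0%N x + series (telescope (fun k => f_ k x)) m).
    by apply/funext => m; exact: eq_sum_telescope (fun k => f_ k x) m.
  rewrite uE; apply: is_cvgD; first exact: is_cvg_cst.
  apply: normed_cvg; apply: nondecreasing_is_cvgn.
    apply: nondecreasing_series => k _ _; exact: normr_ge0.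
  exists (fine (S x)) => _ [m _ <-]; rewrite -lee_fin fineK ?ge0_fin_numE//.
  apply: le_trans (nneseries_lim_ge m _); last by move=> k _ _; rewrite lee_fin.
  rewrite /series/= -sumEFin; apply: lee_sum => k _.
  by rewrite /g lee_fin distrC.
pose f x := limn (fun k => f_ k x * \1_A x).
have cf x : f_ k x * \1_A x @[k --> \oo] --> f x.
  suff : cvgn (fun k => f_ k x * \1_A x) by [].
  rewrite indicE; have [xA|xA] := boolP (x \in A).
    by apply: is_cvgM; [apply: cvA; exact: set_mem|exact: is_cvg_cst].
  by under eq_fun do rewrite mulr0; exact: is_cvg_cst.
exists f.
  apply: (@measurable_fun_cvg _ _ _ _ (fun k x => f_ k x * \1_A x)) => //.
  by move=> k; apply: measurable_funM => //; exact: measurable_indic.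
apply: filterS (integrable_ae mD iS) => x h Dx.
have Ax : A x by split => //=; rewrite -ge0_fin_numE//; exact: h.
have := cf x; rewrite indicE mem_set//.
by under eq_fun do rewrite mulr1.
Qed.

(** Fatou's lemma in [j] for the distance of the terms of index [k] and [k + j]. The induction
    carries the exact partial sum of the geometric series. *)
Lemma fast_cvg_dist (f_ : nat -> T -> R) (f : T -> R) (K : R) : 0 <= K ->
  (forall k, measurable_fun D (f_ k)) -> measurable_fun D f ->
  (forall k, \int[mu]_(x in D) `|f_ k x - f_ k.+1 x|%:E <= (K * 2^-1 ^+ k)%:E)%E ->
  {ae mu, forall x, D x -> f_ k x @[k --> \oo] --> f x} ->
  forall k, (\int[mu]_(x in D) `|f_ k x - f x|%:E <= (2 * K * 2^-1 ^+ k)%:E)%E.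
Proof.
move=> K0 mf_ mf H cv k.
have mn (g h : T -> R) : measurable_fun D g -> measurable_fun D h ->
  measurable_fun D (fun x => `|g x - h x|).
  by move=> mg mh; apply: measurable_normr_fun => //; exact: measurable_funB.
apply: (@fatou_ae_le (fun j x => `|f_ k x - f_ (k + j)%N x|)) => //; try by move=> *; exact: mn.
  apply: filterS cv => x h Dx; apply: cvg_norm; apply: cvgB; first exact: cvg_cst.
  have -> : (fun j => f_ (k + j)%N x) = (fun j => f_ (j + k)%N x).
    by apply/funext => j; rewrite addnC.
  by have := h Dx; rewrite -(cvg_shiftn k (fun j => f_ j x)).
move=> j; apply: (@le_trans _ _ (2 * K * (2^-1 ^+ k - 2^-1 ^+ (k + j)))%:E); last first.
  by rewrite lee_fin ler_wpM2l ?mulr_ge0// lerBlDr lerDl exprn_ge0.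
elim: j => [|j IH].
  rewrite addn0 subrr mulr0; under eq_integral do rewrite subrr normr0.
  by rewrite integral0.
apply: (@le_trans _ _ (\int[mu]_(x in D) (`|f_ k x - f_ (k + j)%N x| +
    `|f_ (k + j)%N x - f_ (k + j).+1 x|)%:E)%E).
  apply: le_int => //.
  - exact: mn.
  - by apply: measurable_funD; exact: mn.
  - by move=> x _; rewrite addnS; exact: ler_distD.
rewrite intD//; try by exact: mn.
apply: le_trans (leeD IH (H (k + j)%N)) _; rewrite -EFinD lee_fin addnS exprS.
set y := 2^-1 ^+ (k + j); set z := 2^-1 ^+ k; rewrite le_eqVlt; apply/orP; left; apply/eqP.
by field.
Qed.

(** Comparison through positive and negative parts, for functions of any sign and without
    integrability; it serves where [plap_form] is only known to be measurable. *)
Lemma integral_le (f g : T -> R) : measurable_fun D f -> measurable_fun D g ->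
  {ae mu, forall x, D x -> f x <= g x} ->
  (\int[mu]_(x in D) (f x)%:E <= \int[mu]_(x in D) (g x)%:E)%E.
Proof.
move=> mf mg fg; rewrite integralE [leRHS]integralE.
have mEf : measurable_fun D (EFin \o f) by exact/measurable_EFinP.
have mEg : measurable_fun D (EFin \o g) by exact/measurable_EFinP.
apply: leeB; apply: ae_ge0_le_integral => //.
- exact: measurable_funepos.
- exact: measurable_funepos.
- apply: filterS fg => x h Dx; rewrite !funeposE.
  by rewrite ge_max !le_max lexx orbT andbT lee_fin h.
- exact: measurable_funeneg.
- exact: measurable_funeneg.
- apply: filterS fg => x h Dx; rewrite !funenegE.
  by rewrite ge_max !le_max lexx orbT andbT -!EFinN lee_fin lerN2 h.
Qed.

End sequences_of_functions.

(** * Energies of vector fields *)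

Section energy.
Context {R : realType} {n : nat}.
Variables (Om : set 'rV[R]_n) (p : 'rV[R]_n -> R).
Hypothesis oOm : open Om.
Hypothesis bOm : bounded_set Om.
Hypothesis mp : measurable_fun Om p.
Hypothesis p1 : forall x, Om x -> 1 < p x.
Local Notation mu := (@lebesgue_rV R n).
Local Notation fn := ('rV[R]_n -> R).
Local Notation vf := ('rV[R]_n -> 'rV[R]_n).
Implicit Types (u v w : fn) (G H : vf).

Let mOm : measurable Om := open_measurable_rV oOm.

Let p_gt0 x : Om x -> 0 < p x.
Proof. by move=> /p1; exact: lt_trans. Qed.

Definition measurable_vf G := forall i, measurable_fun Om (fun x => G x ord0 i).

(** Defined on vector fields because gradients of combinations agree with combinations of gradients
    only almost everywhere, and because limits of gradients are handled before they are known to be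
    gradients. *)
Definition energy G : \bar R := (\int[mu]_(x in Om) (enorm (G x) `^ p x / p x)%:E)%E.

Lemma measurable_vfD G H : measurable_vf G -> measurable_vf H -> measurable_vf (fun x => G x + H x).
Proof. by move=> mG mH i; under eq_fun do rewrite mxE; exact: measurable_funD. Qed.

Lemma measurable_vfZ (c : R) G : measurable_vf G -> measurable_vf (fun x => c *: G x).
Proof. by move=> mG i; under eq_fun do rewrite mxE; exact: measurable_funM. Qed.

Lemma measurable_vfB G H : measurable_vf G -> measurable_vf H -> measurable_vf (fun x => G x - H x).
Proof.
move=> mG mH; rewrite (_ : (fun x => _) = fun x => G x + (-1) *: H x).
  by apply: measurable_vfD => //; exact: measurable_vfZ.
by apply/funext => x; rewrite scaleN1r.
Qed.

Lemma measurable_energy G : measurable_vf G ->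
  measurable_fun Om (fun x => enorm (G x) `^ p x / p x).
Proof.
move=> mG; have := measurable_modular oOm mp p1 (measurable_enorm mOm mG).
apply: eq_measurable_fun => x xO; by rewrite ger0_norm ?enorm_ge0.
Qed.

Lemma energy_integrand_ge0 G x : Om x -> 0 <= enorm (G x) `^ p x / p x.
Proof. by move=> Ox; rewrite divr_ge0 ?powR_ge0// ltW// p_gt0. Qed.

Lemma energy_ge0 G : (0 <= energy G)%E.
Proof. by apply: integral_ge0 => x Ox; rewrite lee_fin energy_integrand_ge0. Qed.

Lemma energy_fin G : (energy G < +oo)%E -> energy G \is a fin_num.
Proof. by move=> h; rewrite ge0_fin_numE// energy_ge0. Qed.

Lemma energy_ae G H : measurable_vf G -> measurable_vf H ->
  {ae mu, forall x, Om x -> G x = H x} -> energy G = energy H.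
Proof.
move=> mG mH GH; apply: ae_eq_int => //; try exact: measurable_energy.
by apply: filterS GH => x h Ox; rewrite h.
Qed.

Lemma energy_integrable G : measurable_vf G -> (energy G < +oo)%E ->
  mu.-integrable Om (EFin \o (fun x => enorm (G x) `^ p x / p x)).
Proof.
by move=> mG fG; apply: ge0_integrable => //;
  [exact: measurable_energy|exact: energy_integrand_ge0].
Qed.

Lemma energy_midpoint G H : measurable_vf G -> measurable_vf H ->
  (energy G < +oo)%E -> (energy H < +oo)%E ->
  (energy (fun x => 2^-1 *: (G x + H x)) <= ((fine (energy G) + fine (energy H)) / 2)%:E)%E.
Proof.
move=> mG mH fG fH.
have -> : (((fine (energy G) + fine (energy H)) / 2)%:E =
    \int[mu]_(x in Om) (2^-1 * (enorm (G x) `^ p x / p x + enorm (H x) `^ p x / p x))%:E)%E.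
  have m1 := measurable_energy mG; have m2 := measurable_energy mH.
  have g1 := energy_integrand_ge0 G; have g2 := energy_integrand_ge0 H.
  have g12 x : Om x -> 0 <= enorm (G x) `^ p x / p x + enorm (H x) `^ p x / p x.
    by move=> Ox; rewrite addr_ge0 ?g1 ?g2.
  rewrite (intZ mu mOm _ (measurable_funD m1 m2) g12) ?invr_ge0//.
  rewrite (intD mu mOm m1 m2 g1 g2) -/(energy G) -/(energy H).
  by rewrite -{2}(fineK (energy_fin fG)) -{2}(fineK (energy_fin fH)) -EFinD -EFinM mulrC.
apply: le_int => //.
- by apply: measurable_energy; apply: measurable_vfZ; exact: measurable_vfD.
- by apply: measurable_funM => //; apply: measurable_funD; exact: measurable_energy.
- exact: energy_integrand_ge0.
- move=> x Ox; have := enorm_midpoint_convex (G x) (H x) (p1 Ox).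
  rewrite -mulrDl mulrA ler_pM2r ?invr_gt0 ?p_gt0// => /le_trans; apply.
  by rewrite mulrC.
Qed.

Lemma energy_unif_convex (r e : R) : 1 < r -> 0 < e ->
  (forall x, Om x -> r <= p x) -> (forall x, Om x -> 2 <= p x \/ n = 1%N) ->
  exists2 C : R, 0 <= C & forall G H, measurable_vf G -> measurable_vf H ->
    (energy G < +oo)%E -> (energy H < +oo)%E ->
    (energy (fun x => 2^-1 *: (G x - H x)) <= (C * ((fine (energy G) + fine (energy H)) / 2 -
      fine (energy (fun x => 2^-1 *: (G x + H x)))) +
      e * ((fine (energy G) + fine (energy H)) / 2))%:E)%E.
Proof.
move=> r1 e0 rp p2; have [C C0 hC] := unif_convex n r1 e0.
exists C => // G H mG mH fG fH.
pose I (F : vf) x := enorm (F x) `^ p x / p x.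
pose M x := 2^-1 *: (G x + H x).
have mM : measurable_vf M by apply: measurable_vfZ; exact: measurable_vfD.
have fM : (energy M < +oo)%E.
  by apply: le_lt_trans (energy_midpoint mG mH fG fH) (ltry _).
have mD : measurable_vf (fun x => 2^-1 *: (G x - H x)).
  by apply: measurable_vfZ; exact: measurable_vfB.
have iG := energy_integrable mG fG; have iH := energy_integrable mH fH.
have iM := energy_integrable mM fM.
have E (F : vf) : (energy F < +oo)%E -> \int[mu]_(x in Om) I F x = fine (energy F) by [].
have iGH : mu.-integrable Om (EFin \o (fun x => I G x + I H x)) := integrableD_real mOm iG iH.
have iS : mu.-integrable Om (EFin \o (fun x => 2^-1 * (I G x + I H x))) :=
  integrableZ_real mOm _ iGH.
have iSM : mu.-integrable Om (EFin \o (fun x => 2^-1 * (I G x + I H x) - I M x)).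
  exact: (integrableB mOm iS iM).
have iB : mu.-integrable Om (EFin \o (fun x => C * (2^-1 * (I G x + I H x) - I M x))) :=
  integrableZ_real mOm _ iSM.
have iE : mu.-integrable Om (EFin \o (fun x => e * (2^-1 * (I G x + I H x)))) :=
  integrableZ_real mOm _ iS.
have ES : \int[mu]_(x in Om) (2^-1 * (I G x + I H x)) = (fine (energy G) + fine (energy H)) / 2.
  by rewrite (RintegralZl _ mOm iGH) (RintegralD mOm iG iH) mulrC.
have iT := integrableD_real mOm iB iE.
rewrite -/M -ES -(E M fM) -(RintegralB mOm iS iM) -(RintegralZl _ mOm iSM).
rewrite -(RintegralZl _ mOm iS) -(RintegralD mOm iB iE) /Rintegral fineK;
  last exact: integrable_fin_num iT.
apply: le_int.
- exact: mOm.
- exact: measurable_energy.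
- exact: integrable_measurable iT.
- exact: energy_integrand_ge0.
- move=> x Ox; have := hC (p x) (G x) (H x) (rp x Ox) (p2 x Ox).
  rewrite /I -/(M x); set a := enorm (G x) `^ _; set b := enorm (H x) `^ _.
  set m := enorm (M x) `^ _; set D := enorm _ `^ _ => h.
  have -> : C * (2^-1 * (a / p x + b / p x) - m / p x) + e * (2^-1 * (a / p x + b / p x)) =
    (C * ((a + b) / 2 - m) + e * ((a + b) / 2)) / p x by ring.
  by rewrite ler_pM2r// invr_gt0 p_gt0.
Qed.

End energy.

Section vector_limits.
Context {R : realType} {n : nat}.

Lemma cvg_half_pow (K : R) : K * 2^-1 ^+ k @[k --> \oo] --> (0 : R).
Proof. by apply: (@cvg_geometric R K 2^-1); rewrite ger0_norm// invf_lt1// ltr1n. Qed.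

Lemma cvg_bigsum (I : Type) (s : seq I) (u : I -> R ^nat) (l : I -> R) :
  (forall i, u i k @[k --> \oo] --> l i) ->
  \sum_(i <- s) u i k @[k --> \oo] --> \sum_(i <- s) l i.
Proof.
move=> H; elim: s => [|i s IH].
  by under eq_fun do rewrite big_nil; rewrite big_nil; exact: cvg_cst.
by under eq_fun do rewrite big_cons; rewrite big_cons; apply: cvgD.
Qed.

Lemma cvg_dotv (u v : nat -> 'rV[R]_n) (a b : 'rV[R]_n) :
  (forall i, u k ord0 i @[k --> \oo] --> a ord0 i) ->
  (forall i, v k ord0 i @[k --> \oo] --> b ord0 i) ->
  dotv (u k) (v k) @[k --> \oo] --> dotv a b.
Proof.
move=> ua vb; apply: (@cvg_bigsum _ _ (fun i k => u k ord0 i * v k ord0 i)) => i.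
exact: cvgM.
Qed.

Lemma cvg_enorm_powR (u : nat -> 'rV[R]_n) (a : 'rV[R]_n) (r : R) : 0 < r ->
  (forall i, u k ord0 i @[k --> \oo] --> a ord0 i) ->
  enorm (u k) `^ r @[k --> \oo] --> enorm a `^ r.
Proof.
move=> r0 ua; rewrite powR_enorm; under eq_fun do rewrite powR_enorm.
apply: cvg_powR; first by rewrite divr_gt0.
  by move=> k; exact: dotv_ge0.
exact: cvg_dotv.
Qed.

End vector_limits.

Section L1_limits.
Context d {T : measurableType d} {R : realType} (mu : {measure set T -> \bar R}).
Variables (D : set T) (mD : measurable D).

Lemma integral_mul_cvg (f_ : nat -> T -> R) (f g : T -> R) (K B : R) :
  (forall k, mu.-integrable D (EFin \o f_ k)) -> mu.-integrable D (EFin \o f) ->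
  measurable_fun D g -> 0 <= B -> (forall x, D x -> `|g x| <= B) ->
  (forall k, \int[mu]_(x in D) `|f_ k x - f x|%:E <= (K * 2^-1 ^+ k)%:E)%E ->
  (\int[mu]_(x in D) (f_ k x * g x)) @[k --> \oo] --> \int[mu]_(x in D) (f x * g x).
Proof.
move=> if_ if0 mg B0 gB H.
have im h : mu.-integrable D (EFin \o h) -> mu.-integrable D (EFin \o (fun x => h x * g x)).
  move=> ih; have mh := integrable_measurable ih.
  apply: (@le_integrable_real _ _ _ mu D mD _ (fun x => B * `|h x|)).
  - exact: measurable_funM.
  - apply: integrableZ_real => //; exact: integrable_norm.
  - by move=> x Dx; rewrite normrM mulrC ler_wpM2r// gB.
apply/cvgrPdist_le => e e0.
have := cvg_half_pow (B * K); move/cvgr0Pnorm_le => /(_ e e0); apply: filterS => k hk.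
rewrite distrC; apply: le_trans (_ : B * (K * 2^-1 ^+ k) <= e); last first.
  by rewrite mulrA (le_trans (ler_norm _)).
have id : mu.-integrable D (EFin \o (fun x => f_ k x - f x)) by exact: (integrableB mD (if_ k) if0).
rewrite -(RintegralB mD (im _ (if_ k)) (im _ if0)).
have E : \int[mu]_(x in D) (f_ k x * g x - f x * g x) = \int[mu]_(x in D) ((f_ k x - f x) * g x).
  by apply: eq_Rintegral => x _; rewrite mulrBl.
rewrite E; apply: (le_trans (le_normr_Rintegral mD (im _ id))).
have ian := integrable_norm (im _ id).
rewrite -lee_fin /Rintegral fineK; last exact: integrable_fin_num ian.
have md := integrable_measurable id.
apply: (@le_trans _ _ (\int[mu]_(x in D) (B * `|f_ k x - f x|)%:E)%E).
  apply: le_int.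
  - exact: mD.
  - exact: integrable_measurable ian.
  - by apply: measurable_funM => //; exact: measurable_normr_fun.
  - by move=> x _; exact: normr_ge0.
  - by move=> x Dx; rewrite normrM mulrC ler_wpM2r// gB.
rewrite (intZ mu mD B0)//; last exact: measurable_normr_fun.
by rewrite EFinM lee_wpmul2l ?lee_fin.
Qed.

End L1_limits.

(** * Completeness of [U1p_0] under control of half differences *)

Section completeness.
Context {R : realType} {n : nat}.
Variables (Om : set 'rV[R]_n) (p : 'rV[R]_n -> R) (q : R).
Hypothesis n0 : (0 < n)%N.
Hypothesis oOm : open Om.
Hypothesis bOm : bounded_set Om.
Hypothesis mp : measurable_fun Om p.
Hypothesis p1 : forall x, Om x -> 1 < p x.
Hypothesis q1 : 1 <= q.
Hypothesis nq : n%:R < q.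
Hypothesis qp : forall x, Om x -> q <= p x.
Local Notation mu := (@lebesgue_rV R n).
Local Notation fn := ('rV[R]_n -> R).
Local Notation vf := ('rV[R]_n -> 'rV[R]_n).

Let mOm : measurable Om := open_measurable_rV oOm.

Lemma W1p_measurable_vf (f : fn) : W1p Om p f -> measurable_vf Om (wgrad Om f).
Proof. by move=> fW i; exact: measurable_wgrad fW. Qed.

Lemma coord_modular_le_energy (G : vf) i : measurable_vf Om G ->
  (\int[mu]_(x in Om) (`|G x ord0 i| `^ p x / p x)%:E <= energy Om p G)%E.
Proof.
move=> mG; apply: le_int => //.
- by apply: measurable_modular => //; exact: mG.
- exact: measurable_energy.
- by move=> x Ox; exact: (modular_ge0 p1 (fun x => G x ord0 i) Ox).
- move=> x Ox; have p0 : 0 < p x by exact: lt_trans ltr01 (p1 Ox).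
  by rewrite ler_pM2r ?invr_gt0//; apply: le_powRn => //; exact: enorm_coord.
Qed.

Lemma small_energy_power (s e : R) : 1 <= s -> (forall x, Om x -> s <= p x) -> 0 < e ->
  exists2 de : R, 0 < de & forall G, measurable_vf Om G -> (energy Om p G <= de%:E)%E ->
    forall i, (\int[mu]_(x in Om) (`|G x ord0 i| `^ s)%:E <= e%:E)%E.
Proof.
move=> s1 sp e0; have e20 : 0 < e / 2 by rewrite divr_gt0.
have [C C0 hC] := modular_power_bound oOm bOm mp p1 s1 sp e20.
have C1 : 0 < C + 1 by rewrite ltr_wpDl.
exists (e / 2 / (C + 1)); first by rewrite divr_gt0.
move=> G mG hG i; apply: (le_trans (hC _ (mG i))).
apply: (@le_trans _ _ ((e / 2)%:E + C%:E * (e / 2 / (C + 1))%:E)%E).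
  apply: leeD => //; apply: lee_wpmul2l; first by rewrite lee_fin.
  exact: le_trans (coord_modular_le_energy i mG) hG.
rewrite -EFinM -EFinD lee_fin [leRHS](_ : _ = e / 2 + e / 2); last by field.
by rewrite lerD2l mulrA ler_pdivrMr// mulrC ler_wpM2l ?(ltW e20)// lerDl.
Qed.

(** Takes the place of a Poincare inequality. [morrey] is applied with bound e/(M+1) on the L^q
    norms of the derivatives, which small energy ensures. *)
Lemma small_energy_bounded (e : R) : 0 < e -> exists2 de : R, 0 < de &
  forall w, U1p_0 Om p w -> (energy Om p (wgrad Om w) <= de%:E)%E ->
  {ae mu, forall x, Om x -> `|w x| <= e}.
Proof.
move=> e0; have [M M0 hM] := morrey n0 oOm bOm mp p1 q1 nq.
have M1 : 0 < M + 1 by rewrite ltr_wpDl.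
have sg0 : 0 < e / (M + 1) by rewrite divr_gt0.
have [de de0 hde] := small_energy_power q1 qp (powR_gt0 q sg0).
exists de => // w wU wde; have wW := U1p_0_W1p wU.
have zw := U1p_0_zero_extension oOm bOm mp p1 n0 wU.
have h i : (\int[mu]_(y in Om) (`|wpartial Om i w y| `^ q)%:E <= ((e / (M + 1)) `^ q)%:E)%E.
  have := hde _ (W1p_measurable_vf wW) wde i.
  by under eq_integral do rewrite mxE.
have := hM w _ zw sg0 h; apply: filterS => x hx Ox.
apply: (le_trans (hx Ox)); by rewrite mulrA ler_pdivrMr// mulrC ler_wpM2l ?(ltW e0)// lerDl.
Qed.

Lemma powR_le_id (t r : R) : 0 <= t <= 1 -> 1 <= r -> t `^ r <= t.
Proof.
move=> /andP[]; rewrite le_eqVlt => /predU1P[<- _ r1|t0 t1 r1].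
  by rewrite powR0// gt_eqF// (lt_le_trans ltr01).
by apply: ge1r_powR => //; rewrite t0.
Qed.

(* [U1p_0] is only known to be closed under limits for which
   [rho1 (f_ k \- f)] tends to [0]; the scaling by [2^-1] keeps all modulars
   finite, and [v] is recovered as [2^-1 v + 2^-1 v]. *)
Lemma U1p_0_complete (v_ : nat -> fn) : (forall k, U1p_0 Om p (v_ k)) ->
  (forall j k, (j <= k)%N ->
    (energy Om p (fun x => 2^-1 *: (wgrad Om (v_ j) x - wgrad Om (v_ k) x)) <= (2^-1 ^+ j)%:E)%E) ->
  (forall j k, (j <= k)%N -> {ae mu, forall x, Om x -> `|v_ j x - v_ k x| <= 2^-1 ^+ j}) ->
  (forall j k i, (j <= k)%N ->
    (\int[mu]_(x in Om) `|wpartial Om i (v_ j) x - wpartial Om i (v_ k) x|%:E <=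
      (2^-1 ^+ j)%:E)%E) ->
  exists2 v, U1p_0 Om p v & {ae mu, forall x, Om x -> forall i,
    wgrad Om (v_ k) x ord0 i @[k --> \oo] --> wgrad Om v x ord0 i}.
Proof.
move=> vU He Hs Hg.
have vW k : W1p Om p (v_ k) := U1p_0_W1p (vU k).
have mv_ k : measurable_fun Om (v_ k) := W1p_measurable (vW k).
have mg_ k i : measurable_fun Om (wpartial Om i (v_ k)) := W1p_wpartial_measurable i (vW k).
have h0 k : 0 <= 2^-1 ^+ k :> R by rewrite exprn_ge0.
have muf := Om_fin oOm bOm.
have mufn : mu Om \is a fin_num by rewrite ge0_fin_numE.
pose A := fine (mu Om); have A0 : 0 <= A by exact: fine_ge0.
have intc k : (\int[mu]_(x in Om) (2^-1 ^+ k)%:E = (A * 2^-1 ^+ k)%:E)%E.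
  transitivity ((2^-1 ^+ k)%:E * mu Om)%E; first exact: integral_cst.
  by rewrite -(fineK mufn) -EFinM mulrC.
have HA k : (\int[mu]_(x in Om) `|v_ k x - v_ k.+1 x|%:E <= (A * 2^-1 ^+ k)%:E)%E.
  apply: (@le_trans _ _ (\int[mu]_(x in Om) (2^-1 ^+ k)%:E)%E).
    apply: le_int_ae => //.
    - by apply: measurable_normr_fun => //; exact: measurable_funB.
    - exact: (Hs k k.+1 (leqnSn k)).
  by rewrite intc.
have [v mv cv] := fast_cvg_ae mOm A0 mv_ HA.
have dv := fast_cvg_dist mOm A0 mv_ mv HA cv.
have HG i k : (\int[mu]_(x in Om) `|wpartial Om i (v_ k) x - wpartial Om i (v_ k.+1) x|%:E <=
    (1 * 2^-1 ^+ k)%:E)%E by rewrite mul1r; exact: Hg.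
have /choice[h hh] i : exists h : fn, measurable_fun Om h /\
    {ae mu, forall x, Om x -> wpartial Om i (v_ k) x @[k --> \oo] --> h x}.
  have [h mh ch] := fast_cvg_ae mOm ler01 (fun k => mg_ k i) (HG i).
  by exists h.
have dh i := fast_cvg_dist mOm ler01 (fun k => mg_ k i) (hh i).1 (HG i) (hh i).2.
have ivk k : mu.-integrable Om (EFin \o v_ k) := W1p_integrable oOm bOm mp p1 (vW k).
have igk k i : mu.-integrable Om (EFin \o wpartial Om i (v_ k)) :=
  W1p_wpartial_integrable oOm bOm mp p1 i (vW k).
have close_int (f g : fn) (c : R) : measurable_fun Om g -> mu.-integrable Om (EFin \o f) ->
    (\int[mu]_(x in Om) `|f x - g x|%:E <= c%:E)%E -> mu.-integrable Om (EFin \o g).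
  move=> mg fi fg; have mf := integrable_measurable fi.
  have di : mu.-integrable Om (EFin \o (fun x => f x - g x)).
    apply/integrableP; split; first by apply/measurable_EFinP; exact: measurable_funB.
    exact: le_lt_trans fg (ltry _).
  have := integrableB mOm fi di; apply: eq_integrable => // x _.
  by rewrite /= -EFinB opprB addrC subrK.
have iv := close_int _ _ _ mv (ivk 0%N) (dv 0%N).
have ih i := close_int _ _ _ (hh i).1 (igk 0%N i) (dh i 0%N).
have wv i : is_wpartial Om i v (h i).
  split; [exact: integrable_L1loc|exact: integrable_L1loc|] => psi tpsi.
  have [Cpsi _] := tpsi.
  have cpsi := Coo_continuous Cpsi; have cdpsi := Coo_continuous (Coo_partial i Cpsi).
  have [M1 M10 hM1] := bounded_on_Om bOm cpsi.
  have [M2 M20 hM2] := bounded_on_Om bOm cdpsi.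
  have mpsi := continuous_measurable oOm cpsi.
  have mdpsi := continuous_measurable oOm cdpsi.
  have c1 := integral_mul_cvg mOm ivk iv mdpsi M20 hM2 dv.
  have c2 := integral_mul_cvg mOm (fun k => igk k i) (ih i) mpsi M10 hM1 (dh i).
  have i1 := integrable_mul_bounded oOm iv mdpsi hM2.
  have i2 := integrable_mul_bounded oOm (ih i) mpsi hM1.
  rewrite -(fineK (integrable_fin_num mOm i1)) -(fineK (integrable_fin_num mOm i2)) -EFinN.
  congr EFin; apply: (cvg_unique _ c1) => //.
  rewrite (_ : (fun k => _) = fun k => - \int[mu]_(x in Om) (wpartial Om i (v_ k) x * psi x)).
    exact: cvgN c2.
  apply/funext => k; have [_ _ H] := W1p_is_wpartial i (vW k).
  rewrite /Rintegral H//.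
  by rewrite fineN.
have vlim j : {ae mu, forall x, Om x -> `|v_ j x - v x| <= 2^-1 ^+ j}.
  have H1 : {ae mu, forall x, forall k, Om x -> `|v_ j x - v_ (k + j)%N x| <= 2^-1 ^+ j}.
    by apply: ae_foralln => k; apply: Hs; exact: leq_addl.
  apply: filterS (ae_conj H1 cv) => x [h1 h2] Ox.
  have c : `|v_ j x - v_ (k + j)%N x| @[k --> \oo] --> `|v_ j x - v x|.
    apply: cvg_norm; apply: cvgB; first exact: cvg_cst.
    by have := h2 Ox; rewrite -(cvg_shiftn j (fun k => v_ k x)).
  rewrite -(cvg_lim _ c)//; apply: limr_le; first by apply/cvg_ex; exists `|v_ j x - v x|.
  by apply: nearW => k; exact: h1.
pose H x : 'rV[R]_n := \row_i h i x.
have mH : measurable_vf Om H by move=> i; under eq_fun do rewrite mxE; exact: (hh i).1.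
have mgv k := W1p_measurable_vf (vW k).
have mdH k : measurable_vf Om (fun x => 2^-1 *: (wgrad Om (v_ k) x - H x)).
  by apply: measurable_vfZ; apply: measurable_vfB.
have cH : {ae mu, forall x, Om x -> forall i, wgrad Om (v_ k) x ord0 i @[k --> \oo] --> H x ord0 i}.
  have H1 : {ae mu, forall x, forall i, Om x -> wpartial Om i (v_ k) x @[k --> \oo] --> h i x}.
    by apply: ae_forall_fin => i; exact: (hh i).2.
  apply: filterS H1 => x hx Ox i; rewrite mxE; under eq_fun do rewrite mxE; exact: hx.
have eH j : (energy Om p (fun x => 2^-1 *: (wgrad Om (v_ j) x - H x)) <= (2^-1 ^+ j)%:E)%E.
  apply: (fatou_ae_le mOm (f_ := fun k x =>
    enorm (2^-1 *: (wgrad Om (v_ j) x - wgrad Om (v_ (k + j)%N) x)) `^ p x / p x)).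
  - move=> k; apply: measurable_energy => //.
    by apply: measurable_vfZ; apply: measurable_vfB.
  - exact: measurable_energy.
  - by move=> k; exact: energy_integrand_ge0.
  - exact: energy_integrand_ge0.
  - apply: filterS cH => x hx Ox; apply: cvgM; last exact: cvg_cst.
    apply: cvg_enorm_powR; first exact: lt_trans ltr01 (p1 Ox).
    move=> i; rewrite !mxE; under eq_fun do rewrite !mxE.
    apply: cvgM; first exact: cvg_cst.
    apply: cvgB; first exact: cvg_cst.
    have := hx Ox i; rewrite mxE; under eq_fun do rewrite mxE.
    by rewrite -(cvg_shiftn j (fun k => wpartial Om i (v_ k) x)).
  - by move=> k; apply: He; exact: leq_addl.
(* [v] differs from [v_ 0] by a function bounded by 1, and half the difference of [h i] and the
   derivative of [v_ 0] has finite modular; so [v] and each [h i] are sums of two members of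
   [Lp]. *)
have Lv : Lp Om p v.
  have -> : v = fun x => v_ 0%N x + -1 * (v_ 0%N x - v x).
    by apply/funext => x; rewrite mulN1r opprB addrC subrK.
  apply: LpD => //; first by case: (vW 0%N).
  apply: LpZ => //; apply: (Lp_bounded oOm bOm mp p1 (M := 1)).
    exact: measurable_funB.
  exact: vlim 0%N.
have Lh i : Lp Om p (h i).
  have -> : h i = fun x => wpartial Om i (v_ 0%N) x +
    -2 * (2^-1 * (wpartial Om i (v_ 0%N) x - h i x)).
    by apply/funext => x; field.
  apply: (LpD oOm mp p1 (W1p_wpartial_Lp oOm mp p1 i (vW 0%N))).
  apply: (LpZ oOm mp p1); apply: (Lp_modular oOm mp p1).
    by apply: measurable_funM => //; apply: measurable_funB => //; exact: (hh i).1.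
  apply: le_lt_trans (ltry (2^-1 ^+ 0)); apply: le_trans (eH 0%N).
  apply: le_trans (coord_modular_le_energy i (mdH 0%N)).
  by under [leRHS]eq_integral do rewrite !mxE.
have Wv : W1p Om p v by exact: (W1pI Lv wv Lh).
have gv : {ae mu, forall x, Om x -> wgrad Om v x = H x} := wgrad_ae oOm wv.
exists v; last first.
  by apply: filterS (ae_conj gv cH) => x [h1 h2] Ox i; rewrite (h1 Ox); exact: h2.
have half : `|2^-1 : R| <= 1 by rewrite ger0_norm// invf_le1// ler1n.
suff hU : U1p_0 Om p (fun x => 2^-1 * v x).
  rewrite (_ : v = fun x => 2^-1 * v x + 2^-1 * v x); first exact: U1p_0D.
  by apply/funext => x; field.
apply: (@U1p_0_closed _ _ _ _ (fun k x => 2^-1 * v_ k x)).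
- by move=> k; exact: U1p_0Z.
- exact: W1pZ.
apply: (squeeze_cvge (f := fun=> 0%E) (h := fun k => ((A + 1) * 2^-1 ^+ k)%:E)).
- apply: nearW => k; apply/andP; split; first by rewrite adde_ge0// rho_ge0.
  rewrite mulrDl mul1r EFinD; apply: leeD.
    apply: (@le_trans _ _ (\int[mu]_(x in Om) (2^-1 ^+ k)%:E)%E); last first.
      by rewrite intc.
    have md : measurable_fun Om (fun x => 2^-1 * v_ k x - 2^-1 * v x).
      by apply: measurable_funB; exact: measurable_funM.
    apply: le_int_ae => //.
    + exact: measurable_modular.
    + by move=> x Ox; exact: (modular_ge0 p1 (fun x => 2^-1 * v_ k x - 2^-1 * v x) Ox).
    apply: filterS (vlim k) => x hx Ox; have px := p1 Ox; have p0 : 0 < p x by lra.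
    rewrite /= -mulrBr normrM (ger0_norm (_ : 0 <= 2^-1)) ?invr_ge0//.
    have t2 := hx Ox; have k1 : 2^-1 ^+ k <= 1 :> R by rewrite exprn_ile1// invf_le1// ler1n.
    have n0' := normr_ge0 (v_ k x - v x).
    (* Since [t <= 1] and [p > 1], t^p/p <= t whatever the size of [p]: here the uniform estimate
       becomes a modular one. *)
    set t := 2^-1 * `|_|; have t0 : 0 <= t by rewrite mulr_ge0.
    have tk : t <= 2^-1 ^+ k by rewrite /t; lra.
    apply: (@le_trans _ _ (t `^ p x)).
      by rewrite ler_pdivrMr// ler_peMr ?powR_ge0// ltW.
    apply: le_trans tk; apply: powR_le_id; last exact: ltW.
    by rewrite t0 (le_trans _ k1)// /t; lra.
  have Wd : W1p Om p (fun x => 2^-1 * v_ k x - 2^-1 * v x)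
    by exact: (W1pB oOm mp p1 (W1pZ oOm mp p1 2^-1 (vW k)) (W1pZ oOm mp p1 2^-1 Wv)).
  apply: le_trans (eH k); rewrite /rho.
  have -> : energy Om p (fun x => 2^-1 *: (wgrad Om (v_ k) x - H x)) =
      energy Om p (wgrad Om (fun x => 2^-1 * v_ k x - 2^-1 * v x)).
    apply: energy_ae => //; first exact: W1p_measurable_vf.
    have g1 := wgradB oOm mp p1 (W1pZ oOm mp p1 2^-1 (vW k)) (W1pZ oOm mp p1 2^-1 Wv).
    have g2 := ae_conj (wgradZ oOm 2^-1 (vW k)) (wgradZ oOm 2^-1 Wv).
    apply: filterS (ae_conj gv (ae_conj g1 g2)) => x [a1 [a2 [a3 a4]]] Ox.
    by rewrite (a2 Ox) (a3 Ox) (a4 Ox) (a1 Ox) scalerBr.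
  rewrite le_eqVlt; apply/orP; left; apply/eqP; apply: eq_integral => x _.
  by rewrite ger0_norm// enorm_ge0.
- exact: cvg_cst.
- by apply: cvg_EFin; [exact: nearW|exact: cvg_half_pow].
Qed.

End completeness.

Lemma powR_max_le {R : realType} (s t r : R) : Num.max s t `^ r <= s `^ r + t `^ r.
Proof. by rewrite maxEle; case: ifP => _; rewrite ?lerDl ?lerDr powR_ge0. Qed.

(** Here [d] is the infimum, [x] and [y] are energies near it, and [z] is the energy of the
    midpoint. The tolerance gives e/2 to the convexity gap; its cap at 1 keeps the mean energy below
    d + 1, so that the loss term is at most e/2 as well. *)
Lemma near_inf_bound {R : realType} (C d e x y z : R) : 0 <= C -> 0 < e -> 0 <= d ->
  x <= d + Num.min 1 (e / 2 / (C + 1)) -> y <= d + Num.min 1 (e / 2 / (C + 1)) -> d <= z ->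
  C * ((x + y) / 2 - z) + e / 2 / (d + 1) * ((x + y) / 2) <= e.
Proof.
move=> C0 e0 d0; set de := Num.min _ _ => hx hy hz.
have d1 : 0 < d + 1 by rewrite ltr_wpDl.
have C1 : 0 < C + 1 by rewrite ltr_wpDl.
have de0 : 0 < de by rewrite lt_min ltr01 !divr_gt0.
have de1 : de <= 1 by rewrite ge_min lexx.
have deC : de * (C + 1) <= e / 2 by rewrite -ler_pdivlMr// ge_min lexx orbT.
have t1 : C * ((x + y) / 2 - z) <= e / 2.
  apply: le_trans deC; apply: (@le_trans _ _ (C * de)); first by rewrite ler_wpM2l//; lra.
  by rewrite mulrC ler_wpM2l ?(ltW de0)// lerDl.
have t2 : e / 2 / (d + 1) * ((x + y) / 2) <= e / 2.
  by rewrite mulrAC ler_pdivrMr// ler_wpM2l ?divr_ge0 ?(ltW e0)//; lra.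
by lra.
Qed.

(** Makes tolerances monotone, so that a term chosen at index [k] also meets the tolerances of all
    earlier indices. *)
Lemma running_min {R : realType} (u : R ^nat) : (forall k, 0 < u k) ->
  exists2 m : R ^nat, (forall k, 0 < m k) & forall j k, (j <= k)%N -> m k <= u j.
Proof.
move=> u0; pose m := fix m k := if k is k'.+1 then Num.min (m k') (u k) else u 0%N.
exists m; first by elim=> [|k IH] /=; [exact: u0|rewrite lt_min IH u0].
move=> j; elim=> [|k IH]; first by rewrite leqn0 => /eqP ->.
by rewrite leq_eqVlt ltnS => /predU1P[->|/IH h] /=; rewrite ge_min ?lexx ?orbT ?h.
Qed.

(** * Minimizers *)

Section plap_limit.
Context {R : realType} {n : nat}.

(** Uses that the norm of the sum is at most twice the larger norm. [P] bounds the exponent where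
    the perturbation [b] does not vanish, and makes the factors 2^p affordable there; [lam] is a
    scale at which [b] has a finite integral. *)
Lemma perturb_bound (p P c lam : R) (a b : 'rV[R]_n) : 1 < p -> `|c| <= 1 -> 0 < lam ->
  1 <= 2 `^ P :> R -> 0 <= P -> p <= P \/ b = 0 ->
  enorm (a + c *: b) `^ p / p <=
  2 `^ P * (enorm a `^ p / p) + Num.max 1 (2 / lam) `^ P * `|lam * enorm b| `^ p.
Proof.
move=> p1 c1 l0 A1 P0; have p0 : 0 < p by lra.
have a0 : 0 <= enorm a `^ p / p by rewrite divr_ge0 ?powR_ge0// ltW.
case=> [pP|->]; last first.
  rewrite scaler0 addr0 (le_trans (ler_peMl a0 A1))// lerDl mulr_ge0 ?powR_ge0//.
rewrite (ger0_norm (_ : 0 <= lam * enorm b)); last by rewrite mulr_ge0 ?enorm_ge0// ltW.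
have h1 : enorm (a + c *: b) <= Num.max (2 * enorm a) (2 * enorm b).
  apply: (le_trans (ler_enormD _ _)); rewrite enormZ.
  have := ler_wpM2r (enorm_ge0 b) c1; rewrite mul1r => h.
  apply: (le_trans (lerD (lexx _) h)); case: (leP (enorm a) (enorm b)) => ab.
    by rewrite le_max; apply/orP; right; lra.
  by rewrite le_max; apply/orP; left; lra.
have h2 : enorm (a + c *: b) `^ p <= (2 * enorm a) `^ p + (2 * enorm b) `^ p.
  by apply: le_trans (powR_max_le _ _ _); apply: le_powRn => //; exact: enorm_ge0.
have M1 : 1 <= Num.max 1 (2 / lam) by rewrite le_max lexx.
have M2 : 2 / lam <= Num.max 1 (2 / lam) by rewrite le_max lexx orbT.
have h3 : (2 * enorm a) `^ p / p <= 2 `^ P * (enorm a `^ p / p).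
  by rewrite powRM ?enorm_ge0// -mulrA ler_wpM2r// ler_powR// ler1n.
have h4 : (2 * enorm b) `^ p <= Num.max 1 (2 / lam) `^ P * (lam * enorm b) `^ p.
  have -> : 2 * enorm b = 2 / lam * (lam * enorm b) by rewrite mulrA divfK// gt_eqF.
  have l20 : 0 <= 2 / lam by rewrite divr_ge0// ltW.
  have lb0 : 0 <= lam * enorm b by rewrite mulr_ge0 ?enorm_ge0// ltW.
  rewrite (powRM _ l20 lb0); apply: ler_wpM2r; first exact: powR_ge0.
  by apply: (le_trans (le_powRn p0 l20 M2)); exact: ler_powR.
have h5 : (2 * enorm b) `^ p / p <= (2 * enorm b) `^ p.
  by rewrite ler_pdivrMr// ler_peMr ?powR_ge0// ltW.
apply: (@le_trans _ _ (((2 * enorm a) `^ p + (2 * enorm b) `^ p) / p)).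
  by rewrite ler_pM2r ?invr_gt0.
by rewrite mulrDl; apply: lerD => //; exact: le_trans h5 h4.
Qed.

Lemma enorm_powR_convex (p t : R) (a b : 'rV[R]_n) : 1 < p -> 0 <= t <= 1 ->
  enorm (a + t *: (b - a)) `^ p <= (1 - t) * enorm a `^ p + t * enorm b `^ p.
Proof.
move=> p1 /andP[t0 t1]; have p0 : 0 < p by lra.
set w := a + _; have ha := plap_gradient_ineq w a p1; have hb := plap_gradient_ineq w b p1.
have wa : a - w = - t *: (b - a) by rewrite /w opprD addrA subrr add0r scaleNr.
have wb : b - w = (1 - t) *: (b - a) by rewrite /w opprD addrA scalerBl scale1r.
rewrite wa dotvZr in ha; rewrite wb dotvZr in hb.
move: (enorm w `^ p) (enorm a `^ p) (enorm b `^ p) (enorm w `^ (p - 2)) (dotv w (b - a)) ha hb.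
move=> W A B e D ha hb.
have h1 : (1 - t) * (W / p + e * (- t * D)) <= (1 - t) * (A / p) by rewrite ler_wpM2l// subr_ge0.
have h2 : t * (W / p + e * ((1 - t) * D)) <= t * (B / p) by rewrite ler_wpM2l.
have h3 := lerD h1 h2.
rewrite -(ler_pM2r (_ : 0 < p^-1)) ?invr_gt0//.
rewrite (_ : W / p = (1 - t) * (W / p + e * (- t * D)) + t * (W / p + e * ((1 - t) * D)));
  last by ring.
by rewrite (_ : ((1 - t) * A + t * B) / p = (1 - t) * (A / p) + t * (B / p)); last by ring.
Qed.

Lemma plap_gap (p : R) (a b : 'rV[R]_n) : 1 < p ->
  enorm a `^ p / p - enorm b `^ p / p <= enorm a `^ (p - 2) * dotv a (a - b).
Proof.
move=> p1; have := plap_gradient_ineq a b p1.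
rewrite -(opprB a b) dotvNr mulrN.
move: (enorm a `^ p / p) (enorm b `^ p / p) (enorm a `^ (p - 2) * dotv a (a - b)) => A B C.
by lra.
Qed.

(** The gradient inequalities at [a] and at the moving point enclose the quotient, and both bounds
    have the same limit. At [a = 0] the factor with exponent p - 2 may be singular, but the quotient
    is explicitly a multiple of t^(p-1) with [t] tending to 0. *)
Lemma cvg_plap_quotient (p : R) (a b : 'rV[R]_n) : 1 < p ->
  (enorm a `^ p - enorm (a + k.+1%:R^-1 *: (b - a)) `^ p) / p * k.+1%:R @[k --> \oo] -->
  enorm a `^ (p - 2) * dotv a (a - b).
Proof.
move=> p1; have p0 : 0 < p by lra.
have t0 k : 0 < k.+1%:R^-1 :> R by rewrite invr_gt0 ltr0n.
have k0 k : k.+1%:R != 0 :> R by rewrite pnatr_eq0.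
have tc : (k.+1%:R^-1 : R) @[k --> \oo] --> (0 : R) := @cvg_harmonic R.
have [->|a0] := eqVneq a 0.
  rewrite dotvC dotv0 mulr0 enorm0 powR0 ?gt_eqF//.
  have -> : (fun k => (0 - enorm (0 + k.+1%:R^-1 *: (b - 0)) `^ p) / p * k.+1%:R) =
      (fun k => - (enorm b `^ p / p) * (k.+1%:R^-1 : R) `^ (p - 1)).
    apply/funext => k; rewrite sub0r add0r subr0 enormZ (ger0_norm (ltW (t0 k))).
    rewrite powRM ?(ltW (t0 k)) ?enorm_ge0//.
    rewrite -(mulr_powRB1 (ltW (t0 k)) p0); set x := _ `^ (p - 1).
    by field; rewrite gt_eqF//= addr_eq0 gt_eqF// (lt_trans (ltrN10 _)).
  rewrite -[X in _ --> X](mulr0 (- (enorm b `^ p / p))); apply: cvgM; first exact: cvg_cst.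
  rewrite -[X in _ --> X](@powR0 _ (p - 1)); last by rewrite gt_eqF// subr_gt0.
  by apply: cvg_powR => //; rewrite subr_gt0.
pose w k := a + k.+1%:R^-1 *: (b - a).
have wc i : w k ord0 i @[k --> \oo] --> a ord0 i.
  rewrite -[X in _ --> X]addr0; under eq_fun do rewrite !mxE.
  apply: cvgD; first exact: cvg_cst.
  rewrite -[X in _ --> X](mul0r (b ord0 i - a ord0 i)); apply: cvgM => //; exact: cvg_cst.
have cA : enorm (w k) `^ (p - 2) * dotv (w k) (a - b) @[k --> \oo] -->
    enorm a `^ (p - 2) * dotv a (a - b).
  apply: cvgM; last by apply: cvg_dotv => // i; exact: cvg_cst.
  rewrite powR_enorm; under eq_fun do rewrite powR_enorm.
  apply: cvg_powR_gt0; last exact: cvg_dotv.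
  rewrite lt_neqAle dotv_ge0 andbT eq_sym; apply: contra a0 => /eqP/dotv_eq0 ->//.
apply: (squeeze_cvgr (f := fun k => enorm (w k) `^ (p - 2) * dotv (w k) (a - b))
  (h := fun=> enorm a `^ (p - 2) * dotv a (a - b))) => //; last exact: cvg_cst.
apply: nearW => k; rewrite -/(w k).
have wa : w k - a = k.+1%:R^-1 *: (b - a) by rewrite /w addrC addKr.
have aw : a - w k = k.+1%:R^-1 *: (a - b) by rewrite -opprB wa -scalerN opprB.
have h1 := plap_gradient_ineq a (w k) p1; have h2 := plap_gradient_ineq (w k) a p1.
rewrite wa dotvZr -(opprB a b) dotvNr in h1; rewrite aw dotvZr in h2.
move: (enorm (w k) `^ p) (enorm a `^ p) (enorm (w k) `^ (p - 2)) (enorm a `^ (p - 2))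
  (dotv (w k) (a - b)) (dotv a (a - b)) h1 h2 => W A ew ea Dw Da h1 h2.
have K0 : 0 < k.+1%:R :> R by rewrite ltr0n.
have e1 : ew * Dw = ew * (k.+1%:R^-1 * Dw) * k.+1%:R by field; rewrite addrC natr1 k0.
have e2 : ea * Da = ea * (k.+1%:R^-1 * Da) * k.+1%:R by field; rewrite addrC natr1 k0.
rewrite e1 e2 !ler_pM2r// mulrBl; apply/andP; split; first by rewrite lerBrDl.
by rewrite lerBlDr addrC -lerBlDr -!mulrN.
Qed.

End plap_limit.

(** * Competitors, minimizers and the variational inequality *)

Section minimization.
Context {R : realType} {n : nat}.
Variables (Om : set 'rV[R]_n) (p : 'rV[R]_n -> R) (q : R).
Hypothesis n0 : (0 < n)%N.
Hypothesis oOm : open Om.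
Hypothesis bOm : bounded_set Om.
Hypothesis mp : measurable_fun Om p.
Hypothesis q1 : 1 < q.
Hypothesis nq : n%:R < q.
Hypothesis qp : forall x, Om x -> q <= p x.
Local Notation mu := (@lebesgue_rV R n).
Local Notation fn := ('rV[R]_n -> R).
Local Notation vf := ('rV[R]_n -> 'rV[R]_n).

Let mOm : measurable Om := open_measurable_rV oOm.

Let p1 x : Om x -> 1 < p x.
Proof. by move=> /qp; exact: lt_le_trans. Qed.

Let p_gt0 x : Om x -> 0 < p x.
Proof. by move=> /p1; exact: lt_trans. Qed.

Let p2 x : Om x -> 2 <= p x \/ n = 1%N.
Proof.
move=> Ox; case: (ltnP 1 n) => hn; last by right; apply/eqP; rewrite eqn_leq hn n0.
by left; rewrite (le_trans _ (qp Ox))// (le_trans _ (ltW nq))// ler_nat.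
Qed.

Variable phi : fn.
Hypothesis phiW : W1p Om p phi.
Hypothesis phi_fin : (energy Om p (wgrad Om phi) < +oo)%E.

Definition competitor (u : fn) := U1p_0 Om p (fun x => u x - phi x) /\
  (energy Om p (wgrad Om u) < +oo)%E.

Lemma competitor_W1p u : competitor u -> W1p Om p u.
Proof.
move=> [uU _]; rewrite (_ : u = fun x => (u x - phi x) + phi x).
  by apply: (W1pD oOm mp p1 _ phiW); exact: U1p_0_W1p uU.
by apply/funext => x; rewrite subrK.
Qed.

Lemma U1p_0_0 : U1p_0 Om p (fun=> 0).
Proof.
apply: W1p_comp_U1p_0; split.
  by have := W1pZ oOm mp p1 0 phiW; congr (W1p Om p _); apply/funext => x; rewrite mul0r.
by exists set0; split => //; [exact: compact0|exact/aeW].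
Qed.

Lemma competitor_phi : competitor phi.
Proof.
split; last exact: phi_fin.
by have := U1p_0_0; congr (U1p_0 Om p _); apply/funext => x; rewrite subrr.
Qed.

Lemma wgrad_comb (a b : R) u w : W1p Om p u -> W1p Om p w ->
  {ae mu, forall x, Om x ->
    wgrad Om (fun x => a * u x + b * w x) x = a *: wgrad Om u x + b *: wgrad Om w x}.
Proof.
move=> uW wW; have g1 := wgradD oOm (W1pZ oOm mp p1 a uW) (W1pZ oOm mp p1 b wW).
have g2 := ae_conj (wgradZ oOm a uW) (wgradZ oOm b wW).
by apply: filterS (ae_conj g1 g2) => x [h1 [h2 h3]] Ox; rewrite (h1 Ox) (h2 Ox) (h3 Ox).
Qed.

Let W1p_comb (a b : R) u w : W1p Om p u -> W1p Om p w -> W1p Om p (fun x => a * u x + b * w x).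
Proof.
move=> uW wW; exact: (W1pD oOm mp p1 (W1pZ oOm mp p1 a uW) (W1pZ oOm mp p1 b wW)).
Qed.

Let mvf u : W1p Om p u -> measurable_vf Om (wgrad Om u).
Proof. exact: W1p_measurable_vf. Qed.

Let mvf_comb (a b : R) (G H : vf) : measurable_vf Om G -> measurable_vf Om H ->
  measurable_vf Om (fun x => a *: G x + b *: H x).
Proof. by move=> mG mH; apply: measurable_vfD; exact: measurable_vfZ. Qed.

Lemma energy_comb (a b : R) u w : W1p Om p u -> W1p Om p w ->
  energy Om p (wgrad Om (fun x => a * u x + b * w x)) =
  energy Om p (fun x => a *: wgrad Om u x + b *: wgrad Om w x).
Proof.
move=> uW wW; apply: (energy_ae oOm mp p1); last exact: wgrad_comb.
  by apply: mvf; exact: W1p_comb.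
by apply: mvf_comb; exact: mvf.
Qed.

Let half : `|2^-1 : R| <= 1.
Proof. by rewrite ger0_norm// invf_le1// ler1n. Qed.

Lemma competitor_conv (t : R) u w : 0 <= t <= 1 -> competitor u -> competitor w ->
  competitor (fun x => (1 - t) * u x + t * w x).
Proof.
move=> /andP[t0 t1] cu cw; have uW := competitor_W1p cu; have wW := competitor_W1p cw.
have [uU ue] := cu; have [wU we] := cw; split.
  have -> : (fun x => (1 - t) * u x + t * w x - phi x) =
      fun x => (1 - t) * (u x - phi x) + t * (w x - phi x).
    by apply/funext => x; ring.
  by apply: (U1p_0D oOm mp p1); apply: (U1p_0Z oOm mp p1) => //; rewrite ger0_norm; lra.
rewrite (energy_comb _ _ uW wW).
have iu := energy_integrable oOm mp p1 (mvf uW) ue.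
have iw := energy_integrable oOm mp p1 (mvf wW) we.
have iS := integrableD_real mOm iu iw.
apply: le_lt_trans (integrable_norm_lt iS); apply: le_int.
- exact: mOm.
- by apply: (measurable_energy oOm mp p1); apply: mvf_comb; exact: mvf.
- by apply: measurable_normr_fun => //; exact: integrable_measurable iS.
- by move=> x; exact: (energy_integrand_ge0 p1 (fun x => (1 - t) *: wgrad Om u x +
    t *: wgrad Om w x)).
move=> x Ox; have px := p_gt0 Ox.
rewrite ger0_norm; last by rewrite addr_ge0// divr_ge0 ?powR_ge0// ltW.
rewrite -mulrDl ler_pM2r ?invr_gt0//.
set a := wgrad Om u x; set b := wgrad Om w x.
apply: (@le_trans _ _ ((Num.max (enorm a) (enorm b)) `^ p x)).
  apply: le_powRn => //; first exact: enorm_ge0.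
  apply: (le_trans (ler_enormD _ _)); rewrite !enormZ (ger0_norm t0) ger0_norm ?subr_ge0//.
  have m1 : enorm a <= Num.max (enorm a) (enorm b) by rewrite le_max lexx.
  have m2 : enorm b <= Num.max (enorm a) (enorm b) by rewrite le_max lexx orbT.
  have := ler_wpM2l t0 m2; have : 0 <= 1 - t by rewrite subr_ge0.
  move=> /ler_wpM2l/(_ _ _ m1) h1 h2.
  by apply: le_trans (lerD h1 h2) _; rewrite mulrBl mul1r subrK.
exact: powR_max_le.
Qed.

Let d : R := inf [set fine (energy Om p (wgrad Om u)) | u in [set u | competitor u]].

Let d_has_inf : has_inf [set fine (energy Om p (wgrad Om u)) | u in [set u | competitor u]].
Proof.
split; first by exists (fine (energy Om p (wgrad Om phi))), phi => //; exact: competitor_phi.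
by exists 0 => _ [u _ <-]; apply: fine_ge0; exact: (energy_ge0 p1).
Qed.

Let le_d u : competitor u -> d <= fine (energy Om p (wgrad Om u)).
Proof. by move=> cu; apply: ge_inf; [exact: d_has_inf.2|exists u]. Qed.

Let d_ge0 : 0 <= d.
Proof.
apply: lb_le_inf; first exact: d_has_inf.1.
by move=> _ [u _ <-]; apply: fine_ge0; exact: (energy_ge0 p1).
Qed.

Lemma energy_half_diff u w : W1p Om p u -> W1p Om p w ->
  energy Om p (fun x => 2^-1 *: (wgrad Om u x - wgrad Om w x)) =
  energy Om p (wgrad Om (fun x => 2^-1 * (u x - w x))).
Proof.
move=> uW wW; have -> : (fun x => 2^-1 * (u x - w x)) = fun x => 2^-1 * u x + (- 2^-1) * w x.
  by apply/funext => x; ring.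
rewrite (energy_comb _ _ uW wW); congr energy; apply/funext => x.
by rewrite scaleNr scalerBr.
Qed.

Lemma near_minimizers_close (e : R) : 0 < e -> exists2 de : R, 0 < de &
  forall u w, competitor u -> competitor w ->
    fine (energy Om p (wgrad Om u)) <= d + de -> fine (energy Om p (wgrad Om w)) <= d + de ->
    (energy Om p (fun x => 2^-1 *: (wgrad Om u x - wgrad Om w x)) <= e%:E)%E.
Proof.
move=> e0; have d1 : 0 < d + 1 by rewrite ltr_wpDl.
have s0 : 0 < e / 2 / (d + 1) by rewrite !divr_gt0.
have [C C0 hC] := energy_unif_convex oOm mp p1 q1 s0 qp p2.
have C1 : 0 < C + 1 by rewrite ltr_wpDl.
pose de := Num.min 1 (e / 2 / (C + 1)).
have de0 : 0 < de by rewrite lt_min ltr01 !divr_gt0.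
exists de; first exact: de0.
move=> u w cu cw hu hw.
have uW := competitor_W1p cu; have wW := competitor_W1p cw.
apply: (le_trans (hC _ _ (mvf uW) (mvf wW) cu.2 cw.2)); rewrite lee_fin.
have h01 : 0 <= (2^-1 : R) <= 1 by rewrite invr_ge0 ler0n invf_le1// ler1n.
(* The midpoint is again a competitor, so its energy is at least [d]; this is what makes the
   convexity gap small. *)
have := le_d (competitor_conv h01 cu cw); rewrite (energy_comb _ _ uW wW).
have -> : (fun x => (1 - 2^-1) *: wgrad Om u x + 2^-1 *: wgrad Om w x) =
    fun x => 2^-1 *: (wgrad Om u x + wgrad Om w x).
  by apply/funext => x; rewrite scalerDr (_ : 1 - 2^-1 = 2^-1)//; field.
by move=> hm; exact: (near_inf_bound C0 e0 d_ge0 hu hw hm).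
Qed.

Let le_energy (G : vf) (c : R) : (energy Om p G < +oo)%E -> fine (energy Om p G) <= c ->
  (energy Om p G <= c%:E)%E.
Proof. by move=> fG h; rewrite -(fineK (energy_fin p1 fG)) lee_fin. Qed.

Let mdiff i u w : W1p Om p u -> W1p Om p w ->
  measurable_fun Om (fun x => `|wpartial Om i u x - wpartial Om i w x|).
Proof.
move=> uW wW; apply: measurable_normr_fun.
exact: (measurable_funB (W1p_wpartial_measurable i uW) (W1p_wpartial_measurable i wW)).
Qed.

(** Provides the three estimates required by [U1p_0_complete]. Differences of competitors lie in
    [U1p_0] because [phi] cancels, but only the energy of half differences is controlled; e/2 is
    therefore asked of the half difference. *)
Lemma near_minimizers_uniform (e : R) : 0 < e -> exists2 de : R, 0 < de &
  forall u w, competitor u -> competitor w ->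
    fine (energy Om p (wgrad Om u)) <= d + de -> fine (energy Om p (wgrad Om w)) <= d + de ->
    [/\ (energy Om p (fun x => 2^-1 *: (wgrad Om u x - wgrad Om w x)) <= e%:E)%E,
      {ae mu, forall x, Om x -> `|u x - w x| <= e} &
      forall i, (\int[mu]_(x in Om) `|wpartial Om i u x - wpartial Om i w x|%:E <= e%:E)%E].
Proof.
move=> e0; have e20 : 0 < e / 2 by rewrite divr_gt0.
have [d1 d10 h1] := small_energy_bounded n0 oOm bOm mp p1 (ltW q1) nq qp e20.
have s1 x : Om x -> 1 <= p x by move=> /p1/ltW.
have [d2 d20 h2] := small_energy_power oOm bOm mp p1 (lexx 1) s1 e20.
pose e' := Num.min e (Num.min d1 d2).
have e'0 : 0 < e' by rewrite !lt_min e0 d10.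
have e'e : e' <= e by rewrite ge_min lexx.
have e'1 : e' <= d1 by rewrite !ge_min lexx orbT.
have e'2 : e' <= d2 by rewrite !ge_min lexx !orbT.
have [de de0 hde] := near_minimizers_close e'0.
exists de; first exact: de0.
move=> u w cu cw hu hw; have H := hde u w cu cw hu hw.
have uW := competitor_W1p cu; have wW := competitor_W1p cw.
split.
- by apply: (le_trans H); rewrite lee_fin.
- have dU : U1p_0 Om p (fun x => 2^-1 * (u x - w x)).
    apply: (U1p_0Z oOm mp p1 half).
    have := U1p_0B oOm mp p1 cu.1 cw.1; congr (U1p_0 Om p _).
    by apply/funext => x; ring.
  have H1 : (energy Om p (wgrad Om (fun x => (2^-1 * (u x - w x))%R)) <= d1%:E)%E.
    by rewrite -(energy_half_diff uW wW); apply: (le_trans H); rewrite lee_fin.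
  apply: filterS (h1 _ dU H1) => x hx Ox; have := hx Ox.
  by rewrite normrM (ger0_norm (_ : 0 <= 2^-1)) ?invr_ge0// mulrC ler_pM2r ?invr_gt0.
- move=> i; have mG : measurable_vf Om (fun x => 2^-1 *: (wgrad Om u x - wgrad Om w x)).
    by apply: measurable_vfZ; apply: measurable_vfB; exact: mvf.
  have H2 : (energy Om p (fun x => 2^-1 *: (wgrad Om u x - wgrad Om w x)) <= d2%:E)%E.
    by apply: (le_trans H); rewrite lee_fin.
  have md : measurable_fun Om (fun x => `|wpartial Om i u x - wpartial Om i w x|).
    exact: mdiff.
  have := h2 _ mG H2 i.
  rewrite (eq_integral (fun x => (2^-1 * `|wpartial Om i u x - wpartial Om i w x|)%:E)); last first.
    move=> x _; rewrite powRr1// !mxE normrM (ger0_norm (_ : 0 <= 2^-1)) ?invr_ge0//.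
  rewrite intZ ?invr_ge0// => h.
  have := lee_wpmul2l (_ : (0 <= 2%:E)%E) h; rewrite lee_fin ler0n => /(_ isT).
  by rewrite muleA -!EFinM mulfV// mul1e mulrC divfK.
Qed.

Lemma exists_minimizer : exists2 u, competitor u &
  forall w, competitor w -> (energy Om p (wgrad Om u) <= energy Om p (wgrad Om w))%E.
Proof.
have h0 k : 0 < 2^-1 ^+ k :> R by rewrite exprn_gt0.
have /choice[de hde] k : exists de : R, 0 < de /\ forall u w, competitor u -> competitor w ->
    fine (energy Om p (wgrad Om u)) <= d + de -> fine (energy Om p (wgrad Om w)) <= d + de ->
    [/\ (energy Om p (fun x => 2^-1 *: (wgrad Om u x - wgrad Om w x)) <= (2^-1 ^+ k)%:E)%E,
      {ae mu, forall x, Om x -> `|u x - w x| <= 2^-1 ^+ k} &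
      forall i, (\int[mu]_(x in Om) `|wpartial Om i u x - wpartial Om i w x|%:E <=
        (2^-1 ^+ k)%:E)%E].
  have [de de0 H] := near_minimizers_uniform (h0 k).
  exists de; split; [exact: de0|exact: H].
have [m m0 mde] := running_min (fun k => (hde k).1).
(* The first bound makes the energies tend to [d], the second makes the sequence Cauchy. *)
have /choice[u_ hu_] k : exists u, competitor u /\
    fine (energy Om p (wgrad Om u)) <= d + Num.min (2^-1 ^+ k) (m k).
  have mk0 : 0 < Num.min (2^-1 ^+ k) (m k) by rewrite lt_min h0 m0.
  have [_ [u cu <-] hu] := inf_adherent mk0 d_has_inf.
  exists u; split; [exact: cu|exact: ltW].
have cu k := (hu_ k).1; have uW k := competitor_W1p (cu k).
have Hm j k : (j <= k)%N -> fine (energy Om p (wgrad Om (u_ k))) <= d + de j.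
  move=> jk; apply: (le_trans (hu_ k).2); rewrite lerD2l ge_min (mde _ _ jk) orbT//.
have Hjk j k (jk : (j <= k)%N) := (hde j).2 _ _ (cu j) (cu k) (Hm j j (leqnn j)) (Hm j k jk).
pose v_ k x := u_ k x - phi x.
have vU k : U1p_0 Om p (v_ k) := (cu k).1.
have vW k : W1p Om p (v_ k) := U1p_0_W1p (vU k).
have gv k : {ae mu, forall x, Om x -> wgrad Om (v_ k) x = wgrad Om (u_ k) x - wgrad Om phi x}.
  exact: (wgradB oOm mp p1 (uW k) phiW).
have gd j k : {ae mu, forall x, Om x ->
    wgrad Om (v_ j) x - wgrad Om (v_ k) x = wgrad Om (u_ j) x - wgrad Om (u_ k) x}.
  apply: filterS (ae_conj (gv j) (gv k)) => x [a1 a2] Ox.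
  by rewrite (a1 Ox) (a2 Ox) opprB addrA subrK.
have e1 j k : (j <= k)%N ->
    (energy Om p (fun x => 2^-1 *: (wgrad Om (v_ j) x - wgrad Om (v_ k) x)) <= (2^-1 ^+ j)%:E)%E.
  move=> jk; have [H _ _] := Hjk j k jk; apply: le_trans (H).
  rewrite le_eqVlt; apply/orP; left; apply/eqP; apply: (energy_ae oOm mp p1).
  - by apply: measurable_vfZ; apply: measurable_vfB; exact: mvf.
  - by apply: measurable_vfZ; apply: measurable_vfB; exact: mvf.
  - by apply: filterS (gd j k) => x h Ox; rewrite (h Ox).
have e2 j k : (j <= k)%N -> {ae mu, forall x, Om x -> `|v_ j x - v_ k x| <= 2^-1 ^+ j}.
  move=> jk; have [_ H _] := Hjk j k jk; apply: filterS H => x h Ox.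
  by rewrite /v_ opprB addrA subrK; exact: h.
have e3 j k i : (j <= k)%N ->
    (\int[mu]_(x in Om) `|wpartial Om i (v_ j) x - wpartial Om i (v_ k) x|%:E <= (2^-1 ^+ j)%:E)%E.
  move=> jk; have [_ _ H] := Hjk j k jk; apply: le_trans (H i).
  rewrite le_eqVlt; apply/orP; left; apply/eqP; apply: ae_eq_int.
  - exact: mOm.
  - exact: mdiff.
  - exact: mdiff.
  - by apply: filterS (gd j k) => x h Ox; have /rowP/(_ i) := h Ox; rewrite !mxE => ->.
have [v vU' cv] := U1p_0_complete oOm bOm mp p1 vU e1 e2 e3.
have vW' : W1p Om p v := U1p_0_W1p vU'.
pose u x := v x + phi x.
have uW' : W1p Om p u by exact: (W1pD oOm mp p1 vW' phiW).
have gu : {ae mu, forall x, Om x -> wgrad Om u x = wgrad Om v x + wgrad Om phi x}.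
  exact: (wgradD oOm vW' phiW).
have cvu : {ae mu, forall x, Om x -> forall i,
    wgrad Om (u_ k) x ord0 i @[k --> \oo] --> wgrad Om u x ord0 i}.
  have gv' : {ae mu, forall x, forall k,
    Om x -> wgrad Om (v_ k) x = wgrad Om (u_ k) x - wgrad Om phi x}.
    exact: ae_foralln.
  apply: filterS (ae_conj (ae_conj gu gv') cv) => x [[a1 a2] a3] Ox i.
  rewrite (a1 Ox) mxE.
  have -> : (fun k => wgrad Om (u_ k) x ord0 i) =
      (fun k => wgrad Om (v_ k) x ord0 i + wgrad Om phi x ord0 i).
    by apply/funext => k; rewrite (a2 k Ox) !mxE subrK.
  by apply: cvgD; [exact: a3|exact: cvg_cst].
have ud : (energy Om p (wgrad Om u) <= d%:E)%E.
  (* Fatou's lemma along a tail on which all energies are at most d + e. *)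
  apply/lee_addgt0Pr => e e0.
  have := @cvg_half_pow R 1; move/cvgr0Pnorm_lt => /(_ e e0)[K _ HK].
  have {HK} HK k : (K <= k)%N -> 2^-1 ^+ k < e.
    by move=> /HK; rewrite /= mul1r ger0_norm// ltW.
  apply: (fatou_ae_le mOm (f_ := fun k x => enorm (wgrad Om (u_ (k + K)%N) x) `^ p x / p x)).
  - by move=> k; apply: (measurable_energy oOm mp p1); exact: mvf.
  - by apply: (measurable_energy oOm mp p1); exact: mvf.
  - by move=> k; exact: (energy_integrand_ge0 p1 (wgrad Om (u_ (k + K)%N))).
  - exact: (energy_integrand_ge0 p1 (wgrad Om u)).
  - apply: filterS cvu => x hx Ox; apply: cvgM; last exact: cvg_cst.
    apply: cvg_enorm_powR; first exact: p_gt0.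
    by move=> i; rewrite (cvg_shiftn K (fun k => wgrad Om (u_ k) x ord0 i)); exact: hx.
  - move=> k; rewrite -EFinD; apply: le_energy; first exact: (cu _).2.
    apply: (le_trans (hu_ _).2); rewrite lerD2l ge_min; apply/orP; left.
    by apply/ltW/HK; exact: leq_addl.
have cu' : competitor u.
  split; last exact: le_lt_trans ud (ltry _).
  by have := vU'; congr (U1p_0 Om p _); apply/funext => x; rewrite /u addrK.
exists u; first exact: cu'.
move=> w cw; apply: (le_trans ud); rewrite -(fineK (energy_fin p1 cw.2)) lee_fin.
exact: le_d.
Qed.

Let integrand u x := enorm (wgrad Om u x) `^ p x / p x.

Let integrand_integrable u : competitor u -> mu.-integrable Om (EFin \o integrand u).
Proof.
move=> cu; exact: (energy_integrable oOm mp p1 (mvf (competitor_W1p cu)) cu.2).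
Qed.

Let measurable_pm2 u : W1p Om p u -> measurable_fun Om (fun x => enorm (wgrad Om u x) `^ (p x - 2)).
Proof.
move=> uW; apply: measurable_powR2; first exact: mOm.
  exact: (measurable_enorm_wgrad oOm uW).
exact: (measurable_funB mp (measurable_cst _)).
Qed.

Lemma measurable_plap u w : W1p Om p u -> W1p Om p w -> measurable_fun Om (plap_form Om p u w).
Proof.
move=> uW wW; apply: (measurable_funM (measurable_pm2 uW)).
by apply: measurable_dotv; exact: mvf.
Qed.

Lemma plap_ae u w (G : vf) : {ae mu, forall x, Om x -> wgrad Om w x = G x} ->
  {ae mu, forall x, Om x ->
    plap_form Om p u w x = enorm (wgrad Om u x) `^ (p x - 2) * dotv (wgrad Om u x) (G x)}.
Proof. by apply: filterS => x h Ox; rewrite /plap_form (h Ox). Qed.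

Definition minimizer u := competitor u /\
  forall w, competitor w -> (energy Om p (wgrad Om u) <= energy Om p (wgrad Om w))%E.

(* Fatou's lemma for the difference quotients of the energy at [u] in the
   direction of [w]: by convexity they are bounded below by an integrable
   function, and their integrals have the sign given by minimality. *)
Lemma minimizer_variational u w : minimizer u -> competitor w ->
  mu.-integrable Om (EFin \o plap_form Om p u (fun x => u x - w x)) /\
  (\int[mu]_(x in Om) (plap_form Om p u (fun x => u x - w x)%R x)%:E <= 0)%E.
Proof.
move=> [cu umin] cw; have uW := competitor_W1p cu; have wW := competitor_W1p cw.
have iu := integrand_integrable cu; have iw := integrand_integrable cw.
pose g x := integrand w x - integrand u x.
have ig : mu.-integrable Om (EFin \o g) := integrableB mOm iw iu.
pose t k : R := k.+1%:R^-1.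
have t01 k : 0 <= t k <= 1 by rewrite invr_ge0 ler0n invf_le1 ?ler1n// ltr0n.
pose W k x := wgrad Om u x + t k *: (wgrad Om w x - wgrad Om u x).
pose iW k x := enorm (W k x) `^ p x / p x.
pose uk k x := (1 - t k) * u x + t k * w x.
have cuk k : competitor (uk k) := competitor_conv (t01 k) cu cw.
have WE k : energy Om p (wgrad Om (uk k)) = energy Om p (W k).
  rewrite (energy_comb (1 - t k) (t k) uW wW); congr energy; apply/funext => x.
  by rewrite /W scalerBl scale1r scalerBr addrA addrAC.
have mW k : measurable_vf Om (W k).
  by apply: measurable_vfD; [exact: mvf|apply: measurable_vfZ; apply: measurable_vfB; exact: mvf].
have fW k : (energy Om p (W k) < +oo)%E by rewrite -WE; exact: (cuk k).2.
have iiW k : mu.-integrable Om (EFin \o iW k) := energy_integrable oOm mp p1 (mW k) (fW k).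
pose f x := enorm (wgrad Om u x) `^ (p x - 2) * dotv (wgrad Om u x) (wgrad Om u x - wgrad Om w x).
have mf : measurable_fun Om f.
  apply: (measurable_funM (measurable_pm2 uW)); apply: measurable_dotv; first exact: mvf.
  by apply: measurable_vfB; exact: mvf.
have fE : {ae mu, forall x, Om x -> plap_form Om p u (fun x => u x - w x) x = f x}.
  by apply: plap_ae; exact: (wgradB oOm mp p1 uW wW).
have mpl : measurable_fun Om (plap_form Om p u (fun x => u x - w x)).
  by apply: measurable_plap => //; exact: (W1pB oOm mp p1 uW wW).
pose fk k x := k.+1%:R * (integrand u x - iW k x).
have ifk k : mu.-integrable Om (EFin \o fk k).
  exact: (integrableZ_real mOm _ (integrableB mOm iu (iiW k))).
pose hk k x := fk k x + g x.
have ihk k : mu.-integrable Om (EFin \o hk k) := integrableD_real mOm (ifk k) ig.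
have k0 k : 0 < k.+1%:R :> R by rewrite ltr0n.
have hk0 k x : Om x -> 0 <= hk k x.
  move=> Ox; have := enorm_powR_convex (wgrad Om u x) (wgrad Om w x) (p1 Ox) (t01 k).
  rewrite /hk /fk /g /iW /integrand -/(W k x).
  move: (enorm (W k x) `^ p x) (enorm (wgrad Om u x) `^ p x) (enorm (wgrad Om w x) `^ p x).
  move=> C A B h; have px := p_gt0 Ox.
  have -> : k.+1%:R * (A / p x - C / p x) + (B / p x - A / p x) =
      k.+1%:R / p x * ((1 - t k) * A + t k * B - C).
    rewrite /t; move: (k.+1%:R : R) (k0 k) => K K0.
    by field; rewrite !gt_eqF.
  by rewrite mulr_ge0 ?subr_ge0// divr_ge0 ?(ltW px)// ltW.
have f0 x : Om x -> 0 <= f x + g x.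
  move=> Ox; have h : integrand u x - integrand w x <= f x := plap_gap _ _ (p1 Ox).
  by have := subr_ge0 (integrand u x - integrand w x) (f x); rewrite h opprB.
have cfk x : Om x -> fk k x @[k --> \oo] --> f x.
  move=> Ox; have -> : (fun k => fk k x) = (fun k => (enorm (wgrad Om u x) `^ p x -
      enorm (wgrad Om u x + k.+1%:R^-1 *: (wgrad Om w x - wgrad Om u x)) `^ p x) / p x * k.+1%:R).
    by apply/funext => k; rewrite /fk /integrand /iW /W mulrBl mulrC.
  exact: cvg_plap_quotient (p1 Ox).
have Jfk k : (\int[mu]_(x in Om) (fk k x)%:E <= 0)%E.
  have iB := integrableB mOm iu (iiW k).
  rewrite (_ : (\int[mu]_(x in Om) (fk k x)%:E = k.+1%:R%:E *
      \int[mu]_(x in Om) (integrand u x - iW k x)%:E)%E); last exact: (integralZl mOm iB).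
  apply: mule_ge0_le0; first by rewrite lee_fin ltW.
  rewrite (_ : (\int[mu]_(x in Om) (integrand u x - iW k x)%:E =
      energy Om p (wgrad Om u) - energy Om p (W k))%E); last exact: (integralB_EFin mOm iu (iiW k)).
  rewrite sube_le0; apply: (le_trans (umin _ (cuk k))).
  by rewrite (WE k).
have Jhk k : (\int[mu]_(x in Om) (hk k x)%:E <= \int[mu]_(x in Om) (g x)%:E)%E.
  rewrite (_ : (\int[mu]_(x in Om) (hk k x)%:E = \int[mu]_(x in Om) (fk k x)%:E +
      \int[mu]_(x in Om) (g x)%:E)%E); last exact: (integralD_EFin mOm (ifk k) ig).
  by rewrite -[leRHS]add0e; apply: leeD.
have Jf : (\int[mu]_(x in Om) (f x + g x)%:E <= \int[mu]_(x in Om) (g x)%:E)%E.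
  apply: (fatou_ae_le mOm (f_ := hk)).
  - by move=> k; exact: integrable_measurable (ihk k).
  - by apply: measurable_funD; [exact: mf|exact: integrable_measurable ig].
  - exact: hk0.
  - exact: f0.
  - by apply/aeW => x Ox; apply: cvgD; [exact: cfk|exact: cvg_cst].
  - exact: Jhk.
have gfin := integrable_fin_num mOm ig.
(* The sum is nonnegative with finite integral, hence integrable, and subtracting [g] yields the
   integrability of [f]. The weak equation relies on it to change the sign of the test function. *)
have ifg : mu.-integrable Om (EFin \o (fun x => f x + g x)).
  apply: ge0_integrable.
  - by apply: measurable_funD; [exact: mf|exact: integrable_measurable ig].
  - exact: f0.
  - by apply: le_lt_trans Jf _; rewrite -(fineK gfin) ltry.
have if_ : mu.-integrable Om (EFin \o f).
  have := integrableB mOm ifg ig; apply: eq_integrable; first exact: mOm.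
  by move=> x _; rewrite /= -EFinB addrK.
split.
  apply: (ae_integrable_real mOm _ mpl if_).
  by apply: filterS fE => x h Ox; rewrite (h Ox).
rewrite (ae_eq_int mOm mpl mf fE).
move: Jf; rewrite (_ : (\int[mu]_(x in Om) (f x + g x)%:E = \int[mu]_(x in Om) (f x)%:E +
    \int[mu]_(x in Om) (g x)%:E)%E); last exact: (integralD_EFin mOm if_ ig).
by rewrite -{2}(add0e (\int[mu]_(x in Om) (g x)%:E)%E) leeD2rE.
Qed.

Lemma variational_minimizer u : competitor u ->
  (forall w, competitor w ->
    (\int[mu]_(x in Om) (plap_form Om p u (fun x => u x - w x)%R x)%:E <= 0)%E) ->
  minimizer u.
Proof.
move=> cu H; split; first exact: cu.
move=> w cw; have uW := competitor_W1p cu; have wW := competitor_W1p cw.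
have iu := integrand_integrable cu; have iw := integrand_integrable cw.
have mpl : measurable_fun Om (plap_form Om p u (fun x => u x - w x)).
  by apply: measurable_plap => //; exact: (W1pB oOm mp p1 uW wW).
have fE := plap_ae u (wgradB oOm mp p1 uW wW).
have h : (\int[mu]_(x in Om) (integrand u x - integrand w x)%:E <= 0)%E.
  apply: le_trans (H w cw); apply: integral_le.
  - exact: mOm.
  - exact: integrable_measurable (integrableB mOm iu iw).
  - exact: mpl.
  - apply: filterS fE => x hx Ox; rewrite (hx Ox); exact: plap_gap (p1 Ox).
rewrite -sube_le0; apply: le_trans h.
by rewrite (_ : (\int[mu]_(x in Om) (integrand u x - integrand w x)%:E =
  energy Om p (wgrad Om u) - energy Om p (wgrad Om w))%E)//; exact: (integralB_EFin mOm iu iw).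
Qed.

(** The uniform estimate holds with every tolerance, so the functions themselves coincide; no
    constant has to be recovered from equal gradients. *)
Lemma minimizer_unique u w : minimizer u -> minimizer w ->
  {ae mu, forall x, Om x -> w x = u x}.
Proof.
move=> [cu umin] [cw wmin].
have le_inf v : minimizer v -> fine (energy Om p (wgrad Om v)) <= d.
  move=> [cv vmin]; apply: lb_le_inf; first exact: d_has_inf.1.
  move=> _ [z cz <-]; apply: fine_le; [exact: (energy_fin p1 cv.2)|exact: (energy_fin p1 cz.2)|].
  exact: vmin.
have hu := le_inf u (conj cu umin); have hw := le_inf w (conj cw wmin).
have H k : {ae mu, forall x, Om x -> `|w x - u x| <= k.+1%:R^-1}.
  have k0 : 0 < k.+1%:R^-1 :> R by rewrite invr_gt0 ltr0n.
  have [de de0 hde] := near_minimizers_uniform k0.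
  have hu' : fine (energy Om p (wgrad Om u)) <= d + de by apply: (le_trans hu); rewrite lerDl ltW.
  have hw' : fine (energy Om p (wgrad Om w)) <= d + de by apply: (le_trans hw); rewrite lerDl ltW.
  by have [_ h _] := hde w u cw cu hw' hu'.
apply: filterS (ae_foralln H) => x hx Ox; apply/eqP; rewrite -subr_eq0 -normr_le0.
apply/ler_addgt0Pr => e e0; rewrite add0r.
have [m _ hm] := near_infty_natSinv_lt (PosNum e0).
by apply: (le_trans (hx m Ox)); apply/ltW/(hm m (leqnn m)).
Qed.

Hypothesis pK : forall K : set 'rV[R]_n, compact K -> K `<=` Om ->
  exists P : R, forall x, K x -> p x <= P.

Lemma Lp_enorm_wgrad z : W1p Om p z -> Lp Om p (fun x => enorm (wgrad Om z x)).
Proof.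
move=> zW; have Ls (s : seq 'I_n) : Lp Om p (fun x => \sum_(i <- s) `|wpartial Om i z x|).
  elim: s => [|i s IH].
    apply: (Lp_bounded oOm bOm mp p1 (M := 0)).
      by under eq_fun do rewrite big_nil; exact: measurable_cst.
    by apply/aeW => x _; rewrite big_nil normr0.
  under eq_fun do rewrite big_cons; apply: (LpD oOm mp p1 _ IH).
  have mw := W1p_wpartial_measurable i zW.
  have le : {ae mu, forall x, Om x -> `| `|wpartial Om i z x| | <= `|wpartial Om i z x|}.
    by apply/aeW => x _; rewrite normr_id.
  exact: (@Lp_le R n Om p oOm mp p1 (wpartial Om i z)
    (fun x => `|wpartial Om i z x|) (measurable_normr_fun mw) le (W1p_wpartial_Lp oOm mp p1 i zW)).
apply: (@Lp_le R n Om p oOm mp p1 (fun x => \sum_(i <- index_enum 'I_n) `|wpartial Om i z x|)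
  (fun x => enorm (wgrad Om z x)) (measurable_enorm_wgrad oOm zW) _ (Ls _)).
apply/aeW => x _; rewrite (ger0_norm (enorm_ge0 _)) (le_trans (enorm_le_sum _))//.
by rewrite (le_trans _ (ler_norm _))//; apply: ler_sum => i _; rewrite mxE.
Qed.

Lemma competitor_perturb (c : R) u z : `|c| <= 1 -> competitor u -> W1p_comp Om p z ->
  competitor (fun x => u x + c * z x).
Proof.
move=> c1 cu zC; have [zW [K [cK KOm z0]]] := zC.
have uW := competitor_W1p cu.
split.
  have -> : (fun x => u x + c * z x - phi x) = fun x => (u x - phi x) + c * z x.
    by apply/funext => x; ring.
  apply: (U1p_0D oOm mp p1 cu.1); apply: (U1p_0Z oOm mp p1 c1); exact: W1p_comp_U1p_0.
(* [K] may be empty, which leaves [P0] arbitrary; the truncation at 0 ensures 2^P >= 1. *)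
have [P0 hP0] := pK cK KOm; pose P := Num.max 0 P0.
have hP x : K x -> p x <= P by move=> /hP0 h; rewrite le_max h orbT.
have P_ge0 : 0 <= P by rewrite le_max lexx.
have [menz [lam l0 fz]] := Lp_enorm_wgrad zW.
have iu := integrand_integrable cu.
have iz : mu.-integrable Om (EFin \o (fun x => `|lam * enorm (wgrad Om z x)| `^ p x)).
  apply: ge0_integrable => //.
  by apply: (measurable_pow oOm mp); exact: measurable_funM.
pose A : R := 2 `^ P; pose B : R := Num.max 1 (2 / lam) `^ P.
have iAB := integrableD_real mOm (integrableZ_real mOm A iu) (integrableZ_real mOm B iz).
have zz : {ae mu, forall x, Om x -> ~ K x -> wgrad Om z x = 0}.
  have h : {ae mu, forall x, forall i, Om x -> ~ K x -> wpartial Om i z x = 0}.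
    by apply: ae_forall_fin => i; exact: (W1p_comp_wpartial_ae0 oOm i zW cK KOm z0).
  by apply: filterS h => x hx Ox Kx; apply/rowP => i; rewrite !mxE hx.
have gE : {ae mu, forall x, Om x ->
    wgrad Om (fun x => u x + c * z x) x = wgrad Om u x + c *: wgrad Om z x}.
  have g1 := wgradD oOm uW (W1pZ oOm mp p1 c zW).
  by apply: filterS (ae_conj g1 (wgradZ oOm c zW)) => x [a1 a2] Ox; rewrite (a1 Ox) (a2 Ox).
have sW : W1p Om p (fun x => u x + c * z x) := W1pD oOm mp p1 uW (W1pZ oOm mp p1 c zW).
apply: le_lt_trans (integrable_norm_lt iAB); apply: le_int_ae.
- exact: mOm.
- by apply: (measurable_energy oOm mp p1); exact: mvf.
- by apply: measurable_normr_fun; exact: integrable_measurable iAB.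
- exact: (energy_integrand_ge0 p1 (wgrad Om (fun x => u x + c * z x))).
- by move=> x _; exact: normr_ge0.
apply: filterS (ae_conj zz gE) => x [a1 a2] Ox; rewrite (a2 Ox).
have A1 : 1 <= A by rewrite -(powRr0 2) ler_powR// ler1n.
have B0 : 0 <= B by exact: powR_ge0.
apply: le_trans (ler_norm _); apply: perturb_bound => //.
- exact: p1.
- by have [Kx|Kx] := pselect (K x); [left; exact: hP|right; exact: a1].
Qed.

(** The minimizer perturbed by [z] and by its opposite are both competitors, so the variational
    inequality holds with both signs. *)
Lemma minimizer_weak_solution u : minimizer u -> weak_solution Om p u.
Proof.
move=> um z zC; have cu := um.1; have uW := competitor_W1p cu; have [zW _] := zC.
have c1 : competitor (fun x => u x + 1 * z x) by apply: competitor_perturb => //; rewrite normr1.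
have c2 : competitor (fun x => u x + -1 * z x) by apply: competitor_perturb => //; rewrite normrN1.
have [_ h1] := minimizer_variational um c1; have [i2 h2] := minimizer_variational um c2.
rewrite (_ : (fun x => u x - (u x + 1 * z x)) = fun x => - z x) in h1; last first.
  by apply/funext => x; ring.
rewrite (_ : (fun x => u x - (u x + -1 * z x)) = z) in i2 h2; last first.
  by apply/funext => x; ring.
have m1 := measurable_plap uW zW; have m2 := measurable_plap uW (W1pN oOm mp p1 zW).
have E : {ae mu, forall x, Om x -> plap_form Om p u (fun x => - z x) x = -1 * plap_form Om p u z x}.
  apply: filterS (wgradN oOm zW) => x h Ox; rewrite /plap_form (h Ox).
  by rewrite dotvNr mulrN mulN1r.
have mN : measurable_fun Om (fun x => -1 * plap_form Om p u z x).
  exact: (measurable_funM (measurable_cst _) m1).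
rewrite (ae_eq_int mOm m2 mN E) in h1.
rewrite (_ : (\int[mu]_(x in Om) (-1 * plap_form Om p u z x)%:E =
  (-1)%:E * \int[mu]_(x in Om) (plap_form Om p u z x)%:E)%E) in h1; last exact: (integralZl mOm i2).
have Ifin := integrable_fin_num mOm i2.
rewrite -(fineK Ifin) in h1; rewrite -(fineK Ifin) lee_fin in h2; rewrite -(fineK Ifin).
rewrite -EFinM lee_fin mulN1r oppr_le0 in h1.
by congr EFin; apply/eqP; rewrite eq_le h2 h1.
Qed.

End minimization.

Lemma energy_wgradN {R : realType} {n : nat} (Om : set 'rV[R]_n) (p z : 'rV[R]_n -> R) :
  open Om -> measurable_fun Om p -> (forall x, Om x -> 1 < p x) -> W1p Om p z ->
  energy Om p (wgrad Om (fun x => - z x)) = energy Om p (wgrad Om z).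
Proof.
move=> oOm mp p1 zW; have mz := W1p_measurable_vf zW.
transitivity (energy Om p (fun x => (-1) *: wgrad Om z x)).
  apply: (energy_ae oOm mp p1).
  - exact: (W1p_measurable_vf (W1pN oOm mp p1 zW)).
  - exact: measurable_vfZ mz.
  - by apply: filterS (wgradN oOm zW) => x h Ox; rewrite (h Ox) scaleN1r.
by apply: eq_integral => x _; rewrite scaleN1r enormN.
Qed.

Theorem theorem4p1 (R : realType) (n : nat) (n_gt0 : (0 < n)%N)
    (Om : set 'rV[R]_n) (Om_dom : bounded_C2_domain Om)
    (p : 'rV[R]_n -> R)
    (p_gt1 : forall x, Om x -> 1 < p x)
    (p_cont : {within Om, continuous p})
    (p_minus : n%:R < inf [set p x | x in Om])
    (phi : 'rV[R]_n -> R) (phi_W : W1p Om p phi)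
    (phi_fin : (\int[lebesgue_rV n]_(x in Om)
                  (enorm (wgrad Om phi x) `^ p x / p x)%:E < +oo)%E) :
  let solution u :=
    [/\ W1p Om p u,
        weak_solution Om p u,
        U1p_0 Om p (u \- phi),
        (\int[lebesgue_rV n]_(x in Om)
           ((p x)^-1 * enorm (wgrad Om u x) `^ p x)%:E < +oo)%E &
        forall v, U1p_0 Om p v ->
          (\int[lebesgue_rV n]_(x in Om)
             ((p x)^-1 * enorm (wgrad Om (v \- phi) x) `^ p x)%:E < +oo)%E ->
          (\int[lebesgue_rV n]_(x in Om)
             (plap_form Om p u (u \+ v \- phi) x)%:E <= 0)%E] in
  exists u, solution u /\
    forall w, solution w ->
      {ae lebesgue_rV n, forall x, Om x -> w x = u x}.
Proof.
have [_ oOm _ bOm _] := Om_dom.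
have mOm := open_measurable_rV oOm.
have mp : measurable_fun Om p by exact: continuous_measurable_rV.
have n1 : 1 <= n%:R :> R by rewrite ler1n.
(* The infimum of [p] itself serves as the exponent [q] of the preceding estimates. *)
have q1 : 1 < inf [set p x | x in Om] by exact: le_lt_trans n1 p_minus.
have qp x : Om x -> inf [set p x | x in Om] <= p x.
  move=> Ox; apply: ge_inf; last by exists x.
  by exists 1 => _ [y /p_gt1/ltW ? <-].
have pK (K : set 'rV[R]_n) : compact K -> K `<=` Om -> exists P : R, forall x, K x -> p x <= P.
  move=> cK KOm; have := compact_bounded (continuous_compact (continuous_subspaceW KOm p_cont) cK).
  move=> [M [_ hM]]; exists (M + 1) => x Kx.
  apply: (le_trans (ler_norm _)); apply: (hM (M + 1)); first by rewrite ltrDl.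
  by exists x.
have eE (f : 'rV[R]_n -> R) : (\int[lebesgue_rV n]_(x in Om)
    ((p x)^-1 * enorm (wgrad Om f x) `^ p x)%:E)%E = energy Om p (wgrad Om f).
  by apply: eq_integral => x _; rewrite mulrC.
move=> solution.
(* The substitution z = phi - v matches the admissible [v] with the competitors: u + v - phi = u -
   z, and the gradients of v - phi and of [z] have the same length. *)
have solE u : solution u <-> minimizer Om p phi u.
  split=> [[uW _ uU ufin H]|um].
    have cu : competitor Om p phi u by split; [exact: uU|rewrite -eE].
    apply: (variational_minimizer oOm mp q1 qp phi_W cu) => z cz.
    have vU : U1p_0 Om p (fun x => phi x - z x).
      have := U1p_0N oOm mp p_gt1 cz.1; congr (U1p_0 Om p _).
      by apply/funext => x; rewrite opprB.
    have zW := competitor_W1p oOm mp q1 qp phi_W cz.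
    have E1 : (fun x => phi x - z x) \- phi = fun x => - z x.
      by apply/funext => x /=; ring.
    have E2 : u \+ (fun x => phi x - z x) \- phi = fun x => u x - z x.
      by apply/funext => x /=; ring.
    have := H _ vU; rewrite eE E1 E2 (energy_wgradN oOm mp p_gt1 zW); apply.
    exact: cz.2.
  have cu := um.1; have uW := competitor_W1p oOm mp q1 qp phi_W cu.
  split.
  - exact: uW.
  - exact: (minimizer_weak_solution oOm bOm mp q1 qp phi_W pK um).
  - exact: cu.1.
  - by rewrite eE; exact: cu.2.
  move=> v vU vfin; have vW := U1p_0_W1p vU.
  have dW : W1p Om p (fun x => v x - phi x) := W1pB oOm mp p_gt1 vW phi_W.
  have cw : competitor Om p phi (fun x => - (v x - phi x)).
    split; last by rewrite (energy_wgradN oOm mp p_gt1 dW) -eE.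
    have := U1p_0N oOm mp p_gt1 vU; congr (U1p_0 Om p _).
    by apply/funext => x; ring.
  have [_] := minimizer_variational oOm mp q1 qp phi_W um cw.
  by have -> : (fun x => u x - - (v x - phi x)) = u \+ v \- phi by apply/funext => x /=; ring.
have cphi : (energy Om p (wgrad Om phi) < +oo)%E by exact: phi_fin.
have [u cu umin] := exists_minimizer n_gt0 oOm bOm mp q1 p_minus qp phi_W cphi.
have um : minimizer Om p phi u by split.
exists u; split; first exact/solE.
move=> w /solE wm.
exact: (minimizer_unique n_gt0 oOm bOm mp q1 p_minus qp phi_W cphi um wm).
Qed.
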